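(* Let $R=\bigoplus_{\alpha\in\Gamma}R_{\alpha}$ be a graded integral domain and let $\star$ be a semistar operation on $R$ such that $R^{\star}\subsetneq R_H$. Then the following statements are equivalent: (1) $R$ is a GP$\star$MD. (2) Every ideal of $\mathrm{NA}(R,\star)$ is extended from a homogeneous ideal of $R$ (i.e. is of the form $I\,\mathrm{NA}(R,\star)$ with $I$ a homogeneous ideal of $R$). (3) Every principal ideal of $\mathrm{NA}(R,\star)$ is extended from a homogeneous ideal of $R$. (4) $\mathrm{NA}(R,\star)$ is a Prüfer domain. (5) $\mathrm{NA}(R,\star)$ is a Bézout domain. (6) $\mathrm{NA}(R,\star)=\mathrm{KR}(R,\widetilde{\star})$. (7) $\mathrm{KR}(R,\widetilde{\star})$ is a quotient ring (ring of fractions) of $R[X]$. (8) $\mathrm{KR}(R,\widetilde{\star})$ is a flat $R[X]$-module. (9) $I^{\widetilde{\star}}=I^{(\widetilde{\star})_a}$ for each nonzero homogeneous finitely generated ideal $I$ of $R$. In particular, if $R$ is a GP$\star$MD, then $R^{\widetilde{\star}}$ is integrally closed.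
   Context: $\Gamma$ is a commutative cancellative monoid (written additively) whose quotient group $\langle\Gamma\rangle=\{a-b:a,b\in\Gamma\}$ is torsion-free. A graded integral domain $R=\bigoplus_{\alpha\in\Gamma}R_\alpha$ is an integral domain that is the direct sum of additive subgroups $R_\alpha$ with $R_\alpha R_\beta\subseteq R_{\alpha+\beta}$. $K$ is the quotient field of $R$, $H$ is the (saturated multiplicative) set of nonzero homogeneous elements of $R$, and $R_H$ (the homogeneous quotient field) is graded by $\langle\Gamma\rangle$. For $a\in R_H$, $C(a)$ is the $R$-submodule of $R_H$ generated by the homogeneous components of $a$; for $f=f_0+f_1X+\cdots+f_nX^n\in R_H[X]$ ($X$ an indeterminate), $A_f:=\sum_{i=0}^n C(f_i)$. An ideal $I$ of $R$ is homogeneous if $I=\bigoplus_\alpha(I\cap R_\alpha)$. $\overline{\mathcal F}(R)$ is the set of nonzero $R$-submodules of $K$, $f(R)$ the set of nonzero finitely generated fractional ideals of $R$. A semistar operation on $R$ is a map $\star:\overline{\mathcal F}(R)\to\overline{\mathcal F}(R)$, $E\mapsto E^\star$, such that for all $0\ne x\in K$ and $E,F\in\overline{\mathcal F}(R)$: $(xE)^\star=xE^\star$; $E\subseteq F\Rightarrow E^\star\subseteq F^\star$; $E\subseteq E^\star$; $(E^\star)^\star=E^\star$. $\star_f$ is defined by $E^{\star_f}=\bigcup\{F^\star: F\in f(R), F\subseteq E\}$. $\widetilde\star$ is defined by $E^{\widetilde\star}=\{x\in K: xJ\subseteq E$ for some finitely generated ideal $J\subseteq R$ with $J^\star=R^\star\}$.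 For a semistar operation $\star$, $\star_a$ is defined by $F^{\star_a}=\bigcup\{((FG)^\star:G^\star): G\in f(R)\}$ for $F\in f(R)$ (where $(A:B)=\{x\in K: xB\subseteq A\}$) and $E^{\star_a}=\bigcup\{F^{\star_a}: F\in f(R), F\subseteq E\}$ for $E\in\overline{\mathcal F}(R)$. A nonzero fractional ideal $I$ is $\star_f$-invertible if $(I(R:I))^{\star_f}=R^\star$. $R$ is a GP$\star$MD (graded Prüfer $\star$-multiplication domain) if every nonzero finitely generated homogeneous ideal of $R$ is $\star_f$-invertible. $N(\star):=\{f\in R[X]: f\ne0,\ A_f^\star=R^\star\}$ (a multiplicatively closed set) and $\mathrm{NA}(R,\star):=R[X]_{N(\star)}$. For a semistar operation $\star$ on $R$, $\mathrm{KR}(R,\star):=\{f/g: f,g\in R[X], g\neq0$, and there is $0\ne h\in R[X]$ with $A_fA_h\subseteq (A_gA_h)^\star\}$. *)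

(* Defs.v *)
From HB Require Import structures.
From mathcomp Require Import all_boot all_order all_algebra fraction.
Set Implicit Arguments. Unset Strict Implicit. Unset Printing Implicit Defensive.
Import GRing.Theory.
Local Open Scope ring_scope.

Section Sets.
Variable L : fieldType.
Implicit Types (E F D : L -> Prop) (x : L).

Definition subs E F := forall x, E x -> F x.
Definition seteq E F := forall x, E x <-> F x.
Definition nonzero E := exists x, E x /\ x != 0.
Definition scaleset x E : L -> Prop := fun z => exists y, E y /\ z = x * y.
Definition mulset E F : L -> Prop := fun z =>
  exists a b : seq L, size a = size b /\
    (forall i, (i < size a)%N -> E a`_i /\ F b`_i) /\
    z = \sum_(i < size a) a`_i * b`_i.
Definition colon E F : L -> Prop := fun x => forall y, F y -> E (x * y).
Definition addset E F : L -> Prop := fun z => exists x y, E x /\ F y /\ z = x + y.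
Definition zeroset : L -> Prop := fun z => z = 0.
Definition dspan D (xs : seq L) : L -> Prop := fun z =>
  exists c : nat -> L, (forall i, D (c i)) /\ z = \sum_(i < size xs) c i * xs`_i.
Definition submod D E :=
  [/\ E 0, (forall x y, E x -> E y -> E (x + y)) & (forall r x, D r -> E x -> E (r * x))].

Definition ideal D E := subs E D /\ submod D E.
Definition fgideal D E := ideal D E /\ exists xs : seq L, (forall i, (i < size xs)%N -> D xs`_i) /\ seteq E (dspan D xs).
Definition principal D E := exists x, D x /\ seteq E (dspan D [:: x]).
Definition invertible D E := seteq (mulset E (colon D E)) D.
Definition prufer D := forall E, fgideal D E -> nonzero E -> invertible D E.
Definition bezout D := forall E, fgideal D E -> principal D E.
End Sets.

(* Gam : the grading monoid, seen inside a Z-module G (its quotient    *)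
(* group is <Gam> = {a - b}), Rg a = the homogeneous component R_a.    *)
Section Graded.
Variables (R : idomainType) (G : zmodType) (Gam : G -> Prop) (Rg : G -> R -> Prop).

Local Notation K := {fraction R}.
Definition emb (r : R) : K := FracField.tofrac r.

Definition decomp (r : R) (s : seq G) (f : G -> R) :=
  [/\ uniq s, (forall a, a \in s -> Rg a (f a)) & r = \sum_(a <- s) f a].

Definition graded_domain :=
  [/\
      Gam 0 /\ (forall a b, Gam a -> Gam b -> Gam (a + b)),
      (forall a b n, Gam a -> Gam b -> (0 < n)%N -> (a - b) *+ n = 0 -> a = b),
      (
      (forall a, Rg a 0 /\ (forall x y, Rg a x -> Rg a y -> Rg a (x - y))) /\
      (forall a x, Rg a x -> x != 0 -> Gam a) /\
      (forall a b x y, Rg a x -> Rg b y -> Rg (a + b) (x * y))),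
      (forall r, exists s f, decomp r s f) &
      (forall s f, uniq s -> (forall a, a \in s -> Rg a (f a)) ->
         \sum_(a <- s) f a = 0 -> forall a, a \in s -> f a = 0)].

Definition homogeneous (x : R) := exists a, Rg a x.

Definition Rset : K -> Prop := fun z => exists r : R, z = emb r.
Definition RH : K -> Prop := fun z =>
  exists a h : R, homogeneous h /\ h != 0 /\ z = emb a / emb h.

Definition Cset (r : R) : K -> Prop := fun z =>
  exists s f, decomp r s f /\ dspan Rset [seq emb (f a) | a <- s] z.
Definition Aset (p : {poly R}) : K -> Prop :=
  foldr (@addset K) (@zeroset K) [seq Cset p`_i | i <- iota 0 (size p)].

Definition idealR (I : R -> Prop) :=
  [/\ I 0, (forall x y, I x -> I y -> I (x + y)) & (forall r x, I x -> I (r * x))].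
Definition homogR (I : R -> Prop) :=
  forall r s f, I r -> decomp r s f -> forall a, a \in s -> I (f a).
Definition fgR (I : R -> Prop) := exists xs : seq R,
  forall x, I x <-> exists c : nat -> R, x = \sum_(i < size xs) c i * xs`_i.
Definition nonzeroR (I : R -> Prop) := exists x, I x /\ x != 0.
Definition embK (I : R -> Prop) : K -> Prop := fun z => exists r, I r /\ z = emb r.

Definition nzsub (E : K -> Prop) := submod Rset E /\ nonzero E.

Definition semistar (st : (K -> Prop) -> (K -> Prop)) :=
  [/\ (forall E, nzsub E -> nzsub (st E)),
      (forall x E, x != 0 -> nzsub E -> seteq (st (scaleset x E)) (scaleset x (st E))),
      (forall E F, nzsub E -> nzsub F -> subs E F -> subs (st E) (st F)),
      (forall E, nzsub E -> subs E (st E)) &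
      (forall E, nzsub E -> seteq (st (st E)) (st E))].

(* nonzero finitely generated R-submodules of K are the spans dspan Rset xs
   with xs containing a nonzero element *)
Definition star_f (st : (K -> Prop) -> (K -> Prop)) (E : K -> Prop) : K -> Prop :=
  fun x => exists xs : seq K, has (fun y => y != 0) xs /\
    subs (dspan Rset xs) E /\ st (dspan Rset xs) x.

Definition star_tilde (st : (K -> Prop) -> (K -> Prop)) (E : K -> Prop) : K -> Prop :=
  fun x => exists js : seq R, has (fun y => y != 0) js /\
    seteq (st (dspan Rset (map emb js))) (st Rset) /\
    subs (scaleset x (dspan Rset (map emb js))) E.

Definition star_a (st : (K -> Prop) -> (K -> Prop)) (E : K -> Prop) : K -> Prop :=
  fun x => exists xs : seq K, has (fun y => y != 0) xs /\ subs (dspan Rset xs) E /\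
    exists ys : seq K, has (fun y => y != 0) ys /\
      colon (st (mulset (dspan Rset xs) (dspan Rset ys))) (st (dspan Rset ys)) x.

Definition GPsMD (st : (K -> Prop) -> (K -> Prop)) :=
  forall I, idealR I -> homogR I -> fgR I -> nonzeroR I ->
    seteq (star_f st (mulset (embK I) (colon Rset (embK I)))) (st Rset).

Local Notation L := {fraction {poly R}}.
Definition embP (p : {poly R}) : L := FracField.tofrac p.

Definition NA (st : (K -> Prop) -> (K -> Prop)) : L -> Prop := fun z =>
  exists f g : {poly R}, g != 0 /\ seteq (st (Aset g)) (st Rset) /\ z = embP f / embP g.

Definition KR (st : (K -> Prop) -> (K -> Prop)) : L -> Prop := fun z =>
  exists f g : {poly R}, g != 0 /\
    (exists h : {poly R}, h != 0 /\
       subs (mulset (Aset f) (Aset h)) (st (mulset (Aset g) (Aset h)))) /\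
    z = embP f / embP g.

Definition extended (I : R -> Prop) (D : L -> Prop) : L -> Prop :=
  mulset (fun z => exists r, I r /\ z = embP r%:P) D.

Definition quotient_ring_of_RX (D : L -> Prop) :=
  exists S : {poly R} -> Prop, [/\ S 1, (forall a b, S a -> S b -> S (a * b)), ~ S 0 &
    seteq D (fun z => exists f s, S s /\ z = embP f / embP s)].

(* D (an R[X]-submodule of L) is a flat R[X]-module: equational criterion *)
Definition flat_RX (D : L -> Prop) :=
  forall n (a : 'I_n -> {poly R}) (b : 'I_n -> L),
    (forall i, D (b i)) -> \sum_i embP (a i) * b i = 0 ->
    exists m (c : 'I_n -> 'I_m -> {poly R}) (y : 'I_m -> L),
      [/\ (forall j, D (y j)),
          (forall i, b i = \sum_j embP (c i j) * y j) &
          (forall j, \sum_i a i * c i j = 0)].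

(* integral closedness of a subring D of K (whose quotient field is K) *)
Definition integrally_closed_in_K (D : K -> Prop) :=
  forall x : K, (exists p : {poly K}, [/\ p \is monic, (forall i, D p`_i) & root p x]) -> D x.

End Graded.

(* Main.v *)
(** Call a homogeneous ideal [J] of [R] big when [J^star = R^star].  All the statements become
    statements about containments [E J <= F] between finitely generated homogeneous fractional
    ideals with [J] big, because a graded submodule containing [e J] contains [e] times the ideal
    generated by the homogeneous components of [J].  The other main tool is the Dedekind-Mertens
    formula [A_f^(k+1) A_g <= A_f^k A_fg].  It is deduced from the one-variable formula by a
    Kronecker substitution, which exists because a finitely generated torsion-free group maps to
    the integers injectively on any given finite set.

    If [A_f] is invertible, with inverse the content of [q] up to a scalar, then [f q] lies in
    [N(star)] by Dedekind-Mertens, so [f NA = A_f NA]: this yields (2), (5) and (6).  Conversely an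
    inverse of [(a, b)] is read off in each case from explicit equations for [a + b X] in [NA] or
    [KR]; two generators suffice since [(A+B)(B+C)(C+A) = (A+B+C)(AB+BC+CA)].  From (8), flatness
    gives [1 = \sum_j c_j y_j] with [c_j b / (a + b X)] in [R[X]], and the determinant trick
    shows that the contents of the [c_j] generate a big ideal.  From (9), [c a b = r a^2 + s b^2]
    for [c] in a big ideal, and [r a / b], [s b / a] are integral with sum [c].

    For the last claim, an element integral over the tilde-closure of [R] is integral over the
    homogeneous quotient ring, which is integrally closed, so it is [w / d] with [d] homogeneous;
    its equation then gives [C(w) H <= d H] up to a big ideal for an invertible [H]. *)

From HB Require Import structures.
Require Import Defs.
From mathcomp Require Import all_boot all_order all_algebra fraction.
From mathcomp Require Import perm ring lra zify boolp.
Set Implicit Arguments. Unset Strict Implicit. Unset Printing Implicit Defensive.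
Import Order.TTheory GRing.Theory Num.Theory.
Local Open Scope ring_scope.

(** The setting is the ordered semiring of [R]-submodules of the quotient field, in which addition
    is idempotent; the identity for three ideals holds there, not between ring elements.
    Dedekind-Mertens leaves powers of contents on both sides of a containment. They are bounded by
    [1] when the content lies in [R], absorbed because powers of the summands of a big sum still
    have a big sum, or cancelled, either by invertibility or by a Nakayama argument. The
    tilde-closure is tested on arbitrary finitely generated ideals while inverses have to be
    homogeneous, so each argument needs a graded target before it can pass from the first kind to
    the second. The inclusion of [R^star] in the homogeneous quotient ring places the coefficients
    of an integral equation over the tilde-closure there. This forces a homogeneous denominator on
    the integral element, and only then are the ideals in its equation homogeneous, hence
    invertible. *)

Section Fractions.
Local Open Scope quotient_scope.
Lemma fracP (R : idomainType) (x : {fraction R}) : exists u v : R, v != 0 /\ x = emb u / emb v.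
Proof.
move: (reprK x); set y := repr x => <-.
have hd := denom_ratioP y; exists (frac y).1, (frac y).2; split=> //.
have hv' : emb (frac y).2 != 0 by rewrite tofrac_eq0.
apply: (mulIf hv'); rewrite divfK // /emb.
rewrite -[_ * _]/(FracField.mul _ _) !piE; apply/eqmodP; rewrite /= FracField.equivfE /FracField.mulf.
by rewrite !numden_Ratio ?mulf_neq0 ?oner_eq0 ?mulr1 // mulrC.
Qed.

End Fractions.

(** * Submodules of the quotient field *)

Section Seqs.
Variable L : fieldType.
Implicit Types (E F : L -> Prop).

Lemma mulset_sum E F (I : Type) (r : seq I) (u v : I -> L) :
  (forall i, E (u i)) -> (forall i, F (v i)) -> mulset E F (\sum_(i <- r) u i * v i).
Proof.
move=> hu hv; exists (map u r), (map v r); rewrite !size_map; split=> //; split.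
  case: r => [|i0 r] i hi; first by [].
  by rewrite !(nth_map i0) //; split.
case: r => [|i0 r]; first by rewrite big_nil big_ord0.
by rewrite (big_nth i0) big_mkord; apply: eq_bigr => i _; rewrite !(nth_map i0).
Qed.

Lemma mulset1 E F x y : E x -> F y -> mulset E F (x * y).
Proof.
move=> hx hy; have := @mulset_sum (fun z => E z) F unit [:: tt] (fun=> x) (fun=> y).
by rewrite big_seq1; apply.
Qed.

Lemma mulset_ind E F (P : L -> Prop) : P 0 -> (forall x y, P x -> P y -> P (x + y)) ->
  (forall x y, E x -> F y -> P (x * y)) -> forall z, mulset E F z -> P z.
Proof.
move=> P0 PD PM z [a [b [_ [h ->]]]].
elim/big_rec: _ => // i x _ hx; apply: PD => //; apply: PM; by case: (h i).
Qed.

Lemma mulset0 E F : mulset E F 0.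
Proof. by exists [::], [::]; do 2?split=> //; rewrite big_ord0. Qed.

Lemma mulsetD E F x y : mulset E F x -> mulset E F y -> mulset E F (x + y).
Proof.
case=> [a [b [sab [hab ->]]]] [a' [b' [sab' [hab' ->]]]].
exists (a ++ a'), (b ++ b'); rewrite !size_cat sab sab'; split=> //; split.
  move=> i hi; rewrite !nth_cat sab; case: ltnP => hib; first by apply: hab; rewrite sab.
  by apply: hab'; rewrite sab' ltn_subLR.
rewrite big_split_ord /=; congr (_ + _).
  by apply: eq_bigr => i _; rewrite !nth_cat sab ltn_ord.
by apply: eq_bigr => i _; rewrite !nth_cat sab ltnNge leq_addr /= addKn.
Qed.

Lemma dspan_ind (D : L -> Prop) xs (P : L -> Prop) : P 0 ->
  (forall x y, P x -> P y -> P (x + y)) -> (forall r x, D r -> x \in xs -> P (r * x)) ->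
  forall z, dspan D xs z -> P z.
Proof.
move=> P0 PD PM z [c [hc ->]].
elim/big_rec: _ => // i x _ hx; apply: PD => //; apply: PM => //; exact: mem_nth.
Qed.

Lemma dspan_submod (D : L -> Prop) xs : D 0 -> (forall x y, D x -> D y -> D (x + y)) ->
  (forall x y, D x -> D y -> D (x * y)) -> submod D (dspan D xs).
Proof.
move=> D0 DD DM; split.
- exists (fun=> 0); split=> //; rewrite big1 // => i _; by rewrite mul0r.
- move=> x y [c [hc ->]] [d [hd ->]]; exists (fun i => c i + d i); split.
    by move=> i; apply: DD.
  by rewrite -big_split; apply: eq_bigr => i _; rewrite mulrDl.
- move=> r x hr [c [hc ->]]; exists (fun i => r * c i); split.
    by move=> i; apply: DM.
  by rewrite mulr_sumr; apply: eq_bigr => i _; rewrite mulrA.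
Qed.

Lemma dspan_mem (D : L -> Prop) xs x : D 0 -> D 1 -> x \in xs -> dspan D xs x.
Proof.
move=> D0 D1 hx; have hi : (index x xs < size xs)%N by rewrite index_mem.
exists (fun i => if i == index x xs then 1 else 0); split.
  by move=> i; case: ifP.
rewrite (bigD1 (Ordinal hi)) //= eqxx mul1r nth_index // big1 ?addr0 // => i ni.
by rewrite ifN ?mul0r //; apply: contra ni => /eqP e; apply/eqP/val_inj.
Qed.
End Seqs.

Section Smod.
Variable R : idomainType.
Local Notation K := {fraction R}.
Local Notation emb := (@emb R).
Local Notation Rset := (@Rset R).

Lemma emb0 : emb 0 = 0. Proof. exact: rmorph0. Qed.
Lemma emb1 : emb 1 = 1. Proof. exact: rmorph1. Qed.
Lemma embD x y : emb (x + y) = emb x + emb y. Proof. exact: rmorphD. Qed.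
Lemma embM x y : emb (x * y) = emb x * emb y. Proof. exact: rmorphM. Qed.
Lemma embN x : emb (- x) = - emb x. Proof. exact: rmorphN. Qed.
Lemma emb_sum (I : Type) (r : seq I) (P : pred I) (F : I -> R) :
  emb (\sum_(i <- r | P i) F i) = \sum_(i <- r | P i) emb (F i).
Proof. exact: rmorph_sum. Qed.
Lemma emb_eq0 x : (emb x == 0) = (x == 0). Proof. exact: tofrac_eq0. Qed.
Lemma emb_inj : injective emb.
Proof. by move=> x y /eqP; rewrite /Defs.emb tofrac_eq => /eqP. Qed.

(** Bundled submodules with the same elements are equal ([leS_anti]), so they form a commutative
    semiring in which [ring] and the big operators are available. *)
Record smod := Smod {scar :> K -> Prop; _ : submod Rset scar}.
Implicit Types E F H : smod.

Lemma smodP E : submod Rset E. Proof. by case: E. Qed.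
Lemma smod0 E : E 0. Proof. by case: (smodP E). Qed.
Lemma smodD E x y : E x -> E y -> E (x + y). Proof. by case: (smodP E) => _ h _; apply: h. Qed.
Lemma smodZ E r x : E x -> E (emb r * x).
Proof. by case: (smodP E) => _ _ h; apply: h; exists r. Qed.
Lemma smodN E x : E x -> E (- x).
Proof. by move=> h; have := smodZ (-1) h; rewrite embN emb1 mulN1r. Qed.
Lemma smod_sum E (I : eqType) (r : seq I) (P : pred I) (f : I -> K) :
  (forall i, i \in r -> P i -> E (f i)) -> E (\sum_(i <- r | P i) f i).
Proof.
move=> h; rewrite big_seq_cond; elim/big_rec: _ => [|i x /andP[ir Pi] hx]; first exact: smod0.
by apply: smodD => //; apply: h.
Qed.

Definition leS E F := forall x, E x -> F x.
Local Infix "≤" := leS (at level 70, no associativity).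

Lemma leS_refl E : E ≤ E. Proof. by []. Qed.
Lemma leS_trans F E H : E ≤ F -> F ≤ H -> E ≤ H. Proof. by move=> h k x /h /k. Qed.
Lemma leS_anti E F : E ≤ F -> F ≤ E -> E = F.
Proof.
move: E F => [E hE] [F hF] /= h k; have e : E = F.
  by apply/funext => x; apply/propext; split; [apply: h|apply: k].
by subst F; congr Smod; apply: Prop_irrelevance.
Qed.
Lemma smod_ext E F : seteq E F -> E = F.
Proof. by move=> h; apply: leS_anti => x; case: (h x). Qed.

HB.instance Definition _ := gen_eqMixin smod.
HB.instance Definition _ := gen_choiceMixin smod.

Lemma zero_submod : submod Rset (@zeroset K).
Proof.
by split=> //; [move=> x y -> ->; rewrite /zeroset addr0 | move=> r x _ ->; rewrite /zeroset mulr0].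
Qed.
Lemma one_submod : submod Rset Rset.
Proof.
split; first by exists 0; rewrite emb0.
  by move=> x y [a ->] [b ->]; exists (a + b); rewrite embD.
by move=> x y [a ->] [b ->]; exists (a * b); rewrite embM.
Qed.
Lemma add_submod E F : submod Rset (addset E F).
Proof.
split; first by exists 0, 0; do !split; rewrite ?addr0 //; apply: smod0.
  move=> x y [a [b [ha [hb ->]]]] [c [d [hc [hd ->]]]]; exists (a + c), (b + d).
  by split; [|split]; [exact: smodD| exact: smodD|rewrite addrACA].
move=> r x [u ->] [a [b [ha [hb ->]]]]; exists (emb u * a), (emb u * b).
by split; [|split]; [exact: smodZ| exact: smodZ|rewrite mulrDr].
Qed.
Lemma mul_submod E F : submod Rset (mulset E F).
Proof.
split; [exact: mulset0|exact: mulsetD|].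
move=> _ x [r ->]; elim/mulset_ind; first by rewrite mulr0; apply: mulset0.
  by move=> a b ha hb; rewrite mulrDr; apply: mulsetD.
by move=> a b ha hb; rewrite mulrA; apply: mulset1 => //; apply: smodZ.
Qed.

Definition szero := Smod zero_submod.
Definition sone := Smod one_submod.
Definition sadd E F := Smod (add_submod E F).
Definition smul E F := Smod (mul_submod E F).

Lemma saddA : associative sadd.
Proof.
move=> E F H; apply: smod_ext => z; split.
  move=> [x [y [hx [[u [v [hu [hv ->]]]] ->]]]]; exists (x + u), v; split; first by exists x, u.
  by rewrite addrA.
move=> [x [y [[u [v [hu [hv ->]]]] [hy ->]]]]; exists u, (v + y); split=> //; split; first by exists v, y.
by rewrite addrA.
Qed.
Lemma saddC : commutative sadd.
Proof.
move=> E F; apply: smod_ext => z; split=> -[x [y [hx [hy ->]]]]; exists y, x; by rewrite addrC.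
Qed.
Lemma sadd0 : left_id szero sadd.
Proof.
move=> E; apply: smod_ext => z; split; first by move=> [x [y [-> [hy ->]]]]; rewrite add0r.
by move=> hz; exists 0, z; rewrite add0r.
Qed.
Lemma smulC : commutative smul.
Proof.
by move=> E F; apply: smod_ext => z; split; elim/mulset_ind;
  [exact: mulset0|exact: mulsetD|move=> x y hx hy; rewrite mulrC; apply: mulset1|
   exact: mulset0|exact: mulsetD|move=> x y hx hy; rewrite mulrC; apply: mulset1].
Qed.
Lemma smulA_le E F H : smul E (smul F H) ≤ smul (smul E F) H.
Proof.
move=> z; elim/mulset_ind; [exact: mulset0|exact: mulsetD|].
move=> x y hx; elim/mulset_ind; first by rewrite mulr0; exact: mulset0.
  by move=> u v hu hv; rewrite mulrDr; apply: mulsetD.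
by move=> u v hu hv; rewrite mulrA; apply: mulset1 => //; apply: mulset1.
Qed.
Lemma smulA : associative smul.
Proof.
move=> E F H; apply: leS_anti; first exact: smulA_le.
by rewrite smulC [smul E F]smulC [smul E _]smulC [smul F H]smulC; apply: smulA_le.
Qed.
Lemma smul1 : left_id sone smul.
Proof.
move=> E; apply: smod_ext => z; split.
  elim/mulset_ind; [exact: smod0|exact: smodD|].
  by move=> _ y [r ->] hy; apply: smodZ.
by move=> hz; rewrite -[z]mul1r; apply: mulset1 => //; exists 1; rewrite emb1.
Qed.
Lemma smul0 : left_zero szero smul.
Proof.
move=> E; apply: smod_ext => z; split; last by move=> ->; apply: mulset0.
elim/mulset_ind => //; [by move=> x y -> ->; rewrite /zeroset /= addr0|].
by move=> x y -> _; rewrite /zeroset /= mul0r.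
Qed.
Lemma smulDl : left_distributive smul sadd.
Proof.
move=> E F H; apply: smod_ext => z; split.
  elim/mulset_ind; [exact: smod0|exact: smodD|].
  move=> _ y [u [v [hu [hv ->]]]] hy; exists (u * y), (v * y).
  by split; [apply: mulset1|split; [apply: mulset1|rewrite mulrDl]].
move=> [x [y [hx [hy ->]]]]; apply: mulsetD.
  elim/mulset_ind: hx; [exact: mulset0|exact: mulsetD|].
  move=> u v hu hv; apply: mulset1 => //; exists u, 0; split=> //; split; [exact: smod0|by rewrite addr0].
elim/mulset_ind: hy; [exact: mulset0|exact: mulsetD|].
move=> u v hu hv; apply: mulset1 => //; exists 0, u; split; [exact: smod0|by rewrite add0r].
Qed.

HB.instance Definition _ := GRing.isNmodule.Build smod saddA saddC sadd0.
HB.instance Definition _ := GRing.Nmodule_isComPzSemiRing.Build smod smulA smulC smul1 smulDl smul0.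

Lemma mulSE E F : scar (E * F) = mulset E F. Proof. by []. Qed.

Lemma leS_addl E F : E ≤ E + F.
Proof. move=> x hx; exists x, 0; rewrite addr0; do !split=> //; exact: smod0. Qed.
Lemma leS_addr E F : F ≤ E + F.
Proof. by rewrite addrC; apply: leS_addl. Qed.
Lemma leS_add E F H : E ≤ H -> F ≤ H -> E + F ≤ H.
Proof. by move=> h k x [u [v [hu [hv ->]]]]; apply: smodD; [apply: h|apply: k]. Qed.
Lemma leS_addS E E' F F' : E ≤ E' -> F ≤ F' -> E + F ≤ E' + F'.
Proof.
move=> h k; apply: leS_add; [apply: leS_trans h _; apply: leS_addl|apply: leS_trans k _; apply: leS_addr].
Qed.
Lemma addSS E : E + E = E.
Proof. by apply: leS_anti; [apply: leS_add|apply: leS_addl]. Qed.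
Lemma leS_mul E E' F F' : E ≤ E' -> F ≤ F' -> E * F ≤ E' * F'.
Proof.
move=> h k z; elim/mulset_ind; [exact: mulset0|exact: mulsetD|].
by move=> x y /h hx /k hy; apply: mulset1.
Qed.
Lemma leS_mull (H : smod) E F : E ≤ F -> H * E ≤ H * F. Proof. by move=> h; apply: leS_mul. Qed.
Lemma leS_mulr H E F : E ≤ F -> E * H ≤ F * H. Proof. by move=> h; apply: leS_mul. Qed.
Arguments leS_mull H [E F].
Arguments leS_mulr H [E F].
Lemma leS_exp n E F : E ≤ F -> E ^+ n ≤ F ^+ n.
Proof. by move=> h; elim: n => // n ih; rewrite !exprS; apply: leS_mul. Qed.
Lemma leS0 E : 0 ≤ E. Proof. by move=> x ->; apply: smod0. Qed.
Lemma mulS_le E F H : (forall x y, E x -> F y -> H (x * y)) -> E * F ≤ H.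
Proof. move=> h z; elim/mulset_ind; [exact: smod0|exact: smodD|exact: h]. Qed.
Lemma mulS_mem E F x y : E x -> F y -> scar (E * F) (x * y).
Proof. exact: mulset1. Qed.
Lemma expS_le1 n E : E ≤ 1 -> E ^+ n ≤ 1.
Proof. by move=> h; rewrite -[X in _ ≤ X](expr1n _ n); apply: leS_exp. Qed.
Lemma mulS_le1l E F : E ≤ 1 -> E * F ≤ F.
Proof. by move=> h; rewrite -{2}[F]mul1r; apply: leS_mulr. Qed.
Lemma mulS_le1r E F : E ≤ 1 -> F * E ≤ F.
Proof. by move=> h; rewrite -{2}[F]mulr1; apply: leS_mull. Qed.
Lemma leS_sum (I : eqType) (r : seq I) (f : I -> smod) E :
  (forall i, i \in r -> f i ≤ E) -> \sum_(i <- r) f i ≤ E.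
Proof.
move=> h; rewrite big_seq; elim/big_rec: _ => [|i F ir hF]; first exact: leS0.
by apply: leS_add => //; apply: h.
Qed.
Lemma leS_bigsum (I : eqType) (r : seq I) (f : I -> smod) i :
  i \in r -> f i ≤ \sum_(j <- r) f j.
Proof. by move=> h; rewrite (big_rem i) //=; apply: leS_addl. Qed.

Lemma scale_submod x E : submod Rset (scaleset x E).
Proof.
split; first by exists 0; rewrite mulr0; split=> //; apply: smod0.
  by move=> a b [u [hu ->]] [v [hv ->]]; exists (u + v); split; [apply: smodD|rewrite mulrDr].
by move=> _ a [r ->] [u [hu ->]]; exists (emb r * u); split; [apply: smodZ|rewrite mulrCA].
Qed.
Definition prin (x : K) := Smod (scale_submod x sone).

Lemma prinP x z : prin x z <-> exists r, z = x * emb r.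
Proof. by split=> [[_ [[r ->] ->]]|[r ->]]; [exists r|exists (emb r); split=> //; exists r]. Qed.
Lemma prin_id x : prin x x.
Proof. by apply/prinP; exists 1; rewrite emb1 mulr1. Qed.
Lemma prin_le x E : prin x ≤ E <-> E x.
Proof.
split=> [h|h z /prinP[r ->]]; first by apply: h; apply: prin_id.
by rewrite mulrC; apply: smodZ.
Qed.
Lemma prinM x y : prin (x * y) = prin x * prin y.
Proof.
apply: leS_anti; first by apply/prin_le; apply: mulS_mem; apply: prin_id.
apply: mulS_le => _ _ /prinP[r ->] /prinP[s ->]; apply/prinP; exists (r * s).
by rewrite embM mulrACA.
Qed.
Lemma prin1 : prin 1 = 1.
Proof.
apply: leS_anti; first by apply/prin_le; exists 1; rewrite emb1.
by move=> _ [r ->]; apply/prinP; exists r; rewrite mul1r.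
Qed.
Lemma prin0 : prin 0 = 0.
Proof. by apply: leS_anti; [apply/prin_le|apply: leS0]. Qed.
Lemma prinX x n : prin (x ^+ n) = prin x ^+ n.
Proof. by elim: n => [|n ih]; rewrite ?expr0 ?prin1 // !exprS prinM ih. Qed.
Lemma prin_mulE x E : scar (prin x * E) = scaleset x E.
Proof.
apply/funext => z; apply/propext; split.
  move: z; apply: (@mulS_le _ _ (Smod (scale_submod x E))) => _ y /prinP[r ->] hy.
  by exists (emb r * y); rewrite mulrA; split=> //; apply: smodZ.
by move=> [y [hy ->]]; apply: mulS_mem => //; apply: prin_id.
Qed.
Lemma prin_mulP x E z : scar (prin x * E) z <-> exists y, E y /\ z = x * y.
Proof. by rewrite prin_mulE. Qed.
Lemma prinVl x : x != 0 -> prin x^-1 * prin x = 1.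
Proof. by move=> hx; rewrite -prinM mulVf // prin1. Qed.
Lemma prin_cancel x E F : x != 0 -> prin x * E ≤ prin x * F -> E ≤ F.
Proof.
move=> hx /(leS_mull (prin x^-1)); by rewrite !mulrA prinVl // !mul1r.
Qed.
Lemma prin_le1 r : prin (emb r) ≤ 1.
Proof. by apply/prin_le; exists r. Qed.
Lemma prin_mul_le x E F : prin x * E ≤ F <-> (forall y, E y -> F (x * y)).
Proof.
split=> [h y hy|h z /prin_mulP[y [hy ->]]]; last exact: h.
by apply: h; apply/prin_mulP; exists y.
Qed.

Definition span (xs : seq K) : smod := \sum_(x <- xs) prin x.

Lemma span_mem xs x : x \in xs -> span xs x.
Proof. by move=> h; apply: (leS_bigsum (f := prin) h); apply: prin_id. Qed.
Lemma span_le xs E : span xs ≤ E <-> (forall x, x \in xs -> E x).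
Proof.
split=> [h x hx|h]; first by apply: h; apply: span_mem.
by apply: leS_sum => x hx; apply/prin_le; apply: h.
Qed.
Lemma spanE xs : scar (span xs) = dspan Rset xs.
Proof.
have hs := dspan_submod xs (smod0 1) (@smodD 1) (fun x y => let: And3 _ _ h := smodP 1 in h x y).
apply/funext => z; apply/propext; split.
  move: z; apply: (proj2 (span_le xs (Smod hs))) => x hx.
  by apply: dspan_mem => //; [exact: smod0|exists 1; rewrite emb1].
elim/dspan_ind; [exact: smod0|exact: smodD|].
by move=> _ x [r ->] hx; apply: smodZ; apply: span_mem.
Qed.
Lemma span_cat xs ys : span (xs ++ ys) = span xs + span ys.
Proof. exact: big_cat. Qed.
Lemma span_mul xs ys : span xs * span ys = span [seq x * y | x <- xs, y <- ys].
Proof.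
rewrite /span big_allpairs_dep big_distrl; apply: eq_bigr => x _.
by rewrite /= big_distrr; apply: eq_bigr => y _; rewrite prinM.
Qed.
Lemma span_scale a xs : prin a * span xs = span [seq a * x | x <- xs].
Proof. by rewrite /span big_map big_distrr /=; apply: eq_bigr => y _; rewrite prinM. Qed.
Lemma span1 x : span [:: x] = prin x.
Proof. exact: big_seq1. Qed.
Lemma span2 x y : span [:: x; y] = prin x + prin y.
Proof. by rewrite /span big_cons big_seq1. Qed.

Lemma neq0S E : E != 0 <-> exists x, E x /\ x != 0.
Proof.
split=> [|[x [hx nx]]]; last first.
  by apply: contra nx => /eqP e; apply/eqP; move: hx; rewrite e.
move=> nE; apply: contrapT => h; move/negP: nE; apply; apply/eqP.
apply: leS_anti; last exact: leS0.
by move=> x hx; apply: contrapT => nx; apply: h; exists x; split=> //; apply/eqP.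
Qed.
Lemma prin_neq0 x : x != 0 -> prin x != 0.
Proof. by move=> h; apply/neq0S; exists x; split=> //; apply: prin_id. Qed.
Lemma mulS_neq0 E F : E != 0 -> F != 0 -> E * F != 0.
Proof.
move=> /neq0S[x [hx nx]] /neq0S[y [hy ny]]; apply/neq0S; exists (x * y); split.
  exact: mulS_mem.
by rewrite mulf_neq0.
Qed.
Lemma leS_neq0 E F : E ≤ F -> E != 0 -> F != 0.
Proof. by move=> h /neq0S[x [/h hx nx]]; apply/neq0S; exists x. Qed.
Lemma expS_neq0 E n : E != 0 -> E ^+ n != 0.
Proof.
by move=> h; elim: n => [|n ih]; rewrite ?expr0 -?prin1 ?prin_neq0 ?oner_neq0 // exprS mulS_neq0.
Qed.
Lemma span_neq0 xs : span xs != 0 <-> has (fun y => y != 0) xs.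
Proof.
split=> [|/hasP[x hx nx]]; last by apply/neq0S; exists x; split=> //; apply: span_mem.
apply: contraTT => /hasPn h; rewrite negbK; apply/eqP; rewrite /span big_seq big1 // => x /h.
by rewrite negbK => /eqP ->; rewrite prin0.
Qed.

(** Every term of the expansion other than [E ^+ m] has a factor [F], and the remaining factors lie
    in [R]. This lets a summand of a big ideal be replaced by its power. *)
Lemma expS_add E F m : E ≤ 1 -> F ≤ 1 -> (E + F) ^+ m ≤ E ^+ m + F.
Proof.
move=> hE hF; elim: m => [|m ih]; first by rewrite !expr0; apply: leS_addl.
rewrite exprSr; apply: leS_trans (leS_mulr _ ih) _.
rewrite mulrDl mulrDr -exprSr -addrA; apply: leS_addS => //.
apply: leS_add; first by apply: mulS_le1l; apply: expS_le1.
by apply: mulS_le1r; apply: leS_add.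
Qed.
End Smod.
Arguments prin {R}. Arguments span {R}. Arguments leS {R}.
Arguments leS_mull {R} H [E F]. Arguments leS_mulr {R} H [E F].
Arguments leS_addl {R} E F. Arguments leS_addr {R} E F. Arguments leS_refl {R} E.
Arguments leS_exp {R} n [E F]. Arguments expS_le1 {R} n [E]. Arguments leS0 {R} E. Arguments expS_add {R} [E F] m.
Arguments prin_le1 {R} r.
Notation "E ≤ F" := (leS E F) (at level 70, no associativity).

(** * The Dedekind-Mertens formula in one variable *)

Section Content.
Variable R : idomainType.
Local Notation emb := (@emb R).
Implicit Types (E B : smod R) (F H : {poly R}).

(** The ordinary content, blind to the grading; [spread_cont] and [spread_exists] compare it with
    the graded content [A]. *)
Definition cont F : smod R := \sum_(i <- iota 0 (size F)) prin (emb F`_i).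

Lemma cont_mem F i : cont F (emb F`_i).
Proof.
case: (ltnP i (size F)) => hi; last by rewrite nth_default // emb0; apply: smod0.
apply: (leS_bigsum (f := fun i => prin (emb F`_i)) (i := i)); last exact: prin_id.
by rewrite mem_iota.
Qed.
Lemma cont_le F E : cont F ≤ E <-> (forall i, E (emb F`_i)).
Proof.
split=> [h i|h]; first by apply: h; apply: cont_mem.
by apply: leS_sum => i _; apply/prin_le.
Qed.
Lemma contB F H : cont (F - H) ≤ cont F + cont H.
Proof.
apply/cont_le => i; rewrite coefB embD embN; apply: smodD.
  by apply: leS_addl; apply: cont_mem.
by apply: smodN; apply: leS_addr; apply: cont_mem.
Qed.
Arguments contB : clear implicits.
Lemma contXM a n F : cont (a *: 'X^n * F) ≤ prin (emb a) * cont F.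
Proof.
apply/cont_le => i; rewrite -scalerAl coefZ coefXnM embM.
case: ifP => _; first by rewrite emb0 mulr0; apply: smod0.
by apply/prin_mulP; exists (emb F`_(i - n)); split=> //; apply: cont_mem.
Qed.
Arguments contXM : clear implicits.
Lemma cont0 : cont 0 = 0.
Proof. by rewrite /cont size_poly0 big_nil. Qed.

Lemma coef_strip n F i : (size F <= n.+1)%N ->
  (F - F`_n *: 'X^n)`_i = if (i < n)%N then F`_i else 0.
Proof.
move=> hF; rewrite coefB coefZ coefXn; case: ltngtP => [hi|hi|->].
- by rewrite mulr0 subr0.
- by rewrite mulr0 subr0 nth_default // (leq_trans hF).
- by rewrite mulr1 subrr.
Qed.
Lemma size_strip n F : (size F <= n.+1)%N -> (size (F - F`_n *: 'X^n)%R <= n)%N.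
Proof. by move=> hF; apply/leq_sizeP => i hi; rewrite coef_strip // ltnNge hi. Qed.
Lemma cont_strip_le n F : (size F <= n.+1)%N -> cont (F - F`_n *: 'X^n) ≤ cont F.
Proof.
move=> hF; apply/cont_le => i; rewrite coef_strip //.
by case: ifP => _; [apply: cont_mem|rewrite emb0; apply: smod0].
Qed.
Lemma cont_strip n F : (size F <= n.+1)%N ->
  cont F ≤ prin (emb F`_n) + cont (F - F`_n *: 'X^n).
Proof.
move=> hF; apply/cont_le => i; have [hi|hi|->] := ltngtP i n.
- apply: leS_addr; suff -> : F`_i = (F - F`_n *: 'X^n)`_i by apply: cont_mem.
  by rewrite coef_strip // hi.
- by rewrite [F`_i]nth_default ?(leq_trans hF) // emb0; apply: smod0.
- by apply: leS_addl; apply: prin_id.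
Qed.

(** A product of generators of [X] and [E'] either contains one from [X] or lies in the power of
    [E']. It serves for a top coefficient here and for a denominator in the proof of integral
    closedness. *)
Lemma exp_split (E E' X : smod R) k : E ≤ X + E' -> X ≤ E -> E' ≤ E ->
  E ^+ k.+1 ≤ X * E ^+ k + E' ^+ k.+1.
Proof.
move=> h hX hE; elim: k => [|k ih]; first by rewrite !expr1 expr0 mulr1.
rewrite exprSr; apply: (leS_trans (leS_mulr _ ih)); rewrite mulrDl; apply: leS_add.
  by rewrite -mulrA -exprSr; apply: leS_addl.
apply: (leS_trans (leS_mull _ h)); rewrite mulrDr; apply: leS_addS.
  by rewrite mulrC; apply: leS_mull; apply: leS_exp.
by rewrite -exprSr; apply: leS_refl.
Qed.

Arguments exp_split [E E' X] k.

(** [F * H'] and [F' * H] differ from [F * H] by a shifted multiple of [F] and of [H], so the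
    inductive hypotheses hold for [F * H] up to terms with a factor [y] or [x]. These terms are
    driven towards [x * y], which lies in [B]. For [k = 0] the polynomial [H'] vanishes, hence the
    trivial case of the hypothesis. *)
Lemma dm_step k n F H (F' := F - F`_n *: 'X^n) (H' := H - H`_k *: 'X^k) :
  (size F <= n.+1)%N -> (size H <= k.+1)%N ->
  (if k is k'.+1 then cont F ^+ k * cont H' ≤ cont F ^+ k' * cont (F * H') else True) ->
  cont F' ^+ k.+1 * cont H ≤ cont F' ^+ k * cont (F' * H) ->
  cont F ^+ k.+1 * cont H ≤ cont F ^+ k * cont (F * H).
Proof.
move=> sF sH hk hn; set A := cont F; set B := cont (F * H).
set x := prin (emb F`_n); set y := prin (emb H`_k).
have xA : x ≤ A by apply/prin_le; apply: cont_mem.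
have A'A : cont F' ≤ A by apply: cont_strip_le.
have xyB : x * y ≤ B.
  rewrite -prinM -embM; apply/prin_le.
  suff -> : F`_n * H`_k = (F * H)`_(n + k) by apply: cont_mem.
  rewrite coefM (bigD1 (inord n)) //= inordK ?ltnS ?leq_addr // addKn big1 ?addr0 // => i ni.
  have [hi|hi|hi] := ltngtP i n.
  - by rewrite [H`_ _]nth_default ?mulr0 // (leq_trans sH) // ltn_subRL ltn_add2r.
  - by rewrite [F`_ _]nth_default ?mul0r // (leq_trans sF).
  - by case/eqP: ni; apply/val_inj; rewrite /= inordK // ltnS leq_addr.
have FH' : cont (F * H') ≤ B + y * A.
  rewrite /H' mulrBr; apply: (leS_trans (contB _ _)); apply: leS_addS; first exact: leS_refl.
  by rewrite mulrC; apply: contXM.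
have F'H : cont (F' * H) ≤ B + x * cont H.
  rewrite /F' mulrBl; apply: (leS_trans (contB _ _)); apply: leS_addS; first exact: leS_refl.
  exact: contXM.
(* The hypothesis for [H'], multiplied by [A], leaves only the error [A ^+ k.+1 * y]. *)
have ha : A ^+ k.+1 * cont H' ≤ A ^+ k * B + A ^+ k.+1 * y.
  case: k @y @H' hk sH hn B xyB FH' F'H => [|k] y H' hk sH hn B xyB FH' F'H.
    suff -> : cont H' = 0 by rewrite mulr0; apply: leS0.
    have := size_strip sH; rewrite leqn0 size_poly_eq0 => /eqP e.
    by rewrite /H' e cont0.
  rewrite [X in X ≤ _](_ : _ = A * (A ^+ k.+1 * cont H')); last by rewrite exprS mulrA.
  apply: (leS_trans (leS_mull _ hk)); rewrite mulrA -exprS.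
  apply: (leS_trans (leS_mull _ FH')); rewrite mulrDr; apply: leS_addS => //.
  by rewrite (exprS A k.+1) -mulrA [y * A]mulrC mulrCA.
(* With [x] in place of one factor [A], the error term acquires the product [x * y] and disappears
   into [B]. *)
have hb : A ^+ k * (x * cont H') ≤ A ^+ k * B.
  case: k @y @H' hk sH hn B xyB FH' F'H ha => [|k] y H' hk sH hn B xyB FH' F'H ha.
    suff -> : cont H' = 0 by rewrite !mulr0; apply: leS0.
    have := size_strip sH; rewrite leqn0 size_poly_eq0 => /eqP e.
    by rewrite /H' e cont0.
  rewrite mulrCA; apply: (leS_trans (leS_mull x hk)).
  apply: (leS_trans (leS_mull x (leS_mull _ FH'))).
  rewrite (_ : x * _ = x * (A ^+ k * B) + A ^+ k.+1 * (x * y)); last by rewrite exprS; ring.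
  apply: leS_add; last exact: leS_mull.
  by rewrite exprS -mulrA; apply: leS_mulr.
(* [A ^+ k.+1] is split by [exp_split]: the part with a factor [x] meets [y], and the part in [F']
   is handled by the hypothesis for [F'], whose error term falls to [xyB] and [hb]. *)
have hy : A ^+ k.+1 * y ≤ A ^+ k * B.
  apply: (leS_trans (leS_mulr _ (exp_split k (cont_strip sF) xA A'A))).
  rewrite mulrDl; apply: leS_add.
    by rewrite mulrAC mulrC; apply: leS_mull.
  apply: (@leS_trans _ (cont F' ^+ k.+1 * cont H)).
    by apply: leS_mull; apply/prin_le; apply: cont_mem.
  apply: leS_trans hn _; apply: (leS_trans (leS_mulr _ (leS_exp k A'A))).
  apply: (leS_trans (leS_mull _ F'H)); rewrite mulrDr; apply: leS_add; first exact: leS_refl.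
  apply: (leS_trans (leS_mull _ (leS_mull _ (cont_strip sH)))).
  rewrite !mulrDr; apply: leS_add => //; exact: leS_mull.
apply: (leS_trans (leS_mull _ (cont_strip sH))); rewrite mulrDr; apply: leS_add => //.
by apply: leS_trans ha _; apply: leS_add.
Qed.

(* Dedekind-Mertens by double induction: strip the top coefficients [y] of [H] and [x] of [F];
   [x * y] is a coefficient of [F * H]. *)
Lemma dedekind_mertens k F H : (size H <= k.+1)%N ->
  cont F ^+ k.+1 * cont H ≤ cont F ^+ k * cont (F * H).
Proof.
elim: k F H => [|k IH] F H; move: (leqnn (size F)); move: {2}(size F) => n; elim: n F => [|n IHn] F;
  try (by rewrite leqn0 size_poly_eq0 => /eqP -> _; rewrite cont0 exprS !mul0r; apply: leS0);
  move=> sF sH; apply: (dm_step sF sH) => //; try (by apply: IHn => //; apply: size_strip).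
by apply: IH; apply: size_strip.
Qed.
End Content.

(** * Separating degrees in torsion-free groups *)

Section TorsionFree.
Variables (G : zmodType) (Hs : G -> Prop).
Hypothesis Hs0 : Hs 0.
Hypothesis HsB : forall x y, Hs x -> Hs y -> Hs (x - y).
Hypothesis Hs_tf : forall x n, Hs x -> (0 < n)%N -> x *+ n = 0 -> x = 0.

Definition zspan k (b : 'I_k -> G) (x : G) := exists c : 'I_k -> int, x = \sum_i b i *~ c i.
Definition zindep k (b : 'I_k -> G) :=
  forall c : 'I_k -> int, \sum_i b i *~ c i = 0 -> forall i, c i = 0.

Lemma zspan0 k (b : 'I_k -> G) : zspan b 0.
Proof. by exists (fun=> 0); rewrite big1. Qed.
Lemma zspanD k (b : 'I_k -> G) x y : zspan b x -> zspan b y -> zspan b (x + y).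
Proof.
move=> [c ->] [d ->]; exists (fun i => c i + d i).
by rewrite -big_split; apply: eq_bigr => i _; rewrite mulrzDr.
Qed.
Lemma zspanZ k (b : 'I_k -> G) x n : zspan b x -> zspan b (x *~ n).
Proof.
move=> [c ->]; exists (fun i => c i * n).
by rewrite mulrz_suml; apply: eq_bigr => i _; rewrite mulrzA_C mulrC mulrzA.
Qed.

Lemma HsN x : Hs x -> Hs (- x). Proof. by move=> h; rewrite -sub0r; apply: HsB. Qed.
Lemma HsD x y : Hs x -> Hs y -> Hs (x + y).
Proof. by move=> h k; rewrite -[y]opprK; apply: HsB => //; apply: HsN. Qed.
Lemma HsZ x n : Hs x -> Hs (x *~ n).
Proof.
move=> h; have hn m : Hs (x *+ m) by elim: m => // m ih; rewrite mulrS; apply: HsD.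
by case: n => n; [apply: hn|apply: HsN; apply: hn].
Qed.
Lemma Hs_tfz x (n : int) : Hs x -> n != 0 -> x *~ n = 0 -> x = 0.
Proof.
case: n => n hx hn e; first by apply: (Hs_tf hx _ e); lia.
by apply: (Hs_tf (n := n.+1) hx) => //; apply/eqP; rewrite -oppr_eq0; apply/eqP.
Qed.

(* Euclid's algorithm on the coefficients of a nontrivial relation ends in a relation
   with one nonzero coefficient, whose generator vanishes by torsion-freeness. *)
Lemma zbasis k (d : 'I_k -> G) : (forall i, Hs (d i)) ->
  exists m (b : 'I_m -> G), zindep b /\ forall i, zspan b (d i).
Proof.
elim: k d => [|k IH] d hd; first by exists 0%N, d; split=> [c _ []|[]].
have [hi|] := pselect (zindep d).
  exists k.+1, d; split=> // i; exists (fun j => (j == i)%:Z).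
  by rewrite (bigD1 i) //= eqxx mulr1z big1 ?addr0 // => j /negbTE ->.
move/existsNP => [c /not_implyP[hc /existsNP[i0 /eqP hi0]]].
(* The descent is on the sum of the absolute values of the coefficients of the relation. *)
move: (leqnn (\sum_i `|c i|)%N); move: {2}(\sum_i _)%N => N.
elim: N d hd c hc i0 hi0 => [|N IHN] d hd c hc i0 hi0 hN.
  by move: hN; rewrite (bigD1 i0) //=; lia.
have [/existsP[j0 /andP[nj hj]]|/existsPn hno] := boolP [exists j, (j != i0) && (c j != 0)]; last first.
  have d0 : d i0 = 0.
    apply: (Hs_tfz (hd i0) hi0); rewrite -[RHS]hc (bigD1 i0) //= big1 ?addr0 // => j nj.
    by have := hno j; rewrite nj negbK => /eqP ->.
  have [m [b [hb hs]]] := IH (fun j => d (lift i0 j)) (fun j => hd _).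
  exists m, b; split=> // i; case: (unliftP i0 i) => [j ->|->]; first exact: hs.
  by rewrite d0; apply: zspan0.
have [i [j [nij [hi [hj' hij]]]]] : exists i j, j != i /\ c i != 0 /\ c j != 0 /\ (`|c j| <= `|c i|)%N.
  have [h|h] := leqP `|c j0| `|c i0|; first by exists i0, j0.
  by exists j0, i0; rewrite eq_sym; do !split=> //; apply: ltnW.
(* This sign makes the new coefficient [c i - e * c j] smaller than [c i] in absolute value. Adding
   [e] times [d i] to [d j] preserves both the relation and the group generated. *)
pose e : int := sgz (c i) * sgz (c j).
pose d' l := if l == j then d j + d i *~ e else d l.
pose c' l := if l == i then c i - e * c j else c l.
have hd' l : Hs (d' l) by rewrite /d'; case: ifP => // _; apply: HsD => //; apply: HsZ.
have hc' : \sum_l d' l *~ c' l = 0.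
  rewrite -[RHS]hc (bigD1 i) //= (bigD1 j) //= [RHS](bigD1 i) //= [in RHS](bigD1 j) //= !addrA.
  congr (_ + _); last first.
    by apply: eq_bigr => l /andP[n1 n2]; rewrite /d' /c' (negbTE n1) (negbTE n2).
  rewrite /d' /c' !eqxx (negbTE nij) eq_sym (negbTE nij) mulrzBr mulrzDl -mulrzA.
  by rewrite [d j *~ _ + _]addrC addrA subrK.
have [||m [b [hb hs]]] := IHN d' hd' c' hc' j; first by rewrite /c' (negbTE nij).
  rewrite -ltnS; apply: leq_trans hN; rewrite (bigD1 i) //= [X in (_ < X)%N](bigD1 i) //=.
  rewrite [X in (_ + X < _)%N](eq_bigr (fun l => `|c l|%N)); last first.
    by move=> l nl; rewrite /c' (negbTE nl).
  rewrite ltn_add2r /c' eqxx /e; move: hi hj' hij.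
  by case: (sgzP (c i)) => //; case: (sgzP (c j)) => //; lia.
exists m, b; split=> // l; have := hs l; rewrite /d'; case: ifP => // /eqP -> h.
have -> : d j = d j + d i *~ e + d i *~ (- e) by rewrite -addrA -mulrzDr subrr addr0.
apply: zspanD => //; apply: zspanZ.
by have := hs i; rewrite /d' eq_sym (negbTE nij).
Qed.

Lemma poly_nonroot (Q : {poly int}) : Q != 0 -> exists M : int, Q.[M] != 0.
Proof.
move=> nQ; apply: contrapT => h.
have hr M : root Q M by apply/negPn/negP => hM; apply: h; exists M.
have := max_poly_roots nQ (rs := [seq i%:Z | i <- iota 0 (size Q)]).
rewrite size_map size_iota ltnn => H; suff : false by []; apply: H.
  by apply/allP => x _; apply: hr.
by rewrite map_inj_uniq ?iota_uniq // => x y [].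
Qed.

(** Coordinates in a basis of the group generated by [D] become the coefficients of an integer
    polynomial, which is evaluated at a point where no difference of two distinct polynomials from
    [D] vanishes. [P] is the group generated by that basis, outside which the coordinates carry no
    meaning. *)
Lemma separating_degree (D : seq G) : (forall d, d \in D -> Hs d) ->
  exists (P : G -> Prop) (phi : G -> int),
  [/\ P 0 /\ (forall d, d \in D -> P d), (forall x y, P x -> P y -> P (x + y)),
      (forall x y, P x -> P y -> phi (x + y) = phi x + phi y) &
      {in D &, injective phi}].
Proof.
move=> hD; have [m [b [hb hs]]] := @zbasis (size D) (tnth (in_tuple D)) (fun i => hD _ (mem_tnth i (in_tuple D))).
(* Outside the span the coordinates default to zero; additivity is claimed only inside it. *)
have co_ x : exists c : 'I_m -> int, zspan b x -> x = \sum_i b i *~ c i.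
  by have [[c e]|n] := pselect (zspan b x); [exists c|exists (fun=> 0)].
pose co x := projT1 (cid (co_ x)).
have coP x : zspan b x -> x = \sum_i b i *~ co x i by rewrite /co; case: cid.
have coD x y i : zspan b x -> zspan b y -> co (x + y) i = co x i + co y i.
  move=> hx hy; apply/eqP; rewrite -subr_eq0; apply/eqP.
  apply: (hb (fun i => co (x + y) i - (co x i + co y i))).
  under eq_bigr do rewrite mulrzBr mulrzDr.
  by rewrite sumrB big_split /= -!coP ?subrr //; apply: zspanD.
pose p x : {poly int} := \poly_(i < m) (if insub i is Some j then co x j else 0).
have pD x y : zspan b x -> zspan b y -> p (x + y) = p x + p y.
  move=> hx hy; apply/polyP => i; rewrite coefD !coef_poly; case: ltnP => // hi.
  by rewrite insubT coD.
have pI x y : zspan b x -> zspan b y -> p x = p y -> x = y.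
  move=> hx hy e; rewrite (coP x) // (coP y) //; apply: eq_bigr => i _; congr (_ *~ _).
  by have := congr1 (fun q : {poly int} => q`_i) e; rewrite !coef_poly ltn_ord valK.
have hDs d : d \in D -> zspan b d.
  move=> hd; have hi : (index d D < size D)%N by rewrite index_mem.
  by have := hs (Ordinal hi); rewrite (tnth_nth 0) /= nth_index.
pose Q : {poly int} := \prod_(x <- D) \prod_(y <- D | p x != p y) (p x - p y).
have [M hM] : exists M : int, Q.[M] != 0.
  apply: poly_nonroot; rewrite prodf_seq_neq0; apply/allP => x _ /=.
  by rewrite prodf_seq_neq0; apply/allP => y _ /=; apply/implyP; rewrite subr_eq0.
exists (zspan b), (fun x => (p x).[M]); split=> //.
- by split=> //; apply: zspan0.
- exact: zspanD.
- by move=> x y hx hy; rewrite pD // hornerD.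
- move=> x y hx hy e; apply: pI; try exact: hDs.
  apply/eqP; apply: contraNT hM => n; rewrite /Q horner_prod.
  rewrite (big_rem x) //= horner_prod (big_rem y) //= n hornerD hornerN e subrr.
  by rewrite !mul0r.
Qed.
End TorsionFree.

(** * Homogeneous components and contents *)

Section Grading.
Variables (R : idomainType) (G : zmodType) (Gam : G -> Prop) (Rg : G -> R -> Prop).
Hypothesis hgr : graded_domain Gam Rg.
Local Notation K := {fraction R}.
Local Notation emb := (@emb R).
Local Notation hom := (homogeneous Rg).
Implicit Types p q : {poly R}.

Lemma Rg0 a : Rg a 0.
Proof. by case: hgr => _ _ [h _] _ _; case: (h a). Qed.
Lemma RgB a x y : Rg a x -> Rg a y -> Rg a (x - y).
Proof. by case: hgr => _ _ [h _] _ _; case: (h a) => _; apply. Qed.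
Lemma RgN a x : Rg a x -> Rg a (- x).
Proof. by move=> h; rewrite -sub0r; apply: RgB => //; apply: Rg0. Qed.
Lemma RgD a x y : Rg a x -> Rg a y -> Rg a (x + y).
Proof. by move=> hx hy; rewrite -[y]opprK; apply: RgB => //; apply: RgN. Qed.
Lemma RgM a b x y : Rg a x -> Rg b y -> Rg (a + b) (x * y).
Proof. by case: hgr => _ _ [_ [_ h]] _ _; apply: h. Qed.
Lemma Rg_Gam a x : Rg a x -> x != 0 -> Gam a.
Proof. by case: hgr => _ _ [_ [h _]] _ _; apply: h. Qed.

Lemma decomp_exists r : exists sf : seq G * (G -> R), decomp Rg r sf.1 sf.2.
Proof. by case: hgr => _ _ _ h _; case: (h r) => s [f e]; exists (s, f). Qed.
(** One decomposition is chosen for each element, possibly with zero terms; [comp_uniq] makes the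
    components independent of the choice. *)
Definition supp r : seq G := (projT1 (cid (decomp_exists r))).1.
Definition comp r a : R := if a \in supp r then (projT1 (cid (decomp_exists r))).2 a else 0.

Lemma supp_uniq r : uniq (supp r).
Proof. by rewrite /supp; case: cid => -[s f] []. Qed.
Lemma comp_Rg r a : Rg a (comp r a).
Proof.
by rewrite /comp /supp; case: cid => -[s f] [/= _ h _]; case: ifP => [/h|_] //; apply: Rg0.
Qed.
Lemma comp_hom r a : hom (comp r a). Proof. by exists a; apply: comp_Rg. Qed.
Lemma comp_sum r : r = \sum_(a <- supp r) comp r a.
Proof.
rewrite {1}(_ : r = \sum_(a <- supp r) (projT1 (cid (decomp_exists r))).2 a).
  by rewrite !big_seq; apply: eq_bigr => a h; rewrite /comp h.
by rewrite /supp; case: cid => -[s f] [].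
Qed.
Lemma comp_notin r a : a \notin supp r -> comp r a = 0.
Proof. by rewrite /comp => /negbTE ->. Qed.
Lemma decomp_comp r : decomp Rg r (supp r) (comp r).
Proof. by split; [exact: supp_uniq|move=> a _; exact: comp_Rg|exact: comp_sum]. Qed.

Lemma sum_sub (s t : seq G) (f : G -> R) : uniq s -> uniq t -> {subset s <= t} ->
  \sum_(a <- t) (if a \in s then f a else 0) = \sum_(a <- s) f a.
Proof.
move=> us ut st; rewrite -big_mkcond -big_filter; apply: perm_big.
apply: uniq_perm => //; first exact: filter_uniq.
by move=> a; rewrite mem_filter; case: (boolP (a \in s)) => // /st ->.
Qed.

(** On a common support [t] containing [a], the two decompositions subtract to a decomposition of
    zero. *)
Lemma comp_uniq r s f a : decomp Rg r s f -> comp r a = if a \in s then f a else 0.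
Proof.
case=> us hs e; pose t := undup (a :: s ++ supp r).
have ut : uniq t by apply: undup_uniq.
have := hgr => -[_ _ _ _ /(_ t (fun b => comp r b - (if b \in s then f b else 0)) ut) h].
apply/eqP; rewrite -subr_eq0; apply/eqP; apply: h.
- move=> b _; apply: RgB; first exact: comp_Rg.
  by case: ifP => [/hs|_] //; apply: Rg0.
- rewrite sumrB (@sum_sub s) //; last by move=> b hb; rewrite mem_undup inE mem_cat hb orbT.
  rewrite -e; suff -> : \sum_(b <- t) comp r b = r by rewrite subrr.
  rewrite [RHS]comp_sum -(@sum_sub (supp r) t) ?supp_uniq //.
    by apply: eq_bigr => b _; case: ifP => // /negbT /comp_notin ->.
  by move=> b hb; rewrite mem_undup inE mem_cat hb !orbT.
- by rewrite mem_undup inE eqxx.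
Qed.

Lemma compD x y a : comp (x + y) a = comp x a + comp y a.
Proof.
pose t := undup (a :: supp x ++ supp y).
have ut : uniq t by apply: undup_uniq.
rewrite (@comp_uniq _ t (fun b => comp x b + comp y b)) ?mem_undup ?inE ?eqxx //.
split=> //; first by move=> b _; apply: RgD; apply: comp_Rg.
rewrite big_split /= {1}(comp_sum x) {1}(comp_sum y).
congr (_ + _).
  rewrite -(@sum_sub (supp x) t (comp x)) ?supp_uniq //.
    by apply: eq_bigr => b _; case: ifP => // /negbT /comp_notin ->.
  by move=> b hb; rewrite mem_undup inE mem_cat hb !orbT.
rewrite -(@sum_sub (supp y) t (comp y)) ?supp_uniq //.
  by apply: eq_bigr => b _; case: ifP => // /negbT /comp_notin ->.
by move=> b hb; rewrite mem_undup inE mem_cat hb !orbT.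
Qed.
Lemma compE x a b : Rg a x -> comp x b = if b == a then x else 0.
Proof.
move=> hx; rewrite (@comp_uniq _ [:: a] (fun=> x)) ?inE //.
by split=> //; [move=> c; rewrite inE => /eqP ->|rewrite big_seq1].
Qed.
Lemma comp0 a : comp 0 a = 0.
Proof. by rewrite (compE (a := a) a) ?eqxx //; apply: Rg0. Qed.
Lemma comp_big (I : Type) (r : seq I) (P : pred I) (F : I -> R) a :
  comp (\sum_(i <- r | P i) F i) a = \sum_(i <- r | P i) comp (F i) a.
Proof.
apply: (big_morph (comp^~ a)); [by move=> x y; apply: compD|exact: comp0].
Qed.
Lemma compMl b x r c : Rg b x -> comp (x * r) c = x * comp r (c - b).
Proof.
move=> hx; rewrite {1}(comp_sum r) mulr_sumr comp_big.
have e a : comp (x * comp r a) c = if c == b + a then x * comp r a else 0.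
  by apply: compE; apply: RgM => //; apply: comp_Rg.
rewrite (eq_bigr _ (fun a _ => e a)) => {e}.
have [h|h] := boolP (c - b \in supp r).
  rewrite (bigD1_seq (c - b)) ?supp_uniq //= subrKC eqxx big1 ?addr0 // => a na.
  by case: eqP => // e; move: na; rewrite e addrC addKr eqxx.
rewrite [in RHS]comp_notin // mulr0 big_seq big1 // => a ha; case: eqP => // e.
by move: h; rewrite e addrC addKr ha.
Qed.

(** The grading axioms do not place [1] in degree zero. If [comp 1 b] is nonzero, then
    [comp 1 b * 1] is homogeneous of degree [b], so every component of [1] in a nonzero degree is
    killed by [comp 1 b] and vanishes in the domain. *)
Lemma Rg1 : Rg 0 1.
Proof.
have [b hb] : exists b, comp 1 b != 0.
  apply: contrapT => h; have /eqP := oner_neq0 R; apply.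
  by rewrite (comp_sum 1) big1 // => b _; apply/eqP/negPn/negP => k; apply: h; exists b.
have h a : a != 0 -> comp 1 a = 0.
  move=> na; have := @compMl b (comp 1 b) 1 (b + a) (comp_Rg _ _).
  rewrite mulr1 (compE (b + a) (comp_Rg 1 b)) addrC -{2}[b]add0r (inj_eq (addIr b)) (negbTE na) addrK.
  by move/esym/eqP; rewrite mulf_eq0 (negbTE hb) => /eqP.
rewrite [X in Rg _ X](_ : _ = comp 1 0); first exact: comp_Rg.
rewrite {1}(comp_sum 1); have [h0|h0] := boolP (0 \in supp 1).
  by rewrite (bigD1_seq 0) ?supp_uniq //= big1 ?addr0.
rewrite comp_notin // big_seq big1 // => a ha; apply: h.
by apply: contraNneq h0 => <-.
Qed.
Lemma hom1 : hom 1. Proof. by exists 0; apply: Rg1. Qed.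
Lemma hom0 : hom 0. Proof. by exists 0; apply: Rg0. Qed.
Lemma homM x y : hom x -> hom y -> hom (x * y).
Proof. by move=> [a ha] [b hb]; exists (a + b); apply: RgM. Qed.

Definition C r : smod R := span [seq emb (comp r a) | a <- supp r].
Lemma C_mem r a : C r (emb (comp r a)).
Proof.
have [h|h] := boolP (a \in supp r); first by apply: span_mem; apply: map_f.
by rewrite comp_notin // emb0; apply: smod0.
Qed.
Lemma C_le r (E : smod R) : C r ≤ E <-> forall a, E (emb (comp r a)).
Proof.
split=> [h a|h]; first by apply: h; apply: C_mem.
by apply/span_le => _ /mapP[a _ ->].
Qed.
Lemma C_id r : C r (emb r).
Proof.
by rewrite {2}(comp_sum r) emb_sum; apply: smod_sum => a _ _; apply: C_mem.
Qed.
Lemma CsetE r : Cset Rg r = scar (C r).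
Proof.
apply/funext => z; apply/propext; split.
  move=> [s [f [d]]]; rewrite -spanE; move: z; apply/span_le => _ /mapP[a ha ->].
  have := C_mem r a; by rewrite (comp_uniq a d) ha.
by move=> hz; exists (supp r), (comp r); split; [exact: decomp_comp|rewrite -spanE].
Qed.

Definition A (p : {poly R}) : smod R := \sum_(i <- iota 0 (size p)) C p`_i.
Lemma AsetE p : Aset Rg p = scar (A p).
Proof.
rewrite /Aset /A; elim: (iota _ _) => [|i s ih] /=; first by rewrite big_nil.
by rewrite ih big_cons CsetE.
Qed.
Lemma C0 : C 0 = 0.
Proof.
apply: leS_anti; last exact: leS0.
by apply/C_le => a; rewrite comp0 emb0.
Qed.
Lemma A_coef p i : C p`_i ≤ A p.
Proof.
have [hi|hi] := ltnP i (size p).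
  by apply: (leS_bigsum (f := fun i => C p`_i)); rewrite mem_iota.
by rewrite nth_default // C0; apply: leS0.
Qed.
Arguments A_coef : clear implicits.
Lemma A_mem p i a : A p (emb (comp p`_i a)).
Proof. by apply: (A_coef p i); apply: C_mem. Qed.
Lemma A_le p (E : smod R) : A p ≤ E <-> forall i a, E (emb (comp p`_i a)).
Proof.
split=> [h i a|h]; first by apply: h; apply: A_mem.
by apply: leS_sum => i _; apply/C_le.
Qed.
Lemma A_id p i : A p (emb p`_i).
Proof. by apply: (A_coef p i); apply: C_id. Qed.
Lemma A_le1 p : A p ≤ 1.
Proof. by apply/A_le => i a; exists (comp p`_i a). Qed.
Lemma A_D p q : A (p + q) ≤ A p + A q.
Proof.
apply/A_le => i a; rewrite coefD compD embD; apply: smodD.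
  by apply: leS_addl; apply: A_mem.
by apply: leS_addr; apply: A_mem.
Qed.
Arguments A_D : clear implicits.
Lemma C_M x y : C (x * y) ≤ C x * C y.
Proof.
apply/C_le => c; rewrite [X in comp (X * _)](comp_sum x) [X in comp X _]mulr_suml comp_big emb_sum.
apply: smod_sum => a _ _; rewrite (compMl _ _ (comp_Rg x a)) embM.
by apply: mulS_mem; apply: C_mem.
Qed.
Arguments C_M : clear implicits.
Lemma A_M p q : A (p * q) ≤ A p * A q.
Proof.
apply/A_le => i a; rewrite coefM comp_big emb_sum; apply: smod_sum => j _ _.
apply: (@leS_mul _ _ _ _ _ (A_coef p j) (A_coef q (i - j)%N)); apply: C_M; exact: C_mem.
Qed.
Arguments A_M : clear implicits.
Lemma A_sum (I : Type) (r : seq I) (f : I -> {poly R}) :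
  A (\sum_(i <- r) f i) ≤ \sum_(i <- r) A (f i).
Proof.
elim: r => [|i r ih]; last by rewrite !big_cons; apply: (leS_trans (A_D _ _)); apply: leS_addS.
by rewrite !big_nil; apply/A_le => i a; rewrite coef0 comp0 emb0.
Qed.
Arguments A_sum : clear implicits.
Lemma A_Z c p : hom c -> A (c *: p) = prin (emb c) * A p.
Proof.
move=> [b hb]; apply: leS_anti.
  apply/A_le => i a; rewrite coefZ (compMl _ _ hb) embM.
  by apply: mulS_mem; [apply: prin_id|apply: A_mem].
rewrite /A big_distrr; apply: leS_sum => i _; rewrite /= /C span_scale.
apply/span_le => _ /mapP[_ /mapP[a _ ->] ->].
suff -> : comp p`_i a = comp p`_i (b + a - b) by rewrite -embM -(compMl _ _ hb) -coefZ; apply: A_mem.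
by rewrite addrC addKr.
Qed.

Lemma A_const r : A r%:P = C r.
Proof.
apply: leS_anti; last by rewrite -{1}[r](coefC r 0); apply: A_coef.
apply/A_le => i a; rewrite coefC; case: ifP => _; first exact: C_mem.
by rewrite comp0 emb0; apply: smod0.
Qed.
Lemma C_hom c : hom c -> C c = prin (emb c).
Proof.
move=> [b hb]; apply: leS_anti; last by apply/prin_le; apply: C_id.
apply/C_le => a; rewrite (compE _ hb); case: ifP => _; first exact: prin_id.
by rewrite emb0; apply: smod0.
Qed.
Lemma A_1 : A 1 = 1.
Proof. by rewrite -polyC1 A_const (C_hom hom1) emb1 prin1. Qed.
Lemma A_neq0 p : p != 0 -> A p != 0.
Proof.
move=> np; apply/neq0S; exists (emb (lead_coef p)).
by rewrite lead_coefE emb_eq0 -lead_coefE lead_coef_eq0; split=> //; apply: A_id.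
Qed.
(** Shifting [q] past the last coefficient of [p] avoids any overlap, so one polynomial carries both
    contents. [combine_contents] iterates this. *)
Lemma A_catl p q n : (size p <= n)%N -> A p ≤ A (p + 'X^n * q).
Proof.
move=> hn; apply/A_le => i a; have [hi|hi] := ltnP i n.
  suff -> : p`_i = (p + 'X^n * q)`_i by apply: A_mem.
  by rewrite coefD coefXnM hi addr0.
by rewrite nth_default ?(leq_trans hn) // comp0 emb0; apply: smod0.
Qed.
Lemma A_catr p q n : (size p <= n)%N -> A q ≤ A (p + 'X^n * q).
Proof.
move=> hn; apply/A_le => i a.
suff -> : q`_i = (p + 'X^n * q)`_(n + i) by apply: A_mem.
by rewrite coefD coefXnM ltnNge leq_addr /= addKn [p`_ _]nth_default ?add0r // (leq_trans hn) ?leq_addr.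
Qed.
Lemma hom_A_le p h : hom h -> h != 0 -> A p ≤ prin (emb h) -> exists q, p = h *: q.
Proof.
move=> hh nh hp; have hc i : exists r, p`_i = h * r.
  have /prinP[r e] := hp _ (A_id p i); exists r; apply: emb_inj; by rewrite embM.
exists (\poly_(i < size p) projT1 (cid (hc i))); apply/polyP => i; rewrite coefZ coef_poly.
case: ltnP => hi; first by case: cid.
by rewrite mulr0 nth_default.
Qed.

(** * Kronecker substitution *)

Section Spread.
Variables (P : G -> Prop) (phi : G -> int) (N : nat).
Hypothesis PD : forall x y, P x -> P y -> P (x + y).
Hypothesis phiD : forall x y, P x -> P y -> phi (x + y) = phi x + phi y.

(** The shift [M] is meant to make degrees nonnegative, and [N] is the base of a two-digit
    expansion: the shifted degree is the low digit and the exponent of [X] the high one. *)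
Definition key M (k : G * nat) : nat := (`|(phi k.1 + M%:Z)%R| + k.2 * N)%N.
(* Kronecker substitution: [f] is a sum of terms [x X^i] with [x] homogeneous of degree [a],
   and [F] is the corresponding sum of the [x X^(phi a + M + i N)]. *)
Definition spread M (f F : {poly R}) := exists l : seq (G * nat * R),
  [/\ (forall t, t \in l -> P t.1.1 /\ Rg t.1.1 t.2 /\ 0 <= phi t.1.1 + M%:Z),
      f = \sum_(t <- l) t.2 *: 'X^(t.1.2) & F = \sum_(t <- l) t.2 *: 'X^(key M t.1)].

Lemma spreadD M f F g H : spread M f F -> spread M g H -> spread M (f + g) (F + H).
Proof.
move=> [l [hl -> ->]] [l' [hl' -> ->]]; exists (l ++ l'); rewrite !big_cat; split=> // t.
by rewrite mem_cat => /orP[/hl|/hl'].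
Qed.
Lemma spread0 M : spread M 0 0.
Proof. by exists [::]; rewrite !big_nil. Qed.
Lemma spread_sum M (I : Type) (r : seq I) (f F : I -> {poly R}) :
  (forall i, spread M (f i) (F i)) -> spread M (\sum_(i <- r) f i) (\sum_(i <- r) F i).
Proof. by move=> h; elim/big_rec2: _ => [|i y1 y2 _]; [exact: spread0|exact: spreadD]. Qed.
(** Keys add because [phi] is additive on [P], and the shifts add with them. No injectivity of keys
    is involved, so distinct terms of the product are free to collide. *)
Lemma spreadM M M' f F g H : spread M f F -> spread M' g H -> spread (M + M') (f * g) (F * H).
Proof.
move=> [l [hl -> ->]] [l' [hl' -> ->]].
exists [seq (t.1.1 + u.1.1, (t.1.2 + u.1.2)%N, t.2 * u.2) | t <- l, u <- l']; split.
- move=> _ /allpairsP[[t u] [/= /hl[h1 [h2 h3]] /hl'[k1 [k2 k3]] ->]] /=.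
  by split; [exact: PD|split; [exact: RgM|rewrite phiD // PoszD addrACA addr_ge0]].
- rewrite big_allpairs_dep big_distrl; apply: eq_bigr => t _ /=.
  rewrite big_distrr; apply: eq_bigr => u _ /=.
  by rewrite -scalerAl -scalerAr scalerA -exprD.
- rewrite big_allpairs_dep big_distrl big_seq [RHS]big_seq; apply: eq_bigr => t /hl[h1 [h2 h3]] /=.
  rewrite big_distrr big_seq [RHS]big_seq; apply: eq_bigr => u /hl'[k1 [k2 k3]] /=.
  rewrite -scalerAl -scalerAr scalerA -exprD; congr (_ *: 'X^_).
  rewrite /key /= phiD // mulnDl addnACA; congr (_ + _)%N.
  apply/eqP; rewrite -eqz_nat !PoszD !gez0_abs //; first by rewrite addrACA.
  by rewrite addrACA addr_ge0.
Qed.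
(** Terms with equal degree and exponent are grouped into a component of [f]; different components
    may still share a key, so a coefficient of [F] is a sum of components. That is enough for
    [spread_cont]. *)
Lemma spread_coef M f F e : spread M f F ->
  exists s : seq (G * nat), F`_e = \sum_(k <- s | key M k == e) comp f`_k.2 k.1.
Proof.
move=> [l [hl ef eF]]; exists (undup [seq t.1 | t <- l]).
have hc k : comp f`_k.2 k.1 = \sum_(t <- l | t.1 == k) t.2.
  rewrite ef coef_sum comp_big [RHS]big_mkcond big_seq [RHS]big_seq; apply: eq_bigr => t /hl[_ [ht _]].
  rewrite coefZ coefXn; case: t ht k => [[b j] x] /= ht [a i] /=.
  rewrite xpair_eqE; case: (i =P j) => [->|n]; last first.
    by rewrite mulr0 comp0; case: (j =P i) => [ji|_]; [case: n|rewrite andbF].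
  by rewrite mulr1 (compE _ ht) eqxx andbT eq_sym.
under eq_bigr => k _ do rewrite hc.
rewrite (exchange_big_dep xpredT) //= eF coef_sum big_seq [RHS]big_seq; apply: eq_bigr => t ht.
rewrite coefZ coefXn big_mkcond (bigD1_seq t.1) ?undup_uniq ?mem_undup ?map_f //= eqxx andbT big1.
  by rewrite addr0 eq_sym; case: eqP => _; rewrite ?mulr1 ?mulr0.
by move=> k nk; rewrite [t.1 == k]eq_sym (negbTE nk) andbF.
Qed.
Lemma spread_cont M f F : spread M f F -> cont F ≤ A f.
Proof.
move=> h; apply/cont_le => e; have [s ->] := spread_coef e h.
by rewrite emb_sum; apply: smod_sum => k _ _; apply: A_mem.
Qed.
Lemma spread_0 M F : spread M 0 F -> F = 0.
Proof.
move=> h; apply/polyP => e; have [s ->] := spread_coef e h.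
by rewrite coef0 big1 // => k _; rewrite coef0 comp0.
Qed.
End Spread.
End Grading.
Arguments A_coef {R G Gam Rg} hgr p i. Arguments A_D {R G Gam Rg} hgr p q.
Arguments A_M {R G Gam Rg} hgr p q. Arguments C_M {R G Gam Rg} hgr x y.
Arguments A_sum {R G Gam Rg} hgr [I] r f.
Arguments A_le1 {R G Gam Rg} hgr p.

(** * The graded Dedekind-Mertens formula and the homogeneous quotient ring *)

Section DedekindMertens.
Variables (R : idomainType) (G : zmodType) (Gam : G -> Prop) (Rg : G -> R -> Prop).
Hypothesis hgr : graded_domain Gam Rg.
Local Notation K := {fraction R}.
Local Notation emb := (@emb R).
Local Notation hom := (homogeneous Rg).
Local Notation comp := (comp hgr).
Local Notation supp := (supp hgr).
Local Notation A := (A hgr).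
Implicit Types f g p q : {poly R}.

Definition degrees f : seq G :=
  [seq a | i <- iota 0 (size f), a <- [seq a <- supp f`_i | comp f`_i a != 0]].

Lemma degreesP f i a : comp f`_i a != 0 -> a \in degrees f.
Proof.
move=> h; have hi : (i < size f)%N.
  by rewrite ltnNge; apply: contra h => hi; rewrite nth_default // comp0.
apply/allpairsPdep; exists i, a; rewrite mem_iota mem_filter h; split=> //.
by apply: contraNT h => /comp_notin ->.
Qed.
Lemma degrees_Gam f a : a \in degrees f -> Gam a.
Proof.
move=> /allpairsPdep[i [b [_ hb ->]]]; move: hb; rewrite mem_filter => /andP[h _].
exact: (Rg_Gam hgr (comp_Rg hgr _ _) h).
Qed.

Lemma separating_grading (D : seq G) : (forall a, a \in D -> Gam a) ->
  exists (P : G -> Prop) (phi : G -> int) (M N : nat),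
  [/\ P 0 /\ (forall d, d \in D -> P d), (forall x y, P x -> P y -> P (x + y)),
      (forall x y, P x -> P y -> phi (x + y) = phi x + phi y),
      {in D &, injective phi} &
      forall d, d \in D -> 0 <= phi d + M%:Z /\ (`|(phi d + M%:Z)%R| < N)%N].
Proof.
move=> hD; have [[Gam0 GamD] tf _ _ _] := hgr.
pose Hs x := exists a b, Gam a /\ Gam b /\ x = a - b.
have Hs0 : Hs 0 by exists 0, 0; rewrite subrr.
have HsB x y : Hs x -> Hs y -> Hs (x - y).
  move=> [a [b [ha [hb ->]]]] [c [d [hc [hd ->]]]]; exists (a + d), (b + c).
  by split; [exact: GamD|split; [exact: GamD|rewrite opprB opprD addrACA]].
have Htf x n : Hs x -> (0 < n)%N -> x *+ n = 0 -> x = 0.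
  by move=> [a [b [ha [hb ->]]]] hn /(tf _ _ _ ha hb hn) ->; rewrite subrr.
have hDs d : d \in D -> Hs d by move=> /hD h; exists d, 0; rewrite subr0.
have [P [phi [hP PD phiD phiI]]] := separating_degree Hs0 HsB Htf hDs.
pose M := (\sum_(d <- D) `|phi d|)%N.
have hM d : d \in D -> (`|phi d| <= M)%N by move=> h; rewrite /M (big_rem d) //= leq_addr.
(* Since [M] bounds every absolute value of [phi] on [D], the shifted degrees lie between [0] and
   [2 * M]. *)
exists P, phi, M, (2 * M).+1; split=> // d /hM.
by move: (phi d) (M) => z m; lia.
Qed.

Section Canonical.
Variables (P : G -> Prop) (phi : G -> int) (M N : nat) (D : seq G).
Hypothesis DP : forall d, d \in D -> P d.
Hypothesis phiI : {in D &, injective phi}.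
Hypothesis phiM : forall d, d \in D -> 0 <= phi d + M%:Z /\ (`|(phi d + M%:Z)%R| < N)%N.

Lemma key_inj a i b j : a \in D -> b \in D -> key phi N M (a, i) = key phi N M (b, j) -> a = b /\ i = j.
Proof.
move=> ha hb; rewrite /key /=; have [a0 aN] := phiM ha; have [b0 bN] := phiM hb => e.
have N0 : (0 < N)%N by apply: leq_ltn_trans aN.
have ij : i = j.
  have := congr1 (divn^~ N) e; rewrite /= addnC divnMDl // divn_small //.
  by rewrite addn0 addnC divnMDl // divn_small // addn0.
split=> //; apply: phiI => //; move: e; rewrite ij => /addIn.
by move: a0 b0; move: (phi a) (phi b) => x y; lia.
Qed.

(** When the keys are injective on the degrees of [f], no two components collide. The coefficients
    of [F] are then exactly components of [f], which gives the bound opposite to [spread_cont]. *)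
Lemma spread_exists f : {subset degrees f <= D} -> exists F,
  [/\ spread Rg P phi N M f F, A f ≤ cont F & forall e, hom F`_e].
Proof.
move=> hD; pose s i := [seq a <- supp f`_i | comp f`_i a != 0].
have hs i a : a \in s i -> a \in D.
  by rewrite mem_filter => /andP[/degreesP/hD].
pose F := \sum_(i <- iota 0 (size f)) \sum_(a <- s i) comp f`_i a *: 'X^(key phi N M (a, i)).
have hF i a : a \in s i -> F`_(key phi N M (a, i)) = comp f`_i a.
  move=> ha; have hi : i \in iota 0 (size f).
    rewrite mem_iota /= ltnNge; apply/negP => hi; move: ha.
    by rewrite mem_filter nth_default // comp0 eqxx.
  rewrite coef_sum (bigD1_seq i) ?iota_uniq //= [X in _ + X]big1 ?addr0; last first.
    move=> j nj; rewrite coef_sum big_seq big1 // => b hb; rewrite coefZ coefXn.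
    case: eqP => [e|]; last by rewrite mulr0.
    by have [_ e'] := key_inj (hs _ _ ha) (hs _ _ hb) e; rewrite e' eqxx in nj.
  rewrite coef_sum (bigD1_seq a) ?filter_uniq ?supp_uniq //= coefZ coefXn eqxx mulr1.
  rewrite big_seq_cond big1 ?addr0 // => b /andP[hb nb]; rewrite coefZ coefXn.
  case: eqP => [e|]; last by rewrite mulr0.
  by have [e' _] := key_inj (hs _ _ ha) (hs _ _ hb) e; rewrite e' eqxx in nb.
exists F; split.
- exists [seq (a, i, comp f`_i a) | i <- iota 0 (size f), a <- s i]; split.
  + move=> _ /allpairsPdep[i [a [_ /hs ha ->]]] /=.
    by split; [exact: DP|split; [exact: comp_Rg|case: (phiM ha)]].
  + rewrite big_allpairs_dep /= -{1}[f]coefK poly_def -(big_mkord xpredT (fun i => f`_i *: 'X^i)) /index_iota subn0.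
    apply: eq_bigr => i _; rewrite -scaler_suml; congr (_ *: _).
    rewrite {1}(comp_sum hgr f`_i) big_filter [RHS]big_mkcond; apply: eq_bigr => a _.
    by case: eqP => // ->.
  + by rewrite big_allpairs_dep.
- apply/A_le => i a; have [->|h] := eqVneq (comp f`_i a) 0; first by rewrite emb0; apply: smod0.
  rewrite -hF; first exact: cont_mem.
  by rewrite mem_filter h; apply: contraNT h => /comp_notin ->.
- move=> e; have [[i [a [ha ->]]]|h] := pselect (exists i a, a \in s i /\ e = key phi N M (a, i)).
    by rewrite hF //; apply: comp_hom.
  rewrite coef_sum big1; first exact: (hom0 hgr).
  move=> i _; rewrite coef_sum big_seq big1 // => a ha; rewrite coefZ coefXn.
  by case: eqP => [e'|]; [case: h; exists i, a|rewrite mulr0].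
Qed.
End Canonical.

(** Only the degrees of [f] and [g] have to be separated. For the product the bound
    [cont (F * H) ≤ A (f * g)] suffices, and it survives collisions. *)
Lemma A_dedekind_mertens f g : exists k, A f ^+ k.+1 * A g ≤ A f ^+ k * A (f * g).
Proof.
have [|P [phi [M [N [[_ hP] PD phiD phiI hM]]]]] := @separating_grading (degrees f ++ degrees g).
  by move=> a; rewrite mem_cat => /orP[]; apply: degrees_Gam.
have [|F [sF fF _]] := spread_exists hP phiI hM (f := f).
  by move=> a ha; rewrite mem_cat ha.
have [|H [sH gH _]] := spread_exists hP phiI hM (f := g).
  by move=> a ha; rewrite mem_cat ha orbT.
exists (size H).-1; apply: (leS_trans (leS_mul (leS_exp _ fF) gH)).
apply: (leS_trans (dedekind_mertens (F := F) (leqSpred (size H)))); 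
apply: leS_mul; first exact/leS_exp/(spread_cont hgr sF).
exact: (spread_cont hgr (spreadM hgr PD phiD sF sH)).
Qed.

Lemma RH_emb r : RH Rg (emb r).
Proof. by exists r, 1; rewrite emb1 divr1 oner_neq0; do !split=> //; apply: (hom1 hgr). Qed.
Lemma RH_D x y : RH Rg x -> RH Rg y -> RH Rg (x + y).
Proof.
move=> [a [h [hh [nh ->]]]] [b [k [hk [nk ->]]]]; exists (a * k + b * h), (h * k).
do !split; [exact: (homM hgr)|by rewrite mulf_neq0|].
by rewrite addf_div ?emb_eq0 // embD !embM.
Qed.
Lemma RH_M x y : RH Rg x -> RH Rg y -> RH Rg (x * y).
Proof.
move=> [a [h [hh [nh ->]]]] [b [k [hk [nk ->]]]]; exists (a * b), (h * k).
do !split; [exact: (homM hgr)|by rewrite mulf_neq0|].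
by rewrite mulf_div !embM.
Qed.
Lemma RH_div x h : RH Rg x -> hom h -> h != 0 -> RH Rg (x / emb h).
Proof.
move=> hx hh nh; apply: RH_M => //; exists 1, h; do !split=> //.
by rewrite emb1 div1r.
Qed.
Lemma RH_sum (I : Type) (r : seq I) (P : pred I) (f : I -> K) :
  (forall i, RH Rg (f i)) -> RH Rg (\sum_(i <- r | P i) f i).
Proof.
move=> h; elim/big_rec: _ => [|i x _ hx]; last exact: RH_D.
by rewrite -emb0; apply: RH_emb.
Qed.
Lemma RH_N x : RH Rg x -> RH Rg (- x).
Proof. by move=> h; rewrite -mulN1r; apply: RH_M => //; rewrite -emb1 -embN; apply: RH_emb. Qed.

Lemma RH_quotient (Q V : {poly K}) h : (forall i, RH Rg V`_i) -> hom h -> h != 0 ->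
  lead_coef V = emb h -> (forall i, RH Rg (Q * V)`_i) -> forall i, RH Rg Q`_i.
Proof.
move=> hV hh nh lV; move: (leqnn (size Q)); move: {2}(size Q) => n.
elim: n Q => [|n IH] Q sQ hQ i.
  by rewrite nth_default ?(leq_trans sQ) // -emb0; apply: RH_emb.
have hl : RH Rg Q`_n.
  have [hn|hn] := ltnP n (size Q); last by rewrite nth_default // -emb0; apply: RH_emb.
  have -> : Q`_n = lead_coef (Q * V) / emb h.
    rewrite lead_coefM lV mulfK ?emb_eq0 // lead_coefE; congr (_`_ _).
    by apply/eqP; rewrite -eqSS prednK ?(leq_ltn_trans _ hn) // eqn_leq hn.
  by apply: RH_div => //; rewrite lead_coefE.
have hi : RH Rg (Q - Q`_n *: 'X^n)`_i.
  apply: IH; first exact: size_strip.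
  move=> j; rewrite mulrBl coefB -scalerAl coefZ coefXnM; apply: RH_D => //.
  by apply: RH_N; apply: RH_M => //; case: ifP => // _; rewrite -emb0; apply: RH_emb.
rewrite -[Q](subrK (Q`_n *: 'X^n)) coefD coefZ coefXn; apply: RH_D => //.
by case: eqP => _; rewrite ?mulr1 ?mulr0 // -emb0; apply: RH_emb.
Qed.
End DedekindMertens.

(** * Integral closedness of the homogeneous quotient ring *)

(** The rational root argument over [K[X, 1/X]]: with [U / V] in lowest terms, the denominator
    divides ['X^e * U' ^+ n], because each of the other terms contains it, and so it divides
    ['X^e]. *)
Lemma dvdp_homogenized (K : fieldType) n e (c : K) (U V : {poly K}) (W : nat -> {poly K}) :
  V != 0 -> c != 0 ->
  c *: 'X^e * U ^+ n + \sum_(i < n) W i * U ^+ i * V ^+ (n - i) = 0 -> V %| 'X^e * U.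
Proof.
move=> nV nc E; pose d := gcdp U V.
have nd : d != 0 by rewrite gcdp_eq0 negb_and nV orbT.
pose U' := U %/ d; pose V' := V %/ d.
have eU : U = U' * d by rewrite divpK ?dvdp_gcdl.
have eV : V = V' * d by rewrite divpK ?dvdp_gcdr.
have cop : coprimep V' (U' ^+ n).
  by apply: coprimep_expr; rewrite coprimep_sym; apply: coprimep_div_gcd; rewrite nV orbT.
have E' : c *: 'X^e * U' ^+ n + \sum_(i < n) W i * U' ^+ i * V' ^+ (n - i) = 0.
  apply: (mulIf (expf_neq0 n nd)); rewrite mul0r -[RHS]E mulrDl; congr (_ + _).
    by rewrite [in RHS]eU exprMn mulrA.
  rewrite mulr_suml; apply: eq_bigr => i _.
  rewrite -[X in _ * d ^+ X = _](subnKC (ltnW (ltn_ord i))) exprD [in RHS]eU [in RHS]eV !exprMn; ring.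
have : V' %| 'X^e * U' ^+ n.
  rewrite -(dvdpZr _ _ nc) scalerAl; move/eqP: E'; rewrite addr_eq0 => /eqP ->.
  rewrite dvdpNr; apply: (big_ind (fun q => V' %| q)); [exact: dvdp0|exact: dvdp_add|].
  by move=> i _; apply: dvdp_mull; apply: dvdp_exp; rewrite ?subn_gt0.
rewrite Gauss_dvdpl // => h; rewrite {1}eV eU mulrA dvdp_mul2r //.
exact: dvdp_mulr.
Qed.

Section IntegrallyClosed.
Variables (R : idomainType) (G : zmodType) (Gam : G -> Prop) (Rg : G -> R -> Prop).
Hypothesis hgr : graded_domain Gam Rg.
Local Notation K := {fraction R}.
Local Notation emb := (@emb R).
Local Notation hom := (homogeneous Rg).
Implicit Types f g p q : {poly R}.

Lemma embX (a : R) n : emb (a ^+ n) = emb a ^+ n. Proof. exact: rmorphXn. Qed.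

Lemma cross_div (F : fieldType) (a h k : F) : h != 0 -> a / k = a * h / (h * k).
Proof. by move=> nh; rewrite invfM mulrA mulfK. Qed.
Lemma clear_div (F : fieldType) (h a b w c : F) : h != 0 -> a != 0 ->
  h * (a * b) * (w / h * (c / a)) = w * c * b.
Proof. by move=> nh na; field; rewrite nh na. Qed.

Lemma RH_common_denominator n (z : nat -> K) : (forall i, RH Rg (z i)) ->
  exists h (w : nat -> R), [/\ hom h, h != 0 & forall i, (i < n)%N -> z i = emb (w i) / emb h].
Proof.
move=> hz; elim: n => [|n [h [w [hh nh IH]]]].
  by exists 1, (fun=> 0); split; [exact: (hom1 hgr)|exact: oner_neq0|].
have [a [k [hk [nk e]]]] := hz n.
exists (h * k), (fun i => if (i < n)%N then w i * k else a * h); split.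
- exact: (homM hgr).
- by rewrite mulf_neq0.
- move=> i; rewrite ltnS leq_eqVlt => /orP[/eqP ->|hi].
    by rewrite ltnn e !embM; apply: cross_div; rewrite emb_eq0.
  by rewrite hi IH // !embM [emb h * _]mulrC; apply: cross_div; rewrite emb_eq0.
Qed.

Section SpreadPowers.
Variables (P : G -> Prop) (phi : G -> int) (N : nat).
Hypothesis P0 : P 0.
Hypothesis PD : forall x y, P x -> P y -> P (x + y).
Hypothesis phiD : forall x y, P x -> P y -> phi (x + y) = phi x + phi y.

Lemma spreadX M f F n : spread Rg P phi N M f F -> spread Rg P phi N (M * n) (f ^+ n) (F ^+ n).
Proof.
move=> h; elim: n => [|n ih]; last by rewrite !exprS mulnS; apply: (spreadM hgr).
have phi0 : phi 0 = 0.
  by have := phiD P0 P0; rewrite addr0 => /eqP; rewrite -subr_eq0 opprD addNKr oppr_eq0 => /eqP.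
exists [:: (0, 0%N, 1)]; rewrite !big_seq1 /key /= phi0 muln0 addr0 !scale1r expr0; split=> // t.
by rewrite inE => /eqP -> /=; rewrite phi0; split=> //; split=> //; apply: (Rg1 hgr).
Qed.
Lemma spread_horner1 M f F : spread Rg P phi N M f F -> F.[1] = f.[1].
Proof.
move=> [l [_ -> ->]]; rewrite !horner_sum; apply: eq_bigr => t _.
by rewrite !hornerZ !hornerXn !expr1n.
Qed.
End SpreadPowers.

(* The substitution [spread] turns the integral equation of [u / v] into one over [K[X, 1/X]], which is
   integrally closed; so [v] divides [u] there, and long division by [v], whose leading
   coefficient is homogeneous, stays inside the homogeneous quotient ring. *)
Theorem RH_integrally_closed x (p : {poly K}) :
  p \is monic -> (forall i, RH Rg p`_i) -> root p x -> RH Rg x.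
Proof.
move=> mp hp rx; have [u [v [nv ex]]] := fracP x.
have sp : (size p).-1.+1 = size p by rewrite prednK // lt0n size_poly_eq0 monic_neq0.
set n := (size p).-1 in sp.
have [h [w [hh nh hw]]] := RH_common_denominator n hp.
have nve : emb v != 0 by rewrite emb_eq0.
have nhe : emb h != 0 by rewrite emb_eq0.
have E : h * u ^+ n + \sum_(i < n) w i * u ^+ i * v ^+ (n - i) = 0.
  apply: emb_inj; rewrite emb0; move/rootP: rx; rewrite horner_coef -sp big_ord_recr /=.
  rewrite -[p`_n]lead_coefE (monicP mp) mul1r => /(congr1 (fun z => emb h * emb v ^+ n * z)).
  rewrite mulr0 => <-; rewrite embD emb_sum mulrDr addrC; congr (_ + _).
    rewrite mulr_sumr; apply: eq_bigr => i _; rewrite hw // ex !embM !embX exprMn exprVn.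
    have -> : emb v ^+ n = emb v ^+ i * emb v ^+ (n - i) by rewrite -exprD subnKC // ltnW.
    apply/esym/clear_div => //.
    by rewrite expf_neq0.
  by rewrite ex embM embX exprMn exprVn -[RHS]mulrA [emb v ^+ n * _]mulrC divfK ?expf_neq0.
have [b hb] := hh.
pose D := degrees hgr u%:P ++ degrees hgr v%:P ++ degrees hgr h%:P
          ++ flatten [seq degrees hgr (w i)%:P | i <- iota 0 n].
have [|P [phi [M [N [[P0 DP] PD phiD phiI hM]]]]] := separating_grading hgr (D := D).
  move=> a; rewrite !mem_cat => /orP[|/orP[|/orP[]]]; try exact: degrees_Gam.
  by move=> /flattenP[_ /mapP[i _ ->]]; apply: degrees_Gam.
have [|U [sU _ _]] := spread_exists (hgr := hgr) DP phiI hM (f := u%:P).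
  by move=> a ha; rewrite mem_cat ha.
have [|V [sV cV hV]] := spread_exists (hgr := hgr) DP phiI hM (f := v%:P).
  by move=> a ha; rewrite !mem_cat ha orbT.
have sW_ i : exists W, (i < n)%N -> spread Rg P phi N M (w i)%:P W.
  have [hi|hi] := ltnP i n; last by exists 0.
  have [|W [sW _ _]] := spread_exists (hgr := hgr) DP phiI hM (f := (w i)%:P).
    move=> a ha; rewrite !mem_cat; apply/orP; right; apply/orP; right; apply/orP; right.
    by apply/flattenP; exists (degrees hgr (w i)%:P) => //; apply: map_f; rewrite mem_iota.
  by exists W.
pose W i := projT1 (cid (sW_ i)).
have sW (i : 'I_n) : spread Rg P phi N M (w i)%:P (W i) by rewrite /W; case: cid => z /=; apply; apply: ltn_ord.
have bD : b \in D.
  rewrite !mem_cat (degreesP (hgr := hgr) (f := h%:P) (i := 0%N)) ?orbT // coefC eqxx.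
  by rewrite (compE hgr _ hb) eqxx.
have [bM _] := hM _ bD; pose e := key phi N M (b, 0%N).
(* A homogeneous [h] becomes a monomial, a unit of [K[X, 1/X]]; this is why the equation remains
   integral there. *)
have sh : spread Rg P phi N M h%:P (h *: 'X^e).
  exists [:: (b, 0%N, h)]; rewrite !big_seq1 /= expr0 alg_polyC; split=> // t.
  by rewrite inE => /eqP -> /=; split; [exact: DP|].
have EX : h *: 'X^e * U ^+ n + \sum_(i < n) W i * U ^+ i * V ^+ (n - i) = 0.
  apply: (@spread_0 _ _ _ _ hgr P phi N (M + M * n)).
  rewrite [X in spread _ _ _ _ _ X](_ : _ = h%:P * u%:P ^+ n
    + \sum_(i < n) (w i)%:P * u%:P ^+ i * v%:P ^+ (n - i)); last first.
    rewrite -[LHS](polyC0) -E polyCD polyCM polyC_exp rmorph_sum; congr (_ + _).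
    by apply: eq_bigr => i _; rewrite /= !polyCM !polyC_exp.
  apply: spreadD; first by apply: (spreadM hgr) => //; apply: spreadX.
  (* Every term of the equation has [n + 1] factors, so all of them carry the same total shift and
     may be added. *)
  apply: spread_sum => i; have -> : (M + M * n = M + M * i + M * (n - i))%N by rewrite -addnA -mulnDr subnKC // ltnW.
  by apply: (spreadM hgr) => //; [apply: (spreadM hgr) => //|]; apply: spreadX.
pose m := map_poly (@FracField.tofrac R).
have nV : V != 0.
  apply: contra nv => /eqP e0; have := cV _ (A_id hgr v%:P 0).
  by rewrite e0 cont0 coefC eqxx => /eqP; rewrite emb_eq0.
have nVm : m V != 0 by rewrite map_poly_eq0_id0 // tofrac_eq0 lead_coef_eq0.
have /dvdpP[Q eQ] : m V %| 'X^e * m U.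
  apply: (@dvdp_homogenized _ n e (emb h) (m U) (m V) (fun i => m (W i))) => //.
  have mh : m (h *: 'X^e) = emb h *: 'X^e.
    by rewrite /m -mul_polyC rmorphM /= map_polyC map_polyXn mul_polyC.
  have := congr1 m EX; rewrite {2}/m rmorph0 => E0; rewrite -[RHS]E0 -mh.
  rewrite /m rmorphD rmorphM rmorphXn rmorph_sum; congr (_ + _).
  by apply: eq_bigr => i _; rewrite !rmorphM !rmorphXn.
have RHm F i : RH Rg (m F)`_i by rewrite coef_map; apply: (RH_emb hgr).
have hQ : forall i, RH Rg Q`_i.
  apply: (@RH_quotient _ _ _ _ hgr Q (m V) (lead_coef V)).
  - exact: RHm.
  - by rewrite lead_coefE; apply: hV.
  - by rewrite lead_coef_eq0.
  - by rewrite lead_coef_map_inj // => a c; apply: emb_inj.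
  - by move=> i; rewrite -eQ coefXnM; case: ifP => // _; rewrite -emb0; apply: (RH_emb hgr).
have m1 F : (m F).[1] = emb F.[1] by rewrite -[1 in LHS](rmorph1 (@FracField.tofrac R)) horner_map.
(* Evaluation at [1] undoes the substitution. *)
have -> : x = Q.[1].
  apply: (mulIf nve); rewrite ex divfK //.
  have := congr1 (fun q : {poly K} => q.[1]) eQ; rewrite !hornerM hornerXn expr1n mul1r !m1.
  by rewrite (spread_horner1 sU) (spread_horner1 sV) !hornerC.
rewrite horner_coef; apply: (RH_sum hgr) => i; apply: (RH_M hgr) => //.
by rewrite expr1n -emb1; apply: (RH_emb hgr).
Qed.
End IntegrallyClosed.

(** * Homogeneous fractional ideals *)

Section Fgh.
Variables (R : idomainType) (G : zmodType) (Gam : G -> Prop) (Rg : G -> R -> Prop).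
Hypothesis hgr : graded_domain Gam Rg.
Local Notation K := {fraction R}.
Local Notation emb := (@emb R).
Local Notation hom := (homogeneous Rg).
Local Notation comp := (comp hgr).
Local Notation A := (A hgr).
Local Notation C := (C hgr).
Implicit Types (p q : {poly R}) (E F H J T : smod R).

(* homogeneous elements of the homogeneous quotient field *)
Definition homK (y : K) := exists a h, [/\ hom a, hom h, h != 0 & y = emb a / emb h].
(* finitely generated homogeneous fractional ideals *)
Definition fgh E := exists ys : seq K, (forall y, y \in ys -> homK y) /\ E = span ys.
Definition fg E := exists ys : seq K, E = span ys.

Lemma fgh_fg E : fgh E -> fg E. Proof. by move=> [ys [_ ->]]; exists ys. Qed.
Lemma homK_emb a : hom a -> homK (emb a).
Proof. by move=> ha; exists a, 1; rewrite emb1 divr1 oner_neq0; split=> //; apply: (hom1 hgr). Qed.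
Lemma homK_M x y : homK x -> homK y -> homK (x * y).
Proof.
move=> [a [h [ha hh nh ->]]] [b [k [hb hk nk ->]]]; exists (a * b), (h * k).
by split; rewrite ?mulf_neq0 ?mulf_div ?embM //; apply: (homM hgr).
Qed.
Lemma homK_V x : homK x -> x != 0 -> homK x^-1.
Proof.
move=> [a [h [ha hh nh ->]]] nx; exists h, a; split=> //; last by rewrite invf_div.
by apply: contraNneq nx => ->; rewrite emb0 mul0r.
Qed.
Lemma fgh_span ys : (forall y, y \in ys -> homK y) -> fgh (span ys).
Proof. by exists ys. Qed.
Lemma fgh_prin x : homK x -> fgh (prin x).
Proof. by move=> h; exists [:: x]; split; [move=> y; rewrite inE => /eqP ->|rewrite span1]. Qed.
Lemma fgh1 : fgh 1.
Proof. by rewrite -prin1 -emb1; apply: fgh_prin; apply: homK_emb; apply: (hom1 hgr). Qed.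
Lemma fgh0 : fgh 0.
Proof. by exists [::]; split=> //; rewrite /span big_nil. Qed.
Lemma fgh_D E F : fgh E -> fgh F -> fgh (E + F).
Proof.
move=> [xs [hx ->]] [ys [hy ->]]; exists (xs ++ ys); rewrite span_cat; split=> // z.
by rewrite mem_cat => /orP[/hx|/hy].
Qed.
Lemma fgh_M E F : fgh E -> fgh F -> fgh (E * F).
Proof.
move=> [xs [hx ->]] [ys [hy ->]]; rewrite span_mul; exists [seq x * y | x <- xs, y <- ys].
by split=> // z /allpairsP[[x y] [/= /hx h1 /hy h2 ->]]; apply: homK_M.
Qed.
Lemma fgh_X E n : fgh E -> fgh (E ^+ n).
Proof. by move=> h; elim: n => [|n ih]; [exact: fgh1|rewrite exprS; apply: fgh_M]. Qed.
Lemma fgh_sum (I : eqType) (r : seq I) (f : I -> smod R) :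
  (forall i, i \in r -> fgh (f i)) -> fgh (\sum_(i <- r) f i).
Proof.
move=> h; rewrite big_seq; elim/big_rec: _ => [|i E ir hE]; first exact: fgh0.
by apply: fgh_D => //; apply: h.
Qed.
Lemma fgh_C r : fgh (C r).
Proof. by apply: fgh_span => _ /mapP[a _ ->]; apply: homK_emb; apply: comp_hom. Qed.
Lemma fgh_A p : fgh (A p).
Proof. by apply: fgh_sum => i _; apply: fgh_C. Qed.
Lemma fgM E F : fg E -> fg F -> fg (E * F).
Proof. by move=> [xs ->] [ys ->]; rewrite span_mul; exists [seq x * y | x <- xs, y <- ys]. Qed.
Lemma fg1 : fg 1. Proof. exact/fgh_fg/fgh1. Qed.

Lemma common_denominator ys : (forall y, y \in ys -> homK y) -> exists h xs,
  [/\ hom h, h != 0, (forall x, x \in xs -> hom x) & [seq emb h * y | y <- ys] = map emb xs].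
Proof.
elim: ys => [|y ys IH] hy.
  by exists 1, [::]; split=> //; [exact: (hom1 hgr)|exact: oner_neq0].
have [|h [xs [hh nh hx e]]] := IH; first by move=> z hz; apply: hy; rewrite inE hz orbT.
have [|a [k [ha hk nk ey]]] := hy y; first by rewrite inE eqxx.
exists (h * k), (h * a :: map ( *%R k) xs); split.
- exact: (homM hgr).
- by rewrite mulf_neq0.
- move=> x; rewrite inE => /orP[/eqP ->|/mapP[z /hx hz ->]]; exact: (homM hgr).
- rewrite /= ey !embM mulrA -[emb h * emb k * _]mulrA [emb k * _]mulrC mulrA mulfK ?emb_eq0 //.
  congr (_ :: _); rewrite -map_comp.
  transitivity [seq emb k * (emb h * y0) | y0 <- ys].
    by apply: eq_map => z; rewrite mulrA [emb k * _]mulrC.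
  by rewrite (map_comp ( *%R (emb k)) ( *%R (emb h))) e -map_comp; apply: eq_map => z /=; rewrite embM.
Qed.
Lemma fgh_denominator E : fgh E -> exists h xs,
  [/\ hom h, h != 0, (forall x, x \in xs -> hom x) & prin (emb h) * E = span (map emb xs)].
Proof.
move=> [ys [/common_denominator[h [xs [hh nh hx e]]] ->]].
by exists h, xs; rewrite span_scale e.
Qed.

(* [F] is a graded submodule, so it contains the components of its elements. *)
Lemma fgh_comp F r : fgh F -> F (emb r) -> C r ≤ F.
Proof.
move=> /fgh_denominator[h [xs [hh nh hx e]]] hr; apply/C_le => a.
have [b hb] := hh.
have : span (map emb xs) (emb (h * r)).
  by rewrite -e embM; apply: mulS_mem => //; apply: prin_id.
rewrite spanE => -[c [hc ec]].
suff : span (map emb xs) (emb (h * comp r a)).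
  rewrite -e embM => /prin_mulP[y [hy]]; move/mulfI => -> //.
  by rewrite emb_eq0.
pose d i := projT1 (cid (hc i)).
have hd i : c i = emb (d i) by rewrite /d; case: cid.
have e2 : h * r = \sum_(i < size xs) d i * xs`_i.
  apply: emb_inj; rewrite ec emb_sum size_map; apply: eq_bigr => i _.
  by rewrite embM hd (nth_map 0).
have -> : h * comp r a = comp (h * r) (b + a) by rewrite (compMl hgr _ _ hb) addrC addKr.
rewrite e2 comp_big emb_sum; apply: smod_sum => i _ _.
have hi : xs`_i \in xs by apply: mem_nth.
have [g hg] := hx _ hi.
rewrite mulrC (compMl hgr _ _ hg) embM mulrC; apply: smodZ; apply: span_mem; exact: map_f.
Qed.

(** A nonzero homogeneous generator [y] of [E] is a unit, so the hypothesis puts [r] in the graded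
    module [y^-1 F], which contains its components. *)
Lemma fgh_comp_mul E F r : fgh E -> fgh F -> E * prin (emb r) ≤ F -> E * C r ≤ F.
Proof.
move=> [ys [hy ->]] hF h; rewrite /span big_distrl; apply: leS_sum => y yin /=.
have [->|ny] := eqVneq y 0; first by rewrite prin0 mul0r; apply: leS0.
apply: (@leS_trans _ (prin y * (prin y^-1 * F))); last first.
  by rewrite mulrA -prinM mulfV // prin1 mul1r.
apply: leS_mull; apply: fgh_comp; first by apply: fgh_M => //; apply/fgh_prin/homK_V => //; apply: hy.
apply/prin_mulP; exists (y * emb r); rewrite mulKf //; split=> //.
by apply: h; apply: mulS_mem; [apply: span_mem|apply: prin_id].
Qed.
Lemma fg_le1 J : fg J -> J ≤ 1 -> exists js : seq R, J = span (map emb js).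
Proof.
move=> [ys ->]; elim: ys => [|y ys IH] h1; first by exists [::].
have [|js ej] := IH; first by apply/span_le => z hz; apply: h1; apply: span_mem; rewrite inE hz orbT.
have [r er] : (1 : smod R) y by apply: h1; apply: span_mem; rewrite inE eqxx.
by exists (r :: js); rewrite /span big_cons /= big_cons er; congr (_ + _); exact: ej.
Qed.
Lemma fgh_le1 J : fgh J -> J ≤ 1 -> exists js : seq R, (forall j, j \in js -> hom j) /\ J = span (map emb js).
Proof.
move=> hJ h1; have [js ej] := fg_le1 (fgh_fg hJ) h1.
exists [seq comp j a | j <- js, a <- supp hgr j]; split.
  by move=> _ /allpairsPdep[j [a [_ _ ->]]]; apply: comp_hom.
apply: leS_anti; last first.
  apply/span_le => _ /mapP[_ /allpairsPdep[j [a [hj _ ->]]] ->].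
  have /fgh_comp : J (emb j) by rewrite ej; apply: span_mem; apply: map_f.
  by move=> /(_ hJ); apply; apply: C_mem.
rewrite {1}ej; apply/span_le => _ /mapP[j hj ->].
rewrite (comp_sum hgr j) emb_sum; apply: smod_sum => a ha _; apply: span_mem; apply: map_f.
by apply/allpairsPdep; exists j, a.
Qed.
Lemma fgh_le1_A J : fgh J -> J ≤ 1 -> exists p, A p = J.
Proof.
move=> hJ h1; have [js [hj ->]] := fgh_le1 hJ h1.
exists (\poly_(i < size js) js`_i); apply: leS_anti.
  apply/A_le => i a; rewrite coef_poly; case: ltnP => hi; last by rewrite comp0 emb0; apply: smod0.
  have [b hb] := hj _ (mem_nth 0 hi); rewrite (compE hgr _ hb).
  by case: ifP => _; [apply: span_mem; apply: map_f; apply: mem_nth|rewrite emb0; apply: smod0].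
apply/span_le => _ /mapP[j hin ->]; have hi : (index j js < size js)%N by rewrite index_mem.
have := A_id hgr (\poly_(i < size js) js`_i) (index j js).
by rewrite coef_poly hi nth_index.
Qed.
End Fgh.

(** * Semistar operations and invertibility *)

Section Star.
Variables (R : idomainType) (G : zmodType) (Gam : G -> Prop) (Rg : G -> R -> Prop).
Hypothesis hgr : graded_domain Gam Rg.
Variable st : ({fraction R} -> Prop) -> ({fraction R} -> Prop).
Hypothesis hst : semistar st.
Local Notation K := {fraction R}.
Local Notation emb := (@emb R).
Local Notation hom := (homogeneous Rg).
Local Notation comp := (comp hgr).
Local Notation A := (A hgr).
Local Notation C := (C hgr).
Local Notation fgh := (fgh Rg).
Local Notation fg := (@fg R).
Implicit Types (p q : {poly R}) (E F H J T : smod R).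

Lemma nzS E : E != 0 -> nzsub E.
Proof. by move=> /neq0S h; split=> //; apply: smodP. Qed.
Lemma one_neq0 : (1 : smod R) != 0.
Proof. by rewrite -prin1; apply: prin_neq0; apply: oner_neq0. Qed.

Definition big E := [/\ E ≤ 1, E != 0 & seteq (st E) (st (@Rset R))].

Lemma st_mono E F : E != 0 -> E ≤ F -> subs (st E) (st F).
Proof.
move=> nE h; case: hst => _ _ hm _ _; apply: hm => //; apply: nzS => //.
exact: leS_neq0 h nE.
Qed.
Lemma st_ext E : E != 0 -> subs E (st E).
Proof. by move=> nE; case: hst => _ _ _ he _; apply: he; apply: nzS. Qed.
Lemma st_smod E : E != 0 -> exists2 F : smod R, scar F = st E & F != 0.
Proof.
move=> nE; case: hst => /(_ _ (nzS nE)) [h1 h2] _ _ _ _.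
by exists (Smod h1) => //; apply/neq0S.
Qed.
Lemma st_le E F : E != 0 -> F != 0 -> subs E (st F) -> subs (st E) (st F).
Proof.
move=> nE nF h; have [F' eF nF'] := st_smod nF.
have := @st_mono E F' nE; rewrite /leS eF => /(_ h) h' x /h'.
by case: hst => _ _ _ _ /(_ _ (nzS nF)) hh /hh.
Qed.
Lemma big_of_one E : E ≤ 1 -> E != 0 -> st E 1 -> big E.
Proof.
move=> h1 nE h; split=> // x; split; first exact: (st_mono nE h1).
apply: (@st_le 1) => //; first exact: one_neq0.
have [F eF _] := st_smod nE; rewrite -eF in h *; move=> y [r ->].
by rewrite -[emb r]mulr1; apply: smodZ.
Qed.
Lemma big_one E : big E -> st E 1.
Proof.
move=> [_ _ h]; apply/h; apply: (@st_ext 1); first exact: one_neq0.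
by exists 1; rewrite emb1.
Qed.
Lemma big1S : big 1.
Proof. by split; [exact: leS_refl|exact: one_neq0|]. Qed.
Lemma big_le E F : big E -> E ≤ F -> F ≤ 1 -> big F.
Proof.
move=> hE EF F1; have [_ nE _] := hE; apply: big_of_one => //; first exact: leS_neq0 EF nE.
by apply: (st_mono nE EF); apply: big_one.
Qed.
(** For [y] in [F], scaling [1] in [E^star] by [y] gives [y] in [(y E)^star], hence in [(E F)^star].
    So [F] lies in [(E F)^star], and then so does [1], which belongs to [F^star]. *)
Lemma big_M E F : big E -> big F -> big (E * F).
Proof.
move=> hE hF; have [E1 nE sE] := hE; have [F1 nF sF] := hF.
have nEF := mulS_neq0 nE nF.
apply: big_of_one => //; first by rewrite -[1]mulr1; apply: leS_mul.
apply: (@st_le F) => //; last exact: big_one.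
move=> y hy; have [->|ny] := eqVneq y 0.
  by have [H eH _] := st_smod nEF; rewrite -eH; apply: smod0.
have sub : subs (scaleset y E) (scar (E * F)).
  by move=> _ [x [hx ->]]; rewrite mulrC; apply: mulS_mem.
have nyE : prin y * E != 0 by apply: mulS_neq0 => //; apply: prin_neq0.
have := @st_mono (prin y * E) (E * F) nyE; rewrite /leS prin_mulE => /(_ sub); apply.
case: hst => _ /(_ y E ny (nzS nE) y) hs _ _ _; apply/hs.
by exists 1; rewrite mulr1; split=> //; apply: big_one.
Qed.
Lemma big_X E n : big E -> big (E ^+ n).
Proof. by move=> h; elim: n => [|n ih]; [exact: big1S|rewrite exprS; apply: big_M]. Qed.
Lemma big_le1 E : big E -> E ≤ 1. Proof. by case. Qed.
Lemma big_neq0 E : big E -> E != 0. Proof. by case. Qed.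

Lemma big_sum_exp (I : eqType) (r : seq I) (f : I -> smod R) (n : I -> nat) :
  (forall i, i \in r -> f i ≤ 1) -> big (\sum_(i <- r) f i) -> big (\sum_(i <- r) f i ^+ n i).
Proof.
move=> h1 hb; suff main F : F ≤ 1 -> big (\sum_(i <- r) f i + F) -> big (\sum_(i <- r) f i ^+ n i + F).
  by rewrite -[\sum_(i <- r) _]addr0; apply: main; [apply: leS0|rewrite addr0].
elim: r h1 F {hb} => [|i r IH] h1 F F1; first by rewrite !big_nil.
have i1 : f i ≤ 1 by apply: h1; rewrite inE eqxx.
have hr : forall j, j \in r -> f j ≤ 1 by move=> j hj; apply: h1; rewrite inE hj orbT.
have r1 : \sum_(j <- r) f j ≤ 1 by apply: leS_sum.
rewrite !big_cons => hb.
have rF1 : \sum_(j <- r) f j + F ≤ 1 by apply: leS_add.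
rewrite -addrA addrCA; apply: (IH hr (f i ^+ n i + F)).
  by apply: leS_add => //; apply: expS_le1.
rewrite addrCA; apply: (big_le (big_X (n i) hb)).
  by rewrite -addrA; apply: expS_add.
by apply: leS_add => //; apply: expS_le1.
Qed.

Section Below.
(** [Q] is [fg] where the tilde-closure is concerned and [fgh] where the grading is; [below_fgh]
    passes from the first to the second. *)
Variable Q : smod R -> Prop.
Hypothesis Q1 : Q 1.
Hypothesis QM : forall E F, Q E -> Q F -> Q (E * F).
(* [E] is contained in [F] after localizing at the ideals [J] with [J^star = R^star]; for finitely
   generated [E] this says that [E] lies in the tilde-closure of [F] (see [below_star_tilde]). *)
Definition below E F := exists J, [/\ Q J, big J & E * J ≤ F].

Lemma below_le E F : E ≤ F -> below E F.
Proof. by move=> h; exists 1; rewrite mulr1; split=> //; apply: big1S. Qed.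
Lemma below_trans E F H : below E F -> below F H -> below E H.
Proof.
move=> [J [QJ bJ h]] [J' [QJ' bJ' h']]; exists (J * J'); split; [exact: QM|exact: big_M|].
by rewrite mulrA; apply: leS_trans h'; apply: leS_mulr.
Qed.
Lemma below_mulr H E F : below E F -> below (E * H) (F * H).
Proof.
by move=> [J [QJ bJ h]]; exists J; split=> //; rewrite mulrAC; apply: leS_mulr.
Qed.
Lemma below_add E F H : below E H -> below F H -> below (E + F) H.
Proof.
move=> [J [QJ bJ h]] [J' [QJ' bJ' h']]; exists (J * J'); split; [exact: QM|exact: big_M|].
rewrite mulrDl; apply: leS_add.
  by rewrite mulrA; apply: leS_trans h; apply: mulS_le1r; apply: big_le1.
by rewrite mulrCA; apply: leS_trans h'; apply: mulS_le1l; apply: big_le1.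
Qed.
Lemma below_sum (I : eqType) (r : seq I) (f : I -> smod R) H :
  (forall i, i \in r -> below (f i) H) -> below (\sum_(i <- r) f i) H.
Proof.
move=> h; rewrite big_seq; elim/big_rec: _ => [|i E ir hE]; first by apply: below_le; apply: leS0.
by apply: below_add => //; apply: h.
Qed.
End Below.

Local Notation "E ⊑ F" := (below fgh E F) (at level 70, no associativity).
Local Notation fghM := (@fgh_M _ _ _ _ hgr).
Local Notation homKe := (@homK_emb _ _ _ _ hgr).

Lemma below_fgh E F : fgh E -> fgh F -> below fg E F -> E ⊑ F.
Proof.
move=> hE hF [J [fJ bJ h]]; have [js ej] := fg_le1 fJ (big_le1 bJ).
have J1 : \sum_(j <- js) C j ≤ 1.
  by apply: leS_sum => j _; apply/C_le => a; exists (comp j a).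
exists (\sum_(j <- js) C j); split.
- by apply: fgh_sum => j _; apply: fgh_C.
- apply: (big_le bJ) => //; rewrite ej; apply/span_le => _ /mapP[j hj ->].
  by apply: (leS_bigsum (f := C) hj); apply: C_id.
- rewrite big_distrr; apply: leS_sum => j hj /=; apply: fgh_comp_mul => //.
  apply: leS_trans h; apply: leS_mull; rewrite ej; apply/prin_le; apply: span_mem; exact: map_f.
Qed.

Lemma star_tildeE E x : star_tilde st E x <-> below fg (prin x) E.
Proof.
split.
  move=> [js [nj [sj h]]]; rewrite -spanE in sj h.
  exists (span (map emb js)); split; first by exists (map emb js).
    split=> //; first by apply/span_le => _ /mapP[j _ ->]; exists j.
    by apply/span_neq0; rewrite has_map; apply: sub_has nj => j /=; rewrite emb_eq0.
  by move=> z; rewrite prin_mulE => /h.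
move=> [J [fJ bJ h]]; have [js ej] := fg_le1 fJ (big_le1 bJ); exists js.
rewrite -spanE -ej; split; last by split; [case: bJ|move=> z hz; apply: h; rewrite prin_mulE].
have := big_neq0 bJ; rewrite ej => /span_neq0; rewrite has_map.
by apply: sub_has => j /=; rewrite emb_eq0.
Qed.
Lemma below_star_tilde E F : fg E -> (subs E (star_tilde st F) <-> below fg E F).
Proof.
move=> [ys ->]; split.
  move=> h; apply: below_sum; [exact: fg1 hgr|exact: fgM|].
  by move=> y hy; apply/star_tildeE; apply: h; apply: span_mem.
move=> [J [fJ bJ h]] x hx; apply/star_tildeE; exists J; split=> //.
by apply: leS_trans h; apply: leS_mulr; apply/prin_le.
Qed.

(** * Invertibility of homogeneous ideals *)

Definition invertS E := exists T, [/\ fgh T, T * E ≤ 1 & big (T * E)].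

Lemma invertS_M E F : invertS E -> invertS F -> invertS (E * F).
Proof.
move=> [T [hT T1 bT]] [T' [hT' T1' bT']]; exists (T * T'); rewrite mulrACA; split.
- exact: fghM.
- by rewrite -[1]mulr1; apply: leS_mul.
- exact: big_M.
Qed.
Lemma invertS_factor E F : fgh F -> invertS (E * F) -> invertS E.
Proof.
move=> hF [T [hT T1 bT]]; exists (T * F); rewrite -mulrA [F * E]mulrC; split=> //.
exact: fghM.
Qed.
Lemma invertS_cancel E F H : fgh E -> invertS E -> F * E ⊑ H * E -> F ⊑ H.
Proof.
move=> hE [T [hT T1 bT]] [J [hJ bJ h]]; exists (J * (T * E)); split.
- by apply: fghM => //; apply: fghM.
- exact: big_M.
- rewrite (_ : _ * _ = F * E * J * T); last by ring.
  apply: (leS_trans (leS_mulr _ h)); rewrite -mulrA [E * T]mulrC; exact: mulS_le1r.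
Qed.
Lemma invertS_prin x : homK Rg x -> x != 0 -> invertS (prin x).
Proof.
move=> hx nx; exists (prin x^-1); rewrite -prinM mulVf // prin1; split.
- exact/fgh_prin/homK_V.
- exact: leS_refl.
- exact: big1S.
Qed.

Lemma invertS_pairs : (forall x y, homK Rg x -> homK Rg y -> x != 0 -> y != 0 -> invertS (prin x + prin y)) ->
  forall E, fgh E -> E != 0 -> invertS E.
Proof.
move=> h2; suff main : forall n ys, (size ys <= n)%N -> ys != [::] ->
    (forall y, y \in ys -> homK Rg y /\ y != 0) -> invertS (span ys).
  move=> E [ys [hy ->]] nE; have e : span ys = span [seq y <- ys | y != 0].
    apply: leS_anti; apply/span_le => y; last by rewrite mem_filter => /andP[_]; apply: span_mem.
    have [-> _|ny hin] := eqVneq y 0; first exact: smod0.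
    by apply: span_mem; rewrite mem_filter ny.
  rewrite e; apply: (main _ _ (leqnn _)); last by move=> y; rewrite mem_filter => /andP[-> /hy].
  by apply: contraNneq nE; rewrite e => ->; rewrite /span big_nil.
elim=> [|n IH] [|x [|y [|z s]]] //= sz _ hy.
- by rewrite span1; have [] := hy x; [rewrite inE eqxx|exact: invertS_prin].
- have [hx nx] := hy x (mem_head _ _); have [|hy' ny] := hy y; first by rewrite !inE eqxx orbT.
  by rewrite span2; apply: h2.
set t := z :: s; set X := prin x; set Y := prin y; set Z := span t.
have ft : fgh Z by apply: fgh_span => u hu; have [] := hy u; rewrite ?inE; rewrite /t inE in hu; rewrite ?hu ?orbT.
have fX : fgh X by apply: fgh_prin; have [] := hy x (mem_head _ _).
have fY : fgh Y by apply: fgh_prin; have [] := hy y; rewrite // !inE eqxx orbT.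
have iXY : invertS (X + Y).
  rewrite -span2; apply: IH => //; first by move: sz; rewrite /=; lia.
  by move=> u; rewrite !inE => hu; apply: hy; rewrite !inE orbA hu.
have iYZ : invertS (Y + Z).
  rewrite (_ : Y + Z = span (y :: t)); last by rewrite /span big_cons.
  by apply: IH => // u; rewrite !inE => hu; apply: hy; rewrite !inE hu orbT.
have iXZ : invertS (X + Z).
  rewrite (_ : X + Z = span (x :: t)); last by rewrite /span big_cons.
  apply: IH => // u; rewrite in_cons => hu; apply: hy; rewrite in_cons in_cons.
  by case/orP: hu => ->; rewrite ?orbT.
rewrite (_ : span _ = X + Y + Z); last by rewrite /span 2!big_cons addrA.
apply: (@invertS_factor _ (X * Y + Y * Z + X * Z)).
  by do !apply: fgh_D; apply: fghM.
rewrite (_ : _ * _ = (X + Y) * (Y + Z) * (X + Z)); first by do !apply: invertS_M.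
(* The two expansions differ only in the number of copies of [X * Y * Z], which idempotent addition
   erases. *)
have -> : (X + Y + Z) * (X * Y + Y * Z + X * Z)
  = X*X*Y + X*X*Z + X*Y*Y + Y*Y*Z + Y*Z*Z + X*Z*Z + (X*Y*Z + X*Y*Z + X*Y*Z) by ring.
have -> : (X + Y) * (Y + Z) * (X + Z)
  = X*X*Y + X*X*Z + X*Y*Y + Y*Y*Z + Y*Z*Z + X*Z*Z + (X*Y*Z + X*Y*Z) by ring.
by rewrite !addSS.
Qed.

Definition all_invertible := forall E, fgh E -> E != 0 -> invertS E.

(** For a nonzero homogeneous generator [g] of [E], the element [r = t g] lies in [R] and [r E] lies
    in the graded module [g R]. Hence so does [C r * E], and [g^-1 C r] is a homogeneous part of the
    inverse containing [t]. *)
Lemma colon_homogeneous E t (xs : seq R) : (forall x, x \in xs -> hom x) -> E = span (map emb xs) ->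
  E != 0 -> colon (@Rset R) E t -> exists T, [/\ fgh T, T * E ≤ 1 & T t].
Proof.
move=> hx eE nE ht.
have /hasP[g0 /mapP[g gx ->]] : has (fun y => y != 0) (map emb xs) by apply/span_neq0; rewrite -eE.
rewrite emb_eq0 => ng; have nge : emb g != 0 by rewrite emb_eq0.
have [r er] : Rset (t * emb g) by apply: ht; rewrite eE; apply: span_mem; apply: map_f.
have hg := hx _ gx; have hE : fgh E.
  by rewrite eE; apply: fgh_span => _ /mapP[x /hx h ->]; apply: homKe.
have hC : E * C r ≤ prin (emb g).
  apply: fgh_comp_mul => //; first exact/fgh_prin/homKe.
  rewrite -er prinM mulrA; apply: mulS_le1l; rewrite mulrC.
  by apply/prin_mul_le => y hy; apply: ht.
exists (prin (emb g)^-1 * C r); split.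
- apply: fghM; last exact: fgh_C.
  by apply: fgh_prin; apply: homK_V => //; apply: homKe.
- rewrite -mulrA [C r * _]mulrC; apply: (leS_trans (leS_mull _ hC)); rewrite -prinM mulVf // prin1.
  exact: leS_refl.
- apply/prin_mulP; exists (emb r); split; first exact: C_id.
  by rewrite -er mulrC mulfK.
Qed.

(** [star_f] witnesses [1] by finitely many elements of the product, each involving finitely many
    elements of the colon. The sum of the homogeneous ideals found for these is the inverse. *)
Lemma invertS_of_star E (xs : seq R) : (forall x, x \in xs -> hom x) -> E = span (map emb xs) ->
  E != 0 -> star_f st (mulset E (colon (@Rset R) E)) 1 -> invertS E.
Proof.
move=> hx eE nE [ys [ny [hys s1]]]; rewrite -spanE in hys s1.
have [T [hT T1 TE]] : exists T, [/\ fgh T, T * E ≤ 1 & span ys ≤ T * E].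
  have h y : mulset E (colon (@Rset R) E) y -> exists T, [/\ fgh T, T * E ≤ 1 & scar (T * E) y].
    elim/mulset_ind.
    - exists 0; rewrite mul0r; split; [exact: fgh0|exact: leS0|exact: smod0].
    - move=> a b [T [hT T1 Ta]] [T' [hT' T1' Ta']]; exists (T + T'); rewrite mulrDl; split.
      + exact: fgh_D.
      + exact: leS_add.
      + by exists a, b.
    - move=> a t ha /(colon_homogeneous hx eE nE)[T [hT T1 Tt]]; exists T; split=> //.
      by rewrite mulrC; apply: mulS_mem.
  have {hys} : forall y, y \in ys -> mulset E (colon (@Rset R) E) y.
    by move=> y hy; apply: hys; apply: span_mem.
  elim: ys {ny s1} => [|y ys IH] hy.
    by exists 0; rewrite mul0r /span big_nil; split; [exact: fgh0|exact: leS0|exact: leS_refl].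
  have [|T [hT T1 Ty]] := IH; first by move=> z hz; apply: hy; rewrite inE hz orbT.
  have [T' [hT' T1' Ty']] := h y (hy y (mem_head _ _)).
  exists (T' + T); rewrite mulrDl /span big_cons; split; [exact: fgh_D|exact: leS_add|].
  by apply: leS_addS => //; apply/prin_le.
have nys : span ys != 0 by apply/span_neq0.
exists T; split=> //; apply: big_of_one => //; first exact: leS_neq0 TE nys.
exact: (st_mono nys TE).
Qed.

Lemma ideal_of_fgh E : fgh E -> E ≤ 1 -> E != 0 -> exists I : R -> Prop,
  [/\ idealR I, homogR Rg I, fgR I, nonzeroR I & embK I = scar E].
Proof.
move=> hE E1 nE; have [js [hj ej]] := fgh_le1 hgr hE E1; exists (fun r => E (emb r)); split.
- split; first by rewrite emb0; apply: smod0.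
    by move=> x y hx hy; rewrite embD; apply: smodD.
  by move=> r x hx; rewrite embM; apply: smodZ.
- move=> r s f hr dec a ha; have := fgh_comp hE hr (C_mem hgr r a).
  by rewrite (comp_uniq hgr a dec) ha.
- exists js => x; rewrite ej spanE; split.
    move=> [c [hc ec]]; exists (fun i => projT1 (cid (hc i))).
    apply: emb_inj; rewrite ec emb_sum size_map; apply: eq_bigr => i _.
    by rewrite embM (nth_map 0) //; case: cid => /= r ->.
  move=> [c ->]; exists (fun i => emb (c i)); split; first by move=> i; exists (c i).
  by rewrite emb_sum size_map; apply: eq_bigr => i _; rewrite embM (nth_map 0).
- have /neq0S[z [hz nz]] := nE; have [r er] := E1 _ hz; exists r; rewrite -er; split=> //.
  by rewrite -emb_eq0 -er.
- apply/funext => z; apply/propext; split; first by move=> [r [hr ->]].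
  by move=> hz; have [r er] := E1 _ hz; exists r; rewrite -er.
Qed.

Lemma fgh_of_ideal (I : R -> Prop) : idealR I -> homogR Rg I -> fgR I -> nonzeroR I ->
  exists E, [/\ fgh E, E ≤ 1, E != 0 & embK I = scar E].
Proof.
move=> [I0 ID IM] homI [xs fgI] [z0 [hz0 nz0]].
have sI : submod (@Rset R) (embK I).
  split; first by exists 0; rewrite emb0.
    by move=> _ _ [a [ha ->]] [b [hb ->]]; exists (a + b); rewrite embD; split=> //; apply: ID.
  by move=> _ _ [r ->] [b [hb ->]]; exists (r * b); rewrite embM; split=> //; apply: IM.
exists (Smod sI); split=> //; last first.
- by apply/neq0S; exists (emb z0); rewrite emb_eq0; split=> //; exists z0.
- by move=> _ [r [_ ->]]; exists r.
suff -> : Smod sI = \sum_(x <- xs) C x by apply: fgh_sum => x _; apply: fgh_C.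
apply: leS_anti.
  move=> _ [r [/fgI[c ->] ->]]; rewrite emb_sum; apply: smod_sum => i _ _; rewrite embM; apply: smodZ.
  by apply: (leS_bigsum (f := C) (mem_nth 0 (ltn_ord i))); apply: C_id.
apply: leS_sum => x hx; apply/C_le => a.
have hI : I x.
  apply/fgI; exists (fun i => if i == index x xs then 1 else 0).
  have hi : (index x xs < size xs)%N by rewrite index_mem.
  rewrite (bigD1 (Ordinal hi)) //= eqxx mul1r nth_index // big1 ?addr0 // => i ni.
  by rewrite ifN ?mul0r //; apply: contra ni => /eqP e; apply/eqP/val_inj.
have [ha|ha] := boolP (a \in supp hgr x); last by rewrite comp_notin // emb0; apply: smod0.
by exists (comp x a); split=> //; apply: (homI _ _ _ hI (decomp_comp hgr x)).
Qed.

Lemma GPsMD_invertible : GPsMD Rg st <-> all_invertible.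
Proof.
split.
  move=> h E hE nE; have [d [xs [hd nd hx e]]] := fgh_denominator hgr hE.
  have nd' : emb d != 0 by rewrite emb_eq0.
  set F := prin (emb d) * E in e.
  have nF : F != 0 by apply: mulS_neq0 => //; apply: prin_neq0.
  have hF : fgh F by rewrite e; apply: fgh_span => _ /mapP[x /hx hh ->]; apply: homKe.
  have F1 : F ≤ 1 by rewrite e; apply/span_le => _ /mapP[x _ ->]; exists x.
  suff [T [hT T1 bT]] : invertS F.
    by exists (T * prin (emb d)); rewrite -mulrA; split=> //; apply: fghM => //; apply/fgh_prin/homKe.
  apply: (invertS_of_star hx e nF).
  have [I [iI hI fI nI <-]] := ideal_of_fgh hF F1 nF.
  apply/(h I) => //; apply: (@st_ext 1); first exact: one_neq0.
  by exists 1; rewrite emb1.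
move=> h I iI hI fI nI; have [E [hE E1 nE ->]] := fgh_of_ideal iI hI fI nI.
have [T [hT T1 bT]] := h E hE nE; move=> x; split.
  move=> [ys [ny [hys]]]; rewrite -spanE in hys *; apply: (@st_mono (span ys) 1); first exact/span_neq0.
  by move=> z /hys; elim/mulset_ind; [exact: smod0|exact: smodD|move=> a b ha; rewrite mulrC; apply].
move=> hx; have [ys [_ eys]] := fghM hT hE.
exists ys; rewrite -spanE -eys; split; first by apply/span_neq0; rewrite -eys; apply: big_neq0.
split; last by case: bT => _ _ /(_ x) [_]; apply.
move=> z; elim/mulset_ind; [exact: mulset0|exact: mulsetD|].
move=> t y ht hy; rewrite mulrC; apply: mulset1 => // w hw.
by apply: T1; apply: mulS_mem.
Qed.

Local Notation L := {fraction {poly R}}.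
Local Notation embP := (@embP R).
Local Notation NA := (NA Rg st).

(** * The Nagata ring *)

Lemma embP_eq0 p : (embP p == 0) = (p == 0). Proof. exact: tofrac_eq0. Qed.
Lemma embP_M p q : embP (p * q) = embP p * embP q. Proof. exact: rmorphM. Qed.
Lemma embP_D p q : embP (p + q) = embP p + embP q. Proof. exact: rmorphD. Qed.
Lemma embP_0 : embP 0 = 0. Proof. exact: rmorph0. Qed.
Lemma embP_1 : embP 1 = 1. Proof. exact: rmorph1. Qed.
Lemma embP_sum (I : Type) (r : seq I) (P : pred I) (F : I -> {poly R}) :
  embP (\sum_(i <- r | P i) F i) = \sum_(i <- r | P i) embP (F i).
Proof. exact: rmorph_sum. Qed.
Lemma embP_inj : injective embP.
Proof. by move=> x y /eqP; rewrite /Defs.embP tofrac_eq => /eqP. Qed.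
Lemma embP_div_eq p q p' q' : q != 0 -> q' != 0 -> p * q' = p' * q ->
  embP p / embP q = embP p' / embP q'.
Proof.
move=> nq nq' e; apply/eqP; rewrite eqr_div ?embP_eq0 //; apply/eqP.
by rewrite -!embP_M e.
Qed.

Lemma A_zero : A 0 = 0.
Proof.
apply: leS_anti; last exact: leS0.
by apply/A_le => i a; rewrite coef0 comp0 emb0.
Qed.

Definition inN p := big (A p).
Lemma inN_neq0 p : inN p -> p != 0.
Proof.
by move=> /big_neq0; apply: contraNneq => ->; rewrite A_zero. Qed.
Lemma inN1 : inN 1. Proof. by rewrite /inN A_1; apply: big1S. Qed.
(** Dedekind-Mertens puts the big ideal [A p ^+ k.+1 * A q] inside [A (p * q)]. *)
Lemma inN_M p q : inN p -> inN q -> inN (p * q).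
Proof.
move=> hp hq; have [k hk] := A_dedekind_mertens hgr p q.
have hpq : A p ^+ k * A (p * q) ≤ A (p * q) by apply: mulS_le1l; apply: expS_le1; apply: A_le1.
apply: (big_le (big_M (big_X k.+1 hp) hq)); last exact: A_le1.
exact: leS_trans hk hpq.
Qed.
Lemma NAP z : NA z <-> exists f g, inN g /\ z = embP f / embP g.
Proof.
split=> [[f [g [ng [hg ->]]]]|[f [g [hg ->]]]]; exists f, g.
  rewrite (AsetE hgr) in hg; split=> //; split=> //; [exact: A_le1|exact: A_neq0].
split; first exact: inN_neq0.
by split=> //; rewrite (AsetE hgr); case: hg.
Qed.
Lemma NA_embP f : NA (embP f).
Proof. by apply/NAP; exists f, 1; rewrite embP_1 divr1; split=> //; apply: inN1. Qed.
Lemma NA_0 : NA 0. Proof. by rewrite -embP_0; apply: NA_embP. Qed.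
Lemma NA_1 : NA 1. Proof. by rewrite -embP_1; apply: NA_embP. Qed.
Lemma NA_M x y : NA x -> NA y -> NA (x * y).
Proof.
move=> /NAP[f [g [hg ->]]] /NAP[f' [g' [hg' ->]]]; apply/NAP; exists (f * f'), (g * g').
by rewrite !embP_M mulf_div; split=> //; apply: inN_M.
Qed.
Lemma NA_D x y : NA x -> NA y -> NA (x + y).
Proof.
move=> /NAP[f [g [hg ->]]] /NAP[f' [g' [hg' ->]]]; apply/NAP; exists (f * g' + f' * g), (g * g').
rewrite embP_D !embP_M addf_div ?embP_eq0 ?inN_neq0 //; split=> //; exact: inN_M.
Qed.
Lemma NA_V g : inN g -> NA (embP g)^-1.
Proof. by move=> hg; apply/NAP; exists 1, g; rewrite embP_1 div1r. Qed.
Lemma NA_submod xs : submod NA (dspan NA xs).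
Proof. by apply: dspan_submod; [exact: NA_0|exact: NA_D|exact: NA_M]. Qed.
Lemma NA_mem xs x : x \in xs -> dspan NA xs x.
Proof. by apply: dspan_mem; [exact: NA_0|exact: NA_1]. Qed.
Lemma NA_dspan_sub xs : (forall x, x \in xs -> NA x) -> subs (dspan NA xs) NA.
Proof.
move=> h z; elim/dspan_ind; [exact: NA_0|exact: NA_D|].
by move=> r x hr /h hx; apply: NA_M.
Qed.
Lemma dspan_single (D : L -> Prop) x z : dspan D [:: x] z <-> exists2 c, D c & z = c * x.
Proof.
split=> [[c [hc ->]]|[c hc ->]]; first by exists (c 0%N) => //; rewrite big_ord1.
by exists (fun=> c); rewrite big_ord1.
Qed.

(** Stated for any multiplicative set, to serve both [NA] and the unknown denominators in
    [quotient_flat]. *)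
Lemma common_den (S : {poly R} -> Prop) (zs : seq L) : S 1 -> (forall a b, S a -> S b -> S (a * b)) ->
  (forall s, S s -> s != 0) -> (forall z, z \in zs -> exists f s, S s /\ z = embP f / embP s) ->
  exists s (num : L -> {poly R}), S s /\ forall z, z \in zs -> z = embP (num z) / embP s.
Proof.
move=> S1 SM S0 h; suff [s [Ss hs]] : exists s, S s /\ forall z, z \in zs -> exists f, z = embP f / embP s.
  have hn z : exists f, z \in zs -> z = embP f / embP s.
    by have [/hs[f e]|nz] := boolP (z \in zs); [exists f|exists 0].
  by exists s, (fun z => projT1 (cid (hn z))); split=> // z hz; case: cid => f /=; apply.
elim: zs h => [|z zs IH] h; first by exists 1.
have [|s [Ss hs]] := IH; first by move=> w hw; apply: h; rewrite inE hw orbT.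
have [f [t [St ez]]] := h z (mem_head _ _); exists (s * t); split; first exact: SM.
move=> w; rewrite inE => /orP[/eqP ->|/hs[f' ->]].
  by exists (f * s); rewrite ez; apply: embP_div_eq; [exact: S0|exact/S0/SM|rewrite mulrA].
by exists (f' * t); apply: embP_div_eq; [exact: S0|exact/S0/SM|ring].
Qed.
Lemma NA_common (zs : seq L) : (forall z, z \in zs -> NA z) ->
  exists g (num : L -> {poly R}), inN g /\ forall z, z \in zs -> z = embP (num z) / embP g.
Proof.
move=> h; apply: common_den; [exact: inN1|exact: inN_M|exact: inN_neq0|].
by move=> z /h/NAP.
Qed.

(* [q] is a polynomial whose content is, up to the denominator [d], a homogeneous inverse of
   the content of [f]. *)
Lemma content_inverse f : all_invertible -> f != 0 -> exists q d p,
  [/\ hom d, d != 0, A f * A q ≤ prin (emb d), f * q = d *: p & inN p].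
Proof.
move=> hinv nf; have [T [hT T1 bT]] := hinv (A f) (fgh_A hgr f) (A_neq0 hgr nf).
have [d [xs [hd nd hx e]]] := fgh_denominator hgr hT.
have nd' : emb d != 0 by rewrite emb_eq0.
have hdT : fgh (prin (emb d) * T) by apply: fghM => //; apply/fgh_prin/homKe.
have dT1 : prin (emb d) * T ≤ 1 by rewrite e; apply/span_le => _ /mapP[x _ ->]; exists x.
have [q eq] := fgh_le1_A hgr hdT dT1.
have hfq : A f * A q ≤ prin (emb d) by rewrite eq mulrCA [A f * T]mulrC; apply: mulS_le1r.
have [p ep] := hom_A_le hd nd (leS_trans (A_M hgr f q) hfq).
exists q, d, p; split=> //.
have [k hk] := A_dedekind_mertens hgr f q.
(* This is Dedekind-Mertens multiplied by [T ^+ k]; the factor [d] cancels, as [A q] is [d T] and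
   [A (f * q)] is [d A p]. *)
have h : (T * A f) ^+ k.+1 ≤ (T * A f) ^+ k * A p.
  apply: (prin_cancel nd').
  have := leS_mull (T ^+ k) hk; rewrite ep (A_Z hgr _ hd) eq.
  rewrite (_ : T ^+ k * _ = prin (emb d) * (T * A f) ^+ k.+1); last by rewrite !exprMn !exprS; ring.
  by rewrite (_ : T ^+ k * _ = prin (emb d) * ((T * A f) ^+ k * A p)) // !exprMn; ring.
apply: (big_le (big_X k.+1 bT)); last exact: A_le1.
by apply: leS_trans h _; apply: mulS_le1l; apply: expS_le1.
Qed.

(** Let [j] have content [J] and let [q] be the content inverse of [f]. The content of [u j q] lies
    in [A f * A q], hence in [d R], so [d] cancels from [u j q / (f q j)] and leaves the denominator
    [p * j] in [inN]. *)
Lemma NA_div u f : all_invertible -> f != 0 -> A u ⊑ A f -> NA (embP u / embP f).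
Proof.
move=> hinv nf [J [hJ bJ h]]; have [j ej] := fgh_le1_A hgr hJ (big_le1 bJ).
have [q [d [p [hd nd hfq eqf hp]]]] := content_inverse hinv nf.
have [w ew] : exists w, u * j * q = d *: w.
  apply: (hom_A_le (hgr := hgr) hd nd); apply: leS_trans hfq; apply: (leS_trans (A_M hgr _ _)).
  by apply: leS_mulr; apply: (leS_trans (A_M hgr _ _)); rewrite ej.
have hj : inN j by rewrite /inN ej.
apply/NAP; exists w, (p * j); split; first exact: inN_M.
apply: embP_div_eq => //; first by rewrite mulf_neq0 ?inN_neq0.
have ndP : d%:P != 0 by rewrite polyC_eq0.
rewrite -!mul_polyC in ew eqf; apply: (mulfI ndP); rewrite [RHS]mulrA -ew.
transitivity (u * j * (d%:P * p)); first by ring.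
by rewrite -eqf; ring.
Qed.

Lemma combine_contents (P : {poly R} -> Prop) (fs : seq {poly R}) : P 0 ->
  (forall f g, P f -> P g -> P (f + g)) -> (forall f g, P f -> P (g * f)) ->
  (forall f, f \in fs -> P f) -> exists d, P d /\ forall f, f \in fs -> A f ≤ A d.
Proof.
move=> P0 PD PM; elim: fs => [|f fs IH] h; first by exists 0.
have [|d [Pd hd]] := IH; first by move=> g hg; apply: h; rewrite inE hg orbT.
exists (f + 'X^(size f) * d); split; first by apply: PD; [apply: h; rewrite inE eqxx|apply: PM].
move=> g; rewrite inE => /orP[/eqP ->|/hd hg]; first exact: A_catl.
by apply: leS_trans hg _; apply: A_catr.
Qed.

(** Over a common denominator the numerators of the generators are concatenated into one polynomial
    [d] of the ideal. Its content contains theirs, so [NA_div] makes each a multiple of [d]. *)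
Lemma invertible_bezout : all_invertible -> bezout NA.
Proof.
move=> hinv E [[EN [E0 ED EM]] [xs [hx eE]]].
have hxs x : x \in xs -> NA x by move=> h; rewrite -(nth_index 0 h); apply: hx; rewrite index_mem.
have [g [num [hg hn]]] := NA_common hxs.
have ng : embP g != 0 by rewrite embP_eq0 inN_neq0.
have [||||d [Pd hd]] := @combine_contents (fun f => E (embP f / embP g)) (map num xs).
- by rewrite embP_0 mul0r.
- by move=> f f' h h'; rewrite embP_D mulrDl; apply: ED.
- by move=> f f' h; rewrite embP_M -mulrA; apply: EM => //; apply: NA_embP.
- by move=> _ /mapP[x hx' ->]; rewrite -hn //; apply/eE; apply: NA_mem.
exists (embP d / embP g); split; first exact: EN.
move=> z; split; last by move=> /dspan_single[c hc ->]; apply: EM.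
move=> /eE; have [S0 SD SM] := NA_submod [:: embP d / embP g].
elim/dspan_ind => // r x hr hx'; apply: (SM) => //; apply/dspan_single.
have [d0|nd] := eqVneq d 0.
  exists 0; first exact: NA_0.
  rewrite mul0r (hn x hx'); have := hd (num x) (map_f num hx').
  rewrite d0 => h; suff -> : num x = 0 by rewrite embP_0 mul0r.
  apply/eqP; apply: contraT => /(A_neq0 hgr) /(leS_neq0 h).
  by rewrite A_zero eqxx.
exists (embP (num x) / embP d).
  apply: NA_div => //; apply: below_le; [exact: (fgh1 hgr)|].
  by apply: hd; apply: map_f.
by rewrite mulrA divfK ?embP_eq0 // -hn.
Qed.

Lemma bezout_prufer : bezout NA -> prufer NA.
Proof.
move=> hb E hE [y [hy ny]]; have [x [hx ex]] := hb E hE.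
have [c hc ey] : exists2 c, NA c & y = c * x by apply/dspan_single/ex.
have nx : x != 0 by apply: contraNneq ny => x0; rewrite ey x0 mulr0.
move=> z; split.
  elim/mulset_ind; [exact: NA_0|exact: NA_D|move=> a b ha hb'].
  by rewrite mulrC; apply: hb'.
move=> hz; have -> : z = x * (z / x) by rewrite mulrC divfK.
apply: mulset1; first by apply/ex/dspan_single; exists 1; [exact: NA_1|rewrite mul1r].
move=> w /ex/dspan_single[c' hc' ->]; rewrite mulrCA divfK //.
exact: NA_M.
Qed.

Lemma div_common (F : fieldType) (a c d : F) : c != 0 -> d != 0 -> a / c = (c * d)^-1 * (a * d).
Proof. by move=> nc nd; field; rewrite nc nd. Qed.
Lemma invertible_of_pairs :
  (forall a b, hom a -> hom b -> a != 0 -> b != 0 -> invertS (prin (emb a) + prin (emb b))) ->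
  all_invertible.
Proof.
move=> h; apply: invertS_pairs => _ _ [a [c [ha hc nc ->]]] [b [d [hb hd nd ->]]] nx ny.
have na : a != 0 by apply: contraNneq nx => ->; rewrite emb0 mul0r.
have nb : b != 0 by apply: contraNneq ny => ->; rewrite emb0 mul0r.
have ncd : emb (c * d) != 0 by rewrite emb_eq0 mulf_neq0.
have hcd : homK Rg (emb (c * d)) by apply: homKe; apply: (homM hgr).
rewrite (_ : _ + _ = prin (emb (c * d))^-1 * (prin (emb (a * d)) + prin (emb (b * c)))).
  apply: invertS_M; first by apply: invertS_prin; rewrite ?invr_eq0 //; apply: homK_V.
  by apply: h; rewrite ?mulf_neq0 //; apply: (homM hgr).
have e1 : emb a / emb c = (emb (c * d))^-1 * emb (a * d).
  by rewrite !embM; apply: div_common; rewrite emb_eq0.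
have e2 : emb b / emb d = (emb (c * d))^-1 * emb (b * c).
  by rewrite [c * d]mulrC !embM; apply: div_common; rewrite emb_eq0.
by rewrite mulrDr -!prinM -e1 -e2.
Qed.

(** It evaluates products of a candidate inverse with [a] or [b]: the fractional ideal [(a / b) A p]
    is the content of a polynomial, hence lies in [R]. *)
Lemma A_swap a b p q : hom a -> hom b -> b != 0 -> a *: p = b *: q ->
  prin (emb b)^-1 * A p * prin (emb a) = A q.
Proof.
move=> ha hb nb e; rewrite -mulrA [A p * _]mulrC -(A_Z hgr p ha) e (A_Z hgr q hb).
by rewrite mulrA prinVl ?emb_eq0 // mul1r.
Qed.
Lemma fgh_pV a : hom a -> a != 0 -> fgh (prin (emb a)^-1).
Proof. by move=> ha na; apply/fgh_prin/homK_V; [exact: homKe|rewrite emb_eq0]. Qed.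

(** Write [1 = z1 a + z2 b] with [z1], [z2] in the colon, and let [p1 / g], [p2 / g], [p3 / g],
    [p4 / g] be the products of [z1] and [z2] with [a] and [b]. The inverse consists of the contents
    of [z1 g = p1 / a] and [z2 g = p4 / b]; its product with [(a, b)] is the sum of the four
    contents, which contains [A g] because [p1 + p4 = g]. *)
Lemma prufer_invertible : prufer NA -> all_invertible.
Proof.
move=> hp; apply: invertible_of_pairs => a b ha hb na nb.
have [xa exa] : exists x, x = embP a%:P by exists (embP a%:P).
have [xb exb] : exists x, x = embP b%:P by exists (embP b%:P).
pose E := dspan NA [:: xa; xb].
have nxa : xa != 0 by rewrite exa embP_eq0 polyC_eq0.
have NAa : NA xa by rewrite exa; apply: NA_embP.
have NAb : NA xb by rewrite exb; apply: NA_embP.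
have Ea : E xa by apply: NA_mem; rewrite inE eqxx.
have Eb : E xb by apply: NA_mem; rewrite !inE eqxx orbT.
have idE : ideal NA E.
  split; last exact: NA_submod.
  by apply: NA_dspan_sub => x; rewrite !inE => /orP[]/eqP ->.
have fgE : fgideal NA E.
  by split=> //; exists [:: xa; xb]; split=> // -[|[|]].
have nzE : nonzero E by exists xa; split.
have [z1 [z2 [hz1 hz2 e1]]] : exists z1 z2, [/\ colon NA E z1, colon NA E z2 & 1 = z1 * xa + z2 * xb].
  have := NA_1; move/(hp E fgE nzE 1); elim/mulset_ind.
  - by exists 0, 0; rewrite !mul0r addr0; split=> // y _; rewrite mul0r; apply: NA_0.
  - move=> x y [z1 [z2 [h1 h2 ->]]] [w1 [w2 [k1 k2 ->]]]; exists (z1 + w1), (z2 + w2).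
    split; last by rewrite !mulrDl addrACA.
      by move=> v hv; rewrite mulrDl; apply: NA_D; [apply: h1|apply: k1].
    by move=> v hv; rewrite mulrDl; apply: NA_D; [apply: h2|apply: k2].
  - move=> x t [c [hc ->]] ht; exists (c 0%N * t), (c 1%N * t).
    split; first by move=> v hv; rewrite -mulrA; apply: NA_M => //; apply: ht.
      by move=> v hv; rewrite -mulrA; apply: NA_M => //; apply: ht.
    by rewrite big_ord_recl big_ord1 mulrDl ![_ * t * _]mulrAC.
have [g [num [hg hn]]] : exists g num, inN g /\ forall z,
    z \in [:: z1 * xa; z1 * xb; z2 * xa; z2 * xb] -> z = embP (num z) / embP g.
  apply: NA_common => z; rewrite !inE => /or4P[]/eqP ->; by [apply: hz1|apply: hz2].
have ng : embP g != 0 by rewrite embP_eq0 inN_neq0.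
set p1 := num (z1 * xa); set p2 := num (z1 * xb); set p3 := num (z2 * xa); set p4 := num (z2 * xb).
have h1 : z1 * xa = embP p1 / embP g by apply: hn; rewrite !inE; apply/or4P/Or41/eqxx.
have h2 : z1 * xb = embP p2 / embP g by apply: hn; rewrite !inE; apply/or4P/Or42/eqxx.
have h3 : z2 * xa = embP p3 / embP g by apply: hn; rewrite !inE; apply/or4P/Or43/eqxx.
have h4 : z2 * xb = embP p4 / embP g by apply: hn; rewrite !inE; apply/or4P/Or44/eqxx.
have cross z p q : z * xa = embP p / embP g -> z * xb = embP q / embP g -> b *: p = a *: q.
  move=> e e'; apply: embP_inj; rewrite -!mul_polyC !embP_M -exa -exb.
  by apply: (mulIf (invr_neq0 ng)); rewrite -!mulrA -e -e' [LHS]mulrCA [RHS]mulrCA [xa * xb]mulrC.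
have eg : p1 + p4 = g.
  apply: embP_inj; apply: (mulIf (invr_neq0 ng)).
  by rewrite embP_D mulrDl -h1 -h4 -e1 mulfV.
exists (prin (emb a)^-1 * A p1 + prin (emb b)^-1 * A p4).
have eT : (prin (emb a)^-1 * A p1 + prin (emb b)^-1 * A p4) * (prin (emb a) + prin (emb b))
   = A p1 + A p2 + (A p3 + A p4).
  rewrite mulrDl !mulrDr (A_swap ha ha na (erefl (a *: p1))) (A_swap hb ha na (cross _ _ _ h1 h2)).
  by rewrite (A_swap ha hb nb (esym (cross _ _ _ h3 h4))) (A_swap hb hb nb (erefl (b *: p4))).
have T1 : A p1 + A p2 + (A p3 + A p4) ≤ 1 by do !apply: leS_add; apply: A_le1.
rewrite eT; split=> //.
  by apply: fgh_D; apply: fghM; [exact: fgh_pV|exact: fgh_A|exact: fgh_pV|exact: fgh_A].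
apply: (big_le hg) => //; rewrite -eg; apply: (leS_trans (A_D hgr _ _)); apply: leS_addS.
  exact: leS_addl.
exact: leS_addr.
Qed.

Lemma poly_sum p : p = \sum_(i < size p) (p`_i)%:P * 'X^i.
Proof. by rewrite -{1}[p]coefK poly_def; apply: eq_bigr => i _; rewrite mul_polyC. Qed.

(** [I] is the contraction of [J]. A component of [r], or a coefficient of [f], has content inside
    that of [r] or [f], so [NA_div] makes it a multiple of that element in [NA]. *)
Lemma invertible_extended : all_invertible -> forall J : L -> Prop, ideal NA J ->
  exists I, [/\ idealR I, homogR Rg I & seteq J (extended I NA)].
Proof.
move=> hinv J [JN [J0 JD JM]]; exists (fun r => J (embP r%:P)); split.
- split; first by rewrite polyC0 embP_0.
    by move=> x y hx hy; rewrite polyCD embP_D; apply: JD.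
  by move=> r x hx; rewrite polyCM embP_M; apply: JM => //; apply: NA_embP.
- move=> r s f hr dec a ha; have -> : f a = comp r a by rewrite (comp_uniq hgr a dec) ha.
  have [r0|nr] := eqVneq r 0; first by rewrite r0 comp0 polyC0 embP_0.
  have nrP : r%:P != 0 by rewrite polyC_eq0.
  rewrite -[embP _](divfK (_ : embP r%:P != 0)) ?embP_eq0 //; apply: JM => //.
  apply: NA_div => //; apply: below_le; first exact: (fgh1 hgr).
  rewrite !A_const C_hom; last exact: comp_hom.
  by apply/prin_le; apply: C_mem.
- move=> z; split; last first.
    elim/mulset_ind => // _ y [r [hr ->]] hy; rewrite mulrC; exact: JM.
  move=> hz; have /NAP[f [g [hg ez]]] := JN _ hz.
  have ng : embP g != 0 by rewrite embP_eq0 inN_neq0.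
  have Jf : J (embP f).
    by rewrite -[embP f](divfK ng) -ez mulrC; apply: JM => //; apply: NA_embP.
  have [f0|nf] := eqVneq f 0; first by rewrite ez f0 embP_0 mul0r; apply: mulset0.
  have -> : z = \sum_(i < size f) embP (f`_i)%:P * (embP 'X^i / embP g).
    by rewrite ez {1}(poly_sum f) embP_sum mulr_suml; apply: eq_bigr => i _; rewrite embP_M mulrA.
  apply: mulset_sum => i; last by apply: NA_M; [exact: NA_embP|exact: NA_V].
  exists f`_i; split=> //.
  rewrite -[embP _](divfK (_ : embP f != 0)) ?embP_eq0 //; apply: JM => //.
  apply: NA_div => //; apply: below_le; first exact: (fgh1 hgr).
  by rewrite A_const; apply: A_coef.
Qed.

Lemma extended_principal :
  (forall J : L -> Prop, ideal NA J -> exists I, [/\ idealR I, homogR Rg I & seteq J (extended I NA)]) ->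
  forall x, NA x -> exists I, [/\ idealR I, homogR Rg I & seteq (dspan NA [:: x]) (extended I NA)].
Proof.
move=> h x hx; apply: h; split; last exact: NA_submod.
by apply: NA_dspan_sub => y; rewrite inE => /eqP ->.
Qed.

Lemma A_pair a b : hom a -> hom b -> A (a%:P + b%:P * 'X) = prin (emb a) + prin (emb b).
Proof.
move=> ha hb; rewrite -(C_hom hgr ha) -(C_hom hgr hb); apply: leS_anti.
  apply: (leS_trans (A_D hgr _ _)); rewrite A_const; apply: leS_addS; first exact: leS_refl.
  apply: (leS_trans (A_M hgr _ _)); rewrite A_const; apply: mulS_le1r; exact: A_le1.
apply: leS_add.
  have := A_coef hgr (a%:P + b%:P * 'X) 0; by rewrite coefD coefC coefMX /= addr0.
by have := A_coef hgr (a%:P + b%:P * 'X) 1; rewrite coefD coefC coefMX coefC /= add0r.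
Qed.

Lemma pair_neq0 a b : a != 0 -> a%:P + b%:P * 'X != 0 :> {poly R}.
Proof.
move=> na; apply: contraNneq na => /(congr1 (fun p : {poly R} => p`_0)).
by rewrite coefD coefC coefMX coef0 /= addr0 => ->.
Qed.

(** With [f = a + b X], the equality [f NA = I NA] is written both ways over a common denominator
    [g]: [f g] is the sum of the [t p_t] and [t g = q_t f], for finitely many homogeneous [t] in
    [I]. Dedekind-Mertens for [q_t f] then exhibits elements of the inverse of [A f]. *)
Lemma principal_extended_invertible :
  (forall x, NA x -> exists I, [/\ idealR I, homogR Rg I & seteq (dspan NA [:: x]) (extended I NA)]) ->
  all_invertible.
Proof.
move=> h; apply: invertible_of_pairs => a b ha hb na nb.
set f := a%:P + b%:P * 'X; rewrite -(A_pair ha hb) -/f.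
have nf : f != 0 by apply: pair_neq0.
have [I [iI hI eI]] := h (embP f) (NA_embP f).
have [l [hl ef]] : exists l : seq (R * L),
    (forall t, t \in l -> [/\ hom t.1, t.1 != 0, I t.1 & NA t.2]) /\
    embP f = \sum_(t <- l) embP t.1%:P * t.2.
  have : extended I NA (embP f) by apply/eI; apply: NA_mem; rewrite inE eqxx.
  elim/mulset_ind; first by exists [::]; rewrite big_nil.
    move=> x y [l [hl ->]] [l' [hl' ->]]; exists (l ++ l'); rewrite big_cat; split=> // t.
    by rewrite mem_cat => /orP[/hl|/hl'].
  move=> _ y [r [hr ->]] hy; exists [seq (comp r c, y) | c <- supp hgr r & comp r c != 0].
  split.
    move=> t /mapP[c]; rewrite mem_filter => /andP[nc hc] ->; split=> //; first exact: comp_hom.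
    exact: (hI _ _ _ hr (decomp_comp hgr r) c hc).
  rewrite big_map big_filter -mulr_suml -embP_sum; congr (embP _ * _).
  rewrite {1}(comp_sum hgr r) rmorph_sum [RHS]big_mkcond; apply: eq_bigr => c _ /=.
  by case: eqP => // ->; rewrite polyC0.
have hc_ r : exists c, I r -> NA c /\ embP r%:P = c * embP f.
  have [hr|nr] := pselect (I r); last by exists 0.
  have : extended I NA (embP r%:P).
    by rewrite -[embP _]mulr1; apply: mulset1; [exists r|exact: NA_1].
  by move=> /eI/dspan_single[c hc e]; exists c.
pose cf r := projT1 (cid (hc_ r)).
have hcf r : I r -> NA (cf r) /\ embP r%:P = cf r * embP f by rewrite /cf; case: cid.
have [g [num [hg hn]]] : exists g num, inN g /\ forall z,
    z \in [seq t.2 | t <- l] ++ [seq cf t.1 | t <- l] -> z = embP (num z) / embP g.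
  apply: NA_common => z; rewrite mem_cat => /orP[]/mapP[t /hl[_ _ It Nt] ->] //.
  by case: (hcf _ It).
have ng : embP g != 0 by rewrite embP_eq0 inN_neq0.
pose p (t : R * L) := num t.2; pose q (t : R * L) := num (cf t.1).
have ep t : t \in l -> embP (p t) = t.2 * embP g.
  by move=> ht; rewrite /p [in RHS](hn t.2) ?divfK // mem_cat map_f.
have eq t : t \in l -> t.1 *: g = q t * f.
  move=> ht; have [_ _ It _] := hl t ht; have [_ e] := hcf _ It.
  apply: embP_inj; rewrite -mul_polyC !embP_M e (hn (cf t.1)) -/(q t); last first.
    by rewrite mem_cat (map_f (fun t => cf t.1)) ?orbT.
  by rewrite mulrAC divfK.
(* Substituting one system of equations into the other and cancelling [f] shows that the contents of
   the [q t] together are big. *)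
have egg : g * g = \sum_(t <- l) q t * p t.
  apply: (mulIf nf); rewrite mulr_suml; transitivity (g * \sum_(t <- l) t.1%:P * p t).
    rewrite -mulrA; congr (_ * _); apply: embP_inj.
    rewrite embP_M ef mulr_sumr embP_sum big_seq [RHS]big_seq; apply: eq_bigr => t ht.
    by rewrite embP_M ep // mulrC mulrA.
  rewrite mulr_sumr big_seq [RHS]big_seq; apply: eq_bigr => t ht.
  by rewrite mulrAC -eq // -mul_polyC; ring.
have bq : big (\sum_(t <- l) A (q t)).
  apply: (big_le (inN_M hg hg)); last by apply: leS_sum => t _; apply: A_le1.
  rewrite egg; apply: (leS_trans (A_sum hgr _ _)); apply: leS_sum => t ht.
  apply: leS_trans (leS_bigsum (f := fun t => A (q t)) ht).
  by apply: (leS_trans (A_M hgr _ _)); apply: mulS_le1r; apply: A_le1.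
pose k t := projT1 (cid (A_dedekind_mertens hgr (q t) f)).
have hk t : A (q t) ^+ (k t).+1 * A f ≤ A (q t) ^+ k t * A (q t * f) by rewrite /k; case: cid.
have nt t : t \in l -> emb t.1 != 0 by move=> /hl[_ n _ _]; rewrite emb_eq0.
have ht t : t \in l -> hom t.1 by move=> /hl[].
(* The exponents are those of Dedekind-Mertens: [A (q t) ^+ (k t).+1 * A f] lies in [A (q t * f)],
   which is [t.1] times [A g]. *)
exists (\sum_(t <- l) prin (emb t.1)^-1 * A (q t) ^+ (k t).+1).
have T1 : (\sum_(t <- l) prin (emb t.1)^-1 * A (q t) ^+ (k t).+1) * A f ≤ 1.
  rewrite mulr_suml; apply: leS_sum => t tl.
  rewrite -mulrA; apply: (leS_trans (leS_mull _ (hk t))); rewrite -eq // (A_Z hgr _ (ht _ tl)).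
  rewrite [A (q t) ^+ k t * _]mulrCA [prin _ * (prin _ * _)]mulrA prinVl ?nt // mul1r -[1]mulr1; apply: leS_mul; last exact: A_le1.
  by apply: expS_le1; apply: A_le1.
split=> //.
  apply: fgh_sum => t tl; apply: fghM; last by apply: (fgh_X hgr); apply: fgh_A.
  by apply: fgh_pV; [exact: ht|rewrite -emb_eq0 nt].
(* The powers of the [A (q t)] still have a big sum. Since [t.1 A g] is the content of [q t * f] and
   so lies in [A f], this sum times [A g] lies in the product of the candidate inverse with
   [A f]. *)
have b1 := @big_sum_exp _ l (fun t => A (q t)) (fun t => (k t).+1) (fun t _ => A_le1 hgr _) bq.
apply: (big_le (big_M b1 hg)) => //; rewrite !mulr_suml; apply: leS_sum => t tl.
apply: leS_trans (leS_bigsum (f := fun t => prin (emb t.1)^-1 * A (q t) ^+ (k t).+1 * A f) tl).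
apply: (prin_cancel (nt _ tl)).
rewrite mulrCA -(A_Z hgr _ (ht _ tl)) eq // [X in _ ≤ X](_ : _ = A (q t) ^+ (k t).+1 * A f); last first.
  by rewrite !mulrA -prinM mulfV ?nt // prin1 mul1r.
apply: leS_mull; apply: (leS_trans (A_M hgr _ _)); apply: mulS_le1l; exact: A_le1.
Qed.

(** * The Kronecker function ring *)

Local Notation tilde := (star_tilde st).
Local Notation KR := (KR Rg tilde).

Lemma fgh_below_fg E F : E ⊑ F -> below fg E F.
Proof. by move=> [J [hJ bJ h]]; exists J; split=> //; apply: fgh_fg hJ. Qed.

Lemma KRP z : KR z <-> exists f g, g != 0 /\
  (exists h, h != 0 /\ A f * A h ⊑ A g * A h) /\ z = embP f / embP g.
Proof.
have E f g h : subs (mulset (Aset Rg f) (Aset Rg h)) (tilde (mulset (Aset Rg g) (Aset Rg h))) <->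
    A f * A h ⊑ A g * A h.
  rewrite !(AsetE hgr) -!mulSE.
  have fgA k : fgh (A k) by apply: fgh_A.
  have fg1 : fgh (A f * A h) by apply: fghM.
  split=> [|hb].
    by move/(below_star_tilde _ (fgh_fg fg1)); apply: below_fgh => //; apply: fghM.
  by apply/(below_star_tilde _ (fgh_fg fg1)); apply: fgh_below_fg.
by split=> -[f [g [ng [[h [nh /E e]] ->]]]]; exists f, g; split=> //; split=> //; exists h.
Qed.

Lemma NA_sub_KR : subs NA KR.
Proof.
move=> z /NAP[f [g [hg ->]]]; apply/KRP; exists f, g; split; first exact: inN_neq0.
split=> //; exists 1; rewrite oner_neq0 A_1 !mulr1; split=> //.
exists (A g); split=> //; first exact: fgh_A.
by apply: mulS_le1l; apply: A_le1.
Qed.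
Lemma invertible_KR : all_invertible -> seteq NA KR.
Proof.
move=> hinv z; split; first exact: NA_sub_KR.
move=> /KRP[f [g [ng [[h [nh e]] ->]]]]; apply: NA_div => //.
by apply: (invertS_cancel (E := A h)) e; [exact: fgh_A|apply: hinv; [exact: fgh_A|exact: A_neq0]].
Qed.
Lemma KR_quotient : seteq NA KR -> quotient_ring_of_RX KR.
Proof.
move=> e; exists inN; split; [exact: inN1|exact: inN_M|by move=> /inN_neq0; rewrite eqxx|].
move=> z; split; first by move=> /e/NAP[f [g [hg ->]]]; exists f, g.
by move=> [f [g [hg ->]]]; apply/e/NAP; exists f, g.
Qed.
Lemma quotient_flat (D : L -> Prop) : quotient_ring_of_RX D -> flat_RX D.
Proof.
move=> [S [S1 SM S0 eD]] n a b hb hab.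
have Sn s : S s -> s != 0 by apply: contraPneq => ->.
have [s [num [Ss hn]]] : exists s num, S s /\
    forall z, z \in [seq b i | i : 'I_n] -> z = embP (num z) / embP s.
  apply: common_den => // z /mapP[i _ ->]; have /eD[f [s [Ss ->]]] := hb i.
  by exists f, s.
have eb i : b i = embP (num (b i)) / embP s by apply: hn; apply: map_f; rewrite mem_enum.
have ns : embP s != 0 by rewrite embP_eq0 Sn.
(* All the [b i] are polynomial multiples of [1 / s], so one generator suffices. *)
exists 1%N, (fun i _ => num (b i)), (fun=> (embP s)^-1); split.
- by move=> _; apply/eD; exists 1, s; rewrite embP_1 div1r.
- by move=> i; rewrite big_ord1 {1}eb.
- move=> _; apply: embP_inj; apply: (mulIf (invr_neq0 ns)).
  rewrite embP_sum embP_0 mul0r mulr_suml -[RHS]hab; apply: eq_bigr => i _.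
  by rewrite embP_M -mulrA -eb.
Qed.

(** * Determinant trick and statement (8) *)

Lemma smod_sign (E : smod R) n x : E x -> E ((-1) ^+ n * x).
Proof.
by move=> h; have := smodZ ((-1) ^+ n) h; rewrite /Defs.emb rmorphXn rmorphN rmorph1.
Qed.

Lemma det_congruent n (E : smod R) (X Y : 'M[K]_n) :
  (forall i j, scar 1 (X i j)) -> (forall i j, scar 1 (Y i j)) ->
  (forall i j, E (X i j - Y i j)) -> E (\det X - \det Y).
Proof.
move=> hX hY h; rewrite /determinant -sumrB; apply: smod_sum => s _ _; rewrite -mulrBr.
apply: smod_sign.
have [_ _ ] : [/\ scar (1 : smod R) (\prod_i X i (s i)), scar (1 : smod R) (\prod_i Y i (s i))
    & E (\prod_i X i (s i) - \prod_i Y i (s i))]; last by [].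
elim/big_rec2: _ => [|i y x _ [hx hy hxy]].
  by rewrite subrr; split; [exists 1; rewrite emb1|exists 1; rewrite emb1|exact: smod0].
have [r er] := hX i (s i); have [u eu] := hy; split.
- by rewrite er; apply: smodZ.
- by have [r' ->] := hY i (s i); apply: smodZ.
- rewrite (_ : _ - _ = X i (s i) * (x - y) + y * (X i (s i) - Y i (s i))); last first.
    by rewrite !mulrBr [y * X _ _]mulrC addrA subrK [y * Y _ _]mulrC.
  by apply: smodD; [rewrite er|rewrite eu]; apply: smodZ.
Qed.

(* Determinant trick: [det (e - M) = 0] for a matrix [M] over [E], and it is congruent to [e^n] modulo [E]. *)
Lemma power_in_ideal (E : smod R) (bs : seq K) (e : K) : E ≤ 1 -> scar 1 e -> span bs != 0 ->
  prin e * span bs ≤ E * span bs -> E (e ^+ size bs).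
Proof.
move=> E1 he nb h; set n := size bs.
have hrow (i : 'I_n) : exists c : 'I_n -> K, (forall k, E (c k)) /\ e * bs`_i = \sum_k c k * bs`_k.
  have : scar (E * span bs) (e * bs`_i).
    by apply: h; apply: mulS_mem; [exact: prin_id|apply: span_mem; apply: mem_nth].
  elim/mulset_ind.
  - by exists (fun=> 0); split; [move=> k; apply: smod0|rewrite big1 // => k _; rewrite mul0r].
  - move=> x y [c [hc ->]] [d [hd ->]]; exists (fun k => c k + d k); split; first by move=> k; apply: smodD.
    by rewrite -big_split; apply: eq_bigr => k _; rewrite mulrDl.
  - move=> x y hx; rewrite spanE => -[c [hc ->]]; exists (fun k => x * c k); split.
      by move=> k; have [r ->] := hc k; rewrite mulrC; apply: smodZ.
    by rewrite mulr_sumr; apply: eq_bigr => k _; rewrite mulrA.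
pose M := \matrix_(i < n, k < n) projT1 (cid (hrow i)) k.
have hM i k : E (M i k) by rewrite mxE; case: cid => c [].
pose v : 'cV[K]_n := \col_i bs`_i.
have nv : v != 0.
  have /hasP[b hb nbb] := proj1 (span_neq0 bs) nb.
  apply: contra nbb => /eqP v0; have hi : (index b bs < n)%N by rewrite index_mem.
  by have := congr1 (fun w : 'cV[K]_n => w (Ordinal hi) 0) v0; rewrite !mxE /= nth_index // => ->.
have hv : (e%:M - M) *m v = 0.
  apply/colP => i; rewrite mulmxBl mul_scalar_mx !mxE; apply/eqP; rewrite subr_eq0; apply/eqP.
  by rewrite /M; under eq_bigr do rewrite !mxE; case: cid => c [].
have d0 : \det (e%:M - M) = 0.
  apply/eqP; apply: contraNT nv => nd.
  have uM : e%:M - M \in unitmx by rewrite unitmxE unitfE.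
  by rewrite -[v](mulKmx uM) hv mulmx0.
have h1 i j : scar (1 : smod R) ((e%:M : 'M[K]_n) i j).
  by rewrite mxE mulrb; case: ifP => // _; apply: (smod0 1).
have eM i j : (e%:M - M) i j = (e%:M : 'M[K]_n) i j - M i j by rewrite !mxE.
rewrite -det_scalar -[\det _]subr0 -d0; apply: det_congruent => // i j.
  by rewrite eM; apply: smodD => //; apply: smodN; apply: E1.
by rewrite eM subKr.
Qed.

(** The determinant trick puts a power of each generator of [J] in [E], and these powers still
    generate a big ideal. *)
Lemma big_nakayama (B J E : smod R) : fg B -> B != 0 -> fg J -> big J -> E ≤ 1 -> B * J ≤ E * B -> big E.
Proof.
move=> [bs ->] nB fJ bJ E1 h; have [js ej] := fg_le1 fJ (big_le1 bJ).
have : big (\sum_(j <- js) prin (emb j) ^+ size bs).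
  apply: big_sum_exp => [j _|]; first exact: prin_le1.
  by move: bJ; rewrite ej /span big_map.
move=> b1; apply: (big_le b1) => //; apply: leS_sum => j hj; rewrite -prinX; apply/prin_le.
apply: power_in_ideal => //; first by exists j.
apply: leS_trans h; rewrite mulrC; apply: leS_mull.
by apply/prin_le; rewrite ej; apply: span_mem; apply: map_f.
Qed.

(** Iterated Dedekind-Mertens, with all auxiliary powers gathered in one nonzero cofactor [W]. It is
    removed later by [big_nakayama] or by invertibility. *)
Lemma A_prod_dedekind_mertens (I : eqType) (r : seq I) (g : I -> {poly R}) : (forall i, g i != 0) ->
  exists W, [/\ fgh W, W != 0 & (\prod_(i <- r) A (g i)) * W ≤ A (\prod_(i <- r) g i) * W].
Proof.
move=> ng; elim: r => [|i r [W [hW nW h]]].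
  by exists 1; rewrite !big_nil A_1; split; [exact: (fgh1 hgr)|exact: one_neq0|exact: leS_refl].
rewrite !big_cons; set P := \prod_(j <- r) g j.
have [k hk] := A_dedekind_mertens hgr (g i) P.
exists (A (g i) ^+ k * W); split.
- by apply: fghM => //; apply: (fgh_X hgr); apply: fgh_A.
- by apply: mulS_neq0 => //; apply: expS_neq0; apply: A_neq0.
- rewrite mulrACA -exprS; apply: (leS_trans (leS_mull _ h)).
  rewrite mulrA; apply: (leS_trans (leS_mulr _ hk)); rewrite [A (g i * P) * _]mulrCA mulrA.
  exact: leS_refl.
Qed.

Lemma A_prod (I : finType) (P : pred I) (g : I -> {poly R}) :
  A (\prod_(i | P i) g i) ≤ \prod_(i | P i) A (g i).
Proof.
apply: (big_ind2 (fun p (E : smod R) => A p ≤ E)) => [|p E q F hE hF|i _]; last exact: leS_refl.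
  by rewrite A_1; apply: leS_refl.
by apply: (leS_trans (A_M hgr _ _)); apply: leS_mul.
Qed.

Lemma below_prod_swap (m : nat) (f g h : 'I_m -> {poly R}) j :
  A (f j) * A (h j) ⊑ A (g j) * A (h j) ->
  A (f j) * (\prod_(l | l != j) A (g l)) * (\prod_l A (h l)) ⊑ (\prod_l A (g l)) * (\prod_l A (h l)).
Proof.
move=> e; rewrite [\prod_l A (h l)](bigD1 j) // [\prod_l A (g l)](bigD1 j) //=.
by rewrite mulrACA [X in _ ⊑ X]mulrACA; apply: below_mulr.
Qed.

Lemma cancel_div (F : fieldType) (u p c f : F) : u != 0 -> u * p * (c * (f / u)) = c * f * p.
Proof. by move=> nu; field. Qed.

(* Clearing denominators and multiplying by the contents that witness [y j] in KR gives an ideal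
   [B] with [B] locally contained in [(\sum_j A (c j)) * B]; then [big_nakayama] applies. *)
Lemma KR_unit_content (m : nat) (c : 'I_m -> {poly R}) (y : 'I_m -> L) :
  (forall j, KR (y j)) -> 1 = \sum_j embP (c j) * y j -> big (\sum_j A (c j)).
Proof.
move=> hy e1.
have hy_ j := cid (proj1 (KRP (y j)) (hy j)).
pose f j := projT1 (hy_ j); pose g j := projT1 (cid (projT2 (hy_ j))).
have hfg j : g j != 0 /\ (exists h, h != 0 /\ A (f j) * A h ⊑ A (g j) * A h) /\ y j = embP (f j) / embP (g j).
  by rewrite /g /f; case: cid.
have ng j : g j != 0 by case: (hfg j).
pose h j := projT1 (cid (proj1 (proj2 (hfg j)))).
have hh j : h j != 0 /\ A (f j) * A (h j) ⊑ A (g j) * A (h j) by rewrite /h; case: cid.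
have ey j : y j = embP (f j) / embP (g j) by case: (hfg j) => _ [].
have eg : \prod_j g j = \sum_j c j * f j * \prod_(l | l != j) g l.
  apply: embP_inj; rewrite -[LHS]mulr1 e1 mulr_sumr embP_sum; apply: eq_bigr => j _.
  rewrite (bigD1 j) //= !embP_M ey.
  by apply: cancel_div; rewrite embP_eq0.
have [W [hW nW hGW]] := A_prod_dedekind_mertens (index_enum 'I_m) ng.
set Gg := \prod_j A (g j) in hGW; set H := \prod_j A (h j).
have nH : H != 0 by rewrite /H; elim/big_rec: _ => [|j x _ nx]; [exact: one_neq0|apply: mulS_neq0 => //; apply: A_neq0; case: (hh j)].
have nG : Gg != 0 by rewrite /Gg; elim/big_rec: _ => [|j x _ nx]; [exact: one_neq0|apply: mulS_neq0 => //; apply: A_neq0].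
have fprod (q : 'I_m -> {poly R}) : fgh (\prod_j A (q j)).
  by elim/big_rec: _ => [|j x _ hx]; [exact: (fgh1 hgr)|apply: fghM => //; apply: fgh_A].
set E := \sum_j A (c j).
have key : A (\prod_j g j) * H ⊑ E * (Gg * H).
  apply: (below_trans fghM (F := (\sum_j A (c j * f j * \prod_(l | l != j) g l)) * H)).
    by apply: (below_le (fgh1 hgr)); rewrite eg; apply: leS_mulr; apply: A_sum.
  rewrite mulr_suml; apply: (below_sum (fgh1 hgr) fghM) => j _.
  have [_ hj] := hh j; have := below_mulr (A (c j)) (below_prod_swap hj); rewrite -/Gg -/H => hb.
  apply: (below_trans fghM (F := A (f j) * (\prod_(l | l != j) A (g l)) * H * A (c j))).
    apply: (below_le (fgh1 hgr)); rewrite [X in _ ≤ X]mulrC !mulrA; apply: leS_mulr.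
    apply: (leS_trans (A_M hgr _ _)); apply: leS_mul; [exact: A_M|exact: A_prod].
  apply: (below_trans fghM hb); apply: (below_le (fgh1 hgr)); rewrite mulrC; apply: leS_mulr.
  by apply: (leS_bigsum (f := fun j => A (c j))); rewrite mem_index_enum.
(* The factor [W] turns the content of the product of the [g j] into the product of contents, so
   that the same ideal stands on both sides. *)
have [J [hJ bJ hk]] : Gg * W * H ⊑ E * (Gg * W * H).
  apply: (below_trans fghM (F := A (\prod_j g j) * H * W)).
    by apply: (below_le (fgh1 hgr)); rewrite [X in _ ≤ X]mulrAC; apply: leS_mulr.
  rewrite [Gg * W * H]mulrAC mulrA; exact: below_mulr.
apply: (big_nakayama _ _ _ bJ _ hk).
- by apply: (fgh_fg (Rg := Rg)); apply: fghM; [apply: fghM => //; apply: fprod|apply: fprod].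
- by apply: mulS_neq0 => //; apply: mulS_neq0.
- exact: fgh_fg hJ.
- by apply: leS_sum => j _; apply: A_le1.
Qed.

Lemma KR_1 : KR 1.
Proof. by apply: NA_sub_KR; apply: NA_1. Qed.

(** Flatness is applied to the relation [f x - b = 0] for [x = b / f] in [KR]. It yields
    [f * c ord0 j = b c i1 j] for all [j], together with an expression of [1] through the [c i1 j],
    whose contents are therefore jointly big. *)
Lemma flat_invertible : flat_RX KR -> all_invertible.
Proof.
move=> hflat; apply: invertible_of_pairs => a b ha hb na nb.
set f := a%:P + b%:P * 'X; have nf : f != 0 by apply: pair_neq0.
have Af : A f = prin (emb a) + prin (emb b) by apply: A_pair.
have nfe : embP f != 0 by rewrite embP_eq0.
have hx : KR (embP b%:P / embP f).
  apply/KRP; exists b%:P, f; split=> //; split=> //; exists 1; split; first exact: oner_neq0.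
  apply: below_mulr; apply: (below_le (fgh1 hgr)); rewrite A_const C_hom // Af; exact: leS_addr.
have [x ex] : exists x, x = embP b%:P / embP f by exists (embP b%:P / embP f).
rewrite -ex in hx; have exf : embP f * x = embP b%:P by rewrite ex mulrC divfK.
pose al (i : 'I_2) : {poly R} := if i == ord0 then f else - b%:P.
pose be (i : 'I_2) : L := if i == ord0 then x else 1.
have hbe i : KR (be i) by rewrite /be; case: ifP => _; [exact: hx|exact: KR_1].
have rel : \sum_i embP (al i) * be i = 0.
  rewrite big_ord_recl big_ord1; change (embP f * x + embP (- b%:P) * 1 = 0).
  by rewrite mulr1 exf -embP_D subrr embP_0.
have [m [c [y [hy eb ec]]]] := hflat 2%N al be hbe rel.
pose i1 : 'I_2 := lift ord0 ord0.
have e1 : 1 = \sum_j embP (c i1 j) * y j by rewrite -(eb i1).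
have rc j : f * c ord0 j = b%:P * c i1 j.
  have := ec j; rewrite big_ord_recl big_ord1; change (f * c ord0 j + (- b%:P) * c i1 j = 0 -> f * c ord0 j = b%:P * c i1 j).
  by rewrite mulNr => /eqP; rewrite subr_eq0 => /eqP.
have bE := KR_unit_content hy e1.
(* Since [f = a + b X], the multiple [a / b] of [c ord0 j] is again a polynomial; this keeps the
   product of the candidate inverse with [a] inside [R]. *)
have rc2 j : a *: c ord0 j = b *: (c i1 j - 'X * c ord0 j).
  rewrite -!mul_polyC mulrBr -rc /f; ring.
exists (\sum_j prin (emb b)^-1 * A (c ord0 j)).
have T1 : (\sum_j prin (emb b)^-1 * A (c ord0 j)) * (prin (emb a) + prin (emb b)) ≤ 1.
  rewrite mulr_suml; apply: leS_sum => j _; rewrite mulrDr (A_swap ha hb nb (rc2 j)).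
  rewrite (A_swap hb hb nb (erefl _)); apply: leS_add; exact: A_le1.
split=> //.
  by apply: fgh_sum => j _; apply: fghM; [exact: fgh_pV|exact: fgh_A].
apply: (big_le bE) => //; rewrite mulr_suml; apply: leS_sum => j _.
apply: leS_trans (leS_bigsum (f := fun j => prin (emb b)^-1 * A (c ord0 j) * (prin (emb a) + prin (emb b))) (mem_index_enum j)).
have nbe : emb b != 0 by rewrite emb_eq0.
apply: (prin_cancel nbe); rewrite -(A_Z hgr _ hb) -mul_polyC -rc -mulrA mulrA -prinM mulfV // prin1 mul1r -Af mulrC.
exact: A_M.
Qed.

(** * Integral closedness of the tilde-closure *)

Lemma expS_mem (E : smod R) x n : E x -> scar (E ^+ n) (x ^+ n).
Proof.
move=> h; elim: n => [|n ih]; first by exists 1; rewrite emb1.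
by rewrite !exprS; apply: mulS_mem.
Qed.

Local Notation fg1 := (fg1 hgr).

Lemma below_absorb Q E F J : Q J -> (forall E F, Q E -> Q F -> Q (E * F)) -> big J ->
  below Q (E * J) F -> below Q E F.
Proof.
move=> QJ QM bJ [J' [QJ' bJ' h]]; exists (J * J'); split; [exact: QM|exact: big_M|].
by rewrite mulrA.
Qed.

Lemma tilde_one_st z : tilde (@Rset R) z -> st (@Rset R) z.
Proof.
move=> /(star_tildeE 1)[J [fJ bJ h]].
have [F eF nF] := st_smod one_neq0; rewrite -[@Rset R]/(scar 1) -eF.
have [->|nz] := eqVneq z 0; first exact: smod0.
have nzJ : prin z * J != 0 by apply: mulS_neq0; [exact: prin_neq0|exact: big_neq0].
have := st_mono nzJ h; rewrite /leS prin_mulE eF; apply.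
case: hst => _ /(_ z J nz (nzS (big_neq0 bJ)) z) hs _ _ _; apply/hs.
by exists 1; rewrite mulr1; split=> //; apply: big_one.
Qed.

Lemma invertible_integrally_closed : all_invertible -> subs (st (@Rset R)) (RH Rg) ->
  integrally_closed_in_K (tilde (@Rset R)).
Proof.
move=> hinv hRH x [p [mp hp rx]].
have [w [d [hd [nd ex]]]] : RH Rg x.
  by apply: (RH_integrally_closed hgr mp) => // i; apply: hRH; apply: tilde_one_st.
have nde : emb d != 0 by rewrite emb_eq0.
have [w0|nw] := eqVneq w 0.
  apply/(star_tildeE 1); exists 1; split; [exact: fg1|exact: big1S|].
  by rewrite ex w0 emb0 mul0r prin0 mul0r; apply: leS0.
have sp : (1 < size p)%N := root_size_gt1 (monic_neq0 mp) rx.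
have [k ek] : exists k, size p = k.+2 by case: (size p) sp => [|[|k]] // _; exists k.
set E := C w + prin (emb d); set F := prin (emb d) * E ^+ k.
have fE : fgh E by apply: fgh_D; [exact: fgh_C|apply: fgh_prin; exact: homKe].
have fF : fgh F by apply: fghM; [apply: fgh_prin; exact: homKe|exact: (fgh_X hgr)].
have Ew : E (emb w) by apply: leS_addl; apply: C_id.
have Ed : E (emb d) by apply: leS_addr; apply: prin_id.
(* One big ideal brings all the lower coefficients of the integral equation into [R]. *)
have [J [fJ bJ hJ]] : below fg (span [seq p`_i | i <- iota 0 k.+1]) 1.
  by apply: (below_sum fg1 (@fgM _)) => _ /mapP[i _ ->]; apply/(star_tildeE 1).
have [js ej] := fg_le1 fJ (big_le1 bJ).
have jF j : j \in js -> F (emb (j * w ^+ k.+1)).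
  move=> hj; have exn : x ^+ k.+1 = - \sum_(i < k.+1) p`_i * x ^+ i.
    move/rootP: rx; rewrite horner_coef ek big_ord_recr /= -[k.+1]/(k.+2.-1) -ek -lead_coefE (monicP mp) mul1r.
    by move/eqP; rewrite addrC addr_eq0 ek => /eqP.
  have ewx : emb w = emb d * x by rewrite ex mulrC divfK.
  rewrite embM embX {1}ewx exprMn exn mulrN mulrN; apply: smodN.
  rewrite mulr_sumr mulr_sumr; apply: smod_sum => i _ _.
  have [r er] : scar (1 : smod R) (p`_i * emb j).
    apply: hJ; apply: mulS_mem; first by apply: span_mem; apply: (map_f (fun i => p`_i)); rewrite mem_iota /= ltn_ord.
    by rewrite ej; apply: span_mem; apply: map_f.
  have ik : (i <= k)%N by rewrite -ltnS.
  have -> : emb j * (emb d ^+ k.+1 * (p`_i * x ^+ i)) = emb r * (emb d * (emb w ^+ i * emb d ^+ (k - i))).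
    rewrite -er ewx exprMn exprS -{1}(subnK ik) exprD; ring.
  (* As [i] is at most [k], a factor [d] is left over beside the [k] factors from [E]; it is the one
     in the definition of [F]. *)
  apply: smodZ; apply: mulS_mem; first exact: prin_id.
  have -> : E ^+ k = E ^+ i * E ^+ (k - i) by rewrite -exprD subnKC.
  by apply: mulS_mem; apply: expS_mem.
pose s := \poly_(i < size js) js`_i.
have bs : big (A s).
  apply: (big_le bJ); last exact: A_le1.
  rewrite ej; apply/span_le => _ /mapP[j hj ->]; have hi : (index j js < size js)%N by rewrite index_mem.
  by have := A_id hgr s (index j js); rewrite coef_poly hi nth_index.
have hs : A (s * (w ^+ k.+1)%:P) ≤ F.
  apply/A_le => i a; rewrite coefMC coef_poly; case: ltnP => hi.
    by apply: (fgh_comp (hgr := hgr) fF); [apply: jF; apply: mem_nth|apply: C_mem].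
  by rewrite mul0r comp0 emb0; apply: smod0.
(* [J] need not be homogeneous, so it is traded for the big homogeneous ideal [A s ^+ m.+1] by
   Dedekind-Mertens. *)
have cF : C (w ^+ k.+1) ⊑ F.
  have [m hm] := A_dedekind_mertens hgr s (w ^+ k.+1)%:P.
  exists (A s ^+ m.+1); split; [by apply: (fgh_X hgr); apply: fgh_A|exact: big_X|].
  rewrite -A_const mulrC; apply: leS_trans hm _; apply: leS_trans hs; apply: mulS_le1l.
  by apply: expS_le1; apply: A_le1.
have nwP : w%:P != 0 by rewrite polyC_eq0.
have [W [hW nW hCW]] := A_prod_dedekind_mertens (index_enum 'I_k.+1) (g := fun=> w%:P) (fun=> nwP).
rewrite !prodr_const card_ord -polyC_exp !A_const in hCW.
have key : C w * (E ^+ k * W) ⊑ prin (emb d) * (E ^+ k * W).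
  (* [C w * E ^+ k] lies in [E ^+ k.+1], which [exp_split] divides into a part with a factor [d] and
     the power of [C w]. With the cofactor [W] that power becomes the content of [w ^+ k.+1], which
     [cF] bounds. *)
  apply: (below_trans fghM (F := prin (emb d) * (E ^+ k * W) + C (w ^+ k.+1) * W)).
    apply: (below_le (fgh1 hgr)); apply: (@leS_trans _ (E ^+ k.+1 * W)).
      by rewrite mulrA exprS; apply: leS_mulr; apply: leS_mulr; apply: leS_addl.
    apply: (@leS_trans _ ((prin (emb d) * E ^+ k + C w ^+ k.+1) * W)).
      apply: leS_mulr; apply: exp_split; rewrite /E.
      - by rewrite addrC; apply: leS_refl.
      - exact: leS_addr.
      - exact: leS_addl.
    by rewrite mulrDl -mulrA; apply: leS_addS; [exact: leS_refl|].
  apply: (below_add fghM); first by apply: (below_le (fgh1 hgr)); apply: leS_refl.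
  by rewrite mulrA; apply: below_mulr.
have fEW : fgh (E ^+ k * W) by apply: fghM => //; apply: (fgh_X hgr).
have nEW : E ^+ k * W != 0.
  apply: mulS_neq0 => //; apply: expS_neq0; apply/neq0S; by exists (emb d).
have [J' [hJ' bJ' h']] := invertS_cancel fEW (hinv _ fEW nEW) key.
apply/(star_tildeE 1); exists J'; split=> //; first exact: fgh_fg hJ'.
apply: (prin_cancel nde); rewrite mulrA -prinM mulr1 ex [emb d * _]mulrC divfK //.
by apply: leS_trans h'; apply: leS_mulr; apply/prin_le; apply: C_id.
Qed.

Lemma fg_stable_integral (e : K) (ys : seq K) : has (fun y => y != 0) ys ->
  (forall y, y \in ys -> span ys (e * y)) ->
  exists p : {poly K}, [/\ p \is monic, (forall i, Rset p`_i) & root p e].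
Proof.
move=> /hasP[y0 hy0 ny0] h; set n := size ys.
have hc_ (i : 'I_n) : exists c : nat -> R, e * ys`_i = \sum_(k < n) emb (c k) * ys`_k.
  have := h _ (mem_nth 0 (ltn_ord i)); rewrite spanE => -[c [hc ->]].
  exists (fun k => projT1 (cid (hc k))); apply: eq_bigr => k _; congr (_ * _).
  by case: cid => r /= ->.
pose c i := projT1 (cid (hc_ i)).
have hc (i : 'I_n) : e * ys`_i = \sum_(k < n) emb (c i k) * ys`_k by rewrite /c; case: cid.
(* Transposed, because eigenvectors are row vectors. *)
pose M := \matrix_(k < n, i < n) c i k.
pose v : 'rV[K]_n := \row_i ys`_i.
exists (map_poly (@FracField.tofrac R) (char_poly M)); split.
- by rewrite monic_map // char_poly_monic.
- by move=> i; rewrite coef_map; exists (char_poly M)`_i.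
- rewrite map_char_poly -eigenvalue_root_char; apply/eigenvalueP; exists v.
    by apply/rowP => i; rewrite !mxE hc; apply: eq_bigr => k _; rewrite !mxE mulrC.
  apply: contra ny0 => /eqP v0; have hi : (index y0 ys < n)%N by rewrite index_mem.
  by have := congr1 (fun w : 'rV[K]_n => w 0 (Ordinal hi)) v0; rewrite !mxE /= nth_index // => ->.
Qed.

(** * The e.a.b. closure *)

Definition tilde_a_eq := forall E, fgh E -> E ≤ 1 -> E != 0 -> seteq (tilde E) (star_a tilde E).

Lemma ideal_tilde_a : (forall I : R -> Prop, idealR I -> homogR Rg I -> fgR I -> nonzeroR I ->
   seteq (tilde (embK I)) (star_a tilde (embK I))) <-> tilde_a_eq.
Proof.
split=> [h E hE E1 nE|h I iI hI fI nI].
  have [I [iI hI fI nI <-]] := ideal_of_fgh hE E1 nE; exact: h.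
by have [E [hE E1 nE ->]] := fgh_of_ideal iI hI fI nI; apply: h.
Qed.

Lemma tilde_sub_tilde_a E : fg E -> E != 0 -> subs (tilde E) (star_a tilde E).
Proof.
move=> [xs ->] nE x /star_tildeE[J [fJ bJ h]]; exists xs; split; first exact/span_neq0.
split; first by rewrite -spanE.
exists [:: 1]; split; first by rewrite /= oner_neq0.
rewrite -!spanE span1 prin1 -mulSE mulr1 => y /star_tildeE[J' [fJ' bJ' h']].
apply/star_tildeE; exists (J * J'); split; [exact: fgM|exact: big_M|].
by rewrite prinM mulrACA -[span xs]mulr1; apply: leS_mul.
Qed.

Lemma tilde_a_intro E B x : fg E -> E != 0 -> fg B -> B != 0 -> prin x * B ≤ E * B -> star_a tilde E x.
Proof.
move=> [xs ->] nE [ys ->] nB h; exists xs; split; first exact/span_neq0.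
split; first by rewrite -spanE.
exists ys; split; first exact/span_neq0.
rewrite -!spanE -mulSE => y /star_tildeE[J [fJ bJ h']].
apply/star_tildeE; exists J; split=> //; rewrite prinM -mulrA.
by apply: leS_trans h; apply: leS_mull.
Qed.

(** Let [Y] be the span of [ys], so [x Y] is locally in [E Y]. For [w] in [x T] it follows that
    [w Y] is locally in [Y], since [T E] lies in [R]. Thus [w] times a big ideal is integral over
    [R] and lies in the tilde-closure of [R]. Hence [x T] is locally in [R], and multiplying by [E]
    brings [x] into the closure of [E], as [T E] is big. *)
Lemma tilde_a_sub_tilde E : integrally_closed_in_K (tilde (@Rset R)) -> fgh E -> invertS E ->
  subs (star_a tilde E) (tilde E).
Proof.
move=> hic hE [T [hT T1 bT]] x [xs [nx [hx [ys [ny hc]]]]].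
rewrite -!spanE in hx hc; rewrite -mulSE in hc.
have fGM := @fgM R; have f1 := fg1.
have fTE : fg (T * E) by apply: fGM; apply: (fgh_fg (Rg := Rg)).
have hxy : below fg (prin x * span ys) (E * span ys).
  rewrite /span big_distrr; apply: (below_sum f1 fGM) => y hy /=; rewrite -prinM.
  have hyt : tilde (span ys) y.
    apply/star_tildeE; apply: (below_le f1); apply/prin_le; exact: span_mem.
  have /star_tildeE h := hc y hyt; apply: (below_trans fGM h); apply: (below_le f1).
  exact: leS_mulr.
have hw w : scar (prin x * T) w -> below fg (prin w) 1.
  move=> hwT; have [J [fJ bJ h]] : below fg (prin w * span ys) (span ys).
    have h1 : prin w * span ys ≤ T * (prin x * span ys).
      by rewrite mulrA; apply: leS_mulr; apply/prin_le; rewrite mulrC.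
    apply: (below_trans fGM (below_le f1 h1)).
    have := below_mulr T hxy; rewrite mulrC => h2; apply: (below_trans fGM h2).
    apply: (below_le f1); rewrite mulrC mulrA; exact: mulS_le1l.
  apply: (below_absorb fJ fGM bJ); have [js ej] := fJ.
  rewrite ej /span big_distrr; apply: (below_sum f1 fGM) => j hj /=; rewrite -prinM.
  have [y hy|p [mp hp rp]] := @fg_stable_integral (w * j) ys ny.
    apply: h; rewrite [w * j * y]mulrAC; apply: mulS_mem; last by rewrite ej; apply: span_mem.
    by apply: mulS_mem; [exact: prin_id|exact: span_mem].
  apply/(star_tildeE 1); apply: hic; exists p; split=> // i.
  by apply/(star_tildeE 1); apply: (below_le f1); apply/prin_le; apply: hp.
apply/star_tildeE; apply: (below_absorb fTE fGM bT).
rewrite mulrA -[X in below _ _ X]mul1r; apply: below_mulr.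
have [ts [_ eT]] := hT; rewrite eT /span big_distrr; apply: (below_sum f1 fGM) => t ht /=.
rewrite -prinM; apply: hw; apply: mulS_mem; first exact: prin_id.
by rewrite eT; apply: span_mem.
Qed.

Lemma invertible_tilde_a : all_invertible -> subs (st (@Rset R)) (RH Rg) -> tilde_a_eq.
Proof.
move=> hinv hRH E hE E1 nE x; split.
  by apply: tilde_sub_tilde_a => //; apply: fgh_fg hE.
by apply: tilde_a_sub_tilde => //; [exact: invertible_integrally_closed|exact: hinv].
Qed.

Lemma quadratic_roots (F : fieldType) (a b c r s : F) : a != 0 -> b != 0 ->
  c * (a * b) = a * a * r + b * b * s -> r * (a / b) + s * (b / a) = c /\ r * (a / b) * (s * (b / a)) = r * s.
Proof.
move=> na nb e; split; last by field; rewrite na nb.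
apply: (mulIf (mulf_neq0 na nb)); rewrite e; field; by rewrite na nb.
Qed.

(* From [c a b = r a^2 + s b^2] the elements [r a / b] and [s b / a] have sum [c] and product
   [r s], so both are integral. *)
Lemma tilde_a_pair a b c : tilde_a_eq -> hom a -> hom b -> a != 0 -> b != 0 -> hom c ->
  scar (prin (emb (a * a)) + prin (emb (b * b))) (emb (c * (a * b))) ->
  exists T, [/\ fgh T, T * (prin (emb a) + prin (emb b)) ≤ 1
    & prin (emb c) ⊑ T * (prin (emb a) + prin (emb b))].
Proof.
move=> h9 [da ha] [db hb] na nb [dc hc] [_ [_ [/prinP[r ->] [/prinP[s ->] e]]]].
have {}e : c * (a * b) = a * a * r + b * b * s by apply: emb_inj; rewrite e embD !embM.
(* [dl] is the degree of [c a b]; comparing components in this degree replaces [r] and [s] by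
   homogeneous elements. *)
pose dl := dc + (da + db); pose r' := comp r (dl - (da + da)); pose s' := comp s (dl - (db + db)).
have e2 : c * (a * b) = a * a * r' + b * b * s'.
  have haa := RgM hgr ha ha; have hbb := RgM hgr hb hb.
  have hcab := RgM hgr hc (RgM hgr ha hb).
  rewrite -(compMl hgr r dl haa) -(compMl hgr s dl hbb) -compD -e (compE hgr _ hcab) eqxx //.
have hr' : hom r' by apply: comp_hom.
have hs' : hom s' by apply: comp_hom.
have nae : emb a != 0 by rewrite emb_eq0.
have nbe : emb b != 0 by rewrite emb_eq0.
pose x := emb r' * (emb a / emb b); pose y := emb s' * (emb b / emb a).
have [exy pxy] : x + y = emb c /\ x * y = emb r' * emb s'.
  by apply: quadratic_roots; rewrite // -!embM -embD e2.
have hab u v : hom u -> hom v -> v != 0 -> homK Rg (emb u / emb v).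
  by move=> hu hv nv; exists u, v.
have hx : homK Rg x by apply: (homK_M hgr); [exact: homKe|apply: hab => //; [exists da|exists db]].
have hy : homK Rg y by apply: (homK_M hgr); [exact: homKe|apply: hab => //; [exists db|exists da]].
have root_tilde z z' : z + z' = emb c -> z * z' = emb r' * emb s' -> below fg (prin z) 1.
  (* The ideal [(1, z)] is stable under [z] by the quadratic equation, so [z] lies in the e.a.b.
     closure of [R], which (9) identifies with the tilde-closure. *)
  move=> ez pz; apply/(star_tildeE 1)/(h9 1 (fgh1 hgr) (leS_refl 1) one_neq0).
  apply: (@tilde_a_intro 1 (span [:: 1; z])); [exact: fg1|exact: one_neq0|by exists [:: 1; z]| |].
    by apply/span_neq0; rewrite /= oner_neq0.
  rewrite mul1r span2 prin1 mulrDr mulr1 -prinM; apply: leS_add; first exact: leS_addr.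
  apply/prin_le; have -> : z * z = emb c * z - emb (r' * s').
    by rewrite embM -pz -ez mulrDl [z' * z]mulrC addrK.
  apply: smodD; first by apply: smodZ; apply: leS_addr; apply: prin_id.
  by apply: smodN; apply: leS_addl; exists (r' * s').
have [J [hJ bJ hxyJ]] : prin x + prin y ⊑ 1.
  apply: (below_fgh (fgh_D (fgh_prin hx) (fgh_prin hy)) (fgh1 hgr)).
  apply: (below_add (@fgM _)); first exact: root_tilde exy pxy.
  by apply: (root_tilde y x); rewrite 1?addrC // mulrC.
(* The product of this ideal with [(a, b)] is generated by [s'], [r'], [x] and [y]. It contains
   [c = x + y], and a big ideal brings it into [R]. *)
pose T := prin (emb s' / emb a) + prin (emb r' / emb b).
have eT : T * (prin (emb a) + prin (emb b)) = prin (emb s') + prin (emb r') + (prin x + prin y).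
  have ey : emb s' / emb a * emb b = y by rewrite -mulrA [_^-1 * _]mulrC.
  have ex : emb r' / emb b * emb a = x by rewrite -mulrA [_^-1 * _]mulrC.
  rewrite /T mulrDl !mulrDr -!prinM ey ex !divfK //.
  by rewrite [prin x + prin (emb r')]addrC addrACA [prin y + prin x]addrC.
exists (T * J); split.
- apply: fghM => //; apply: fgh_D; apply: fgh_prin; apply: hab => //; [exists da|exists db] => //.
- rewrite mulrAC eT mulrDl; apply: leS_add => //.
  rewrite -[1]mulr1; apply: leS_mul; last exact: big_le1.
  by apply: leS_add; apply: prin_le1.
- exists J; split=> //; rewrite mulrAC eT; apply: leS_mulr; apply: leS_trans (leS_addr _ _).
  rewrite -exy; apply/prin_le; exists x, y; do !split; exact: prin_id.
Qed.

(** Since [a b (a, b)] lies in [(a^2, b^2) (a, b)], the element [a b] is in the e.a.b. closure of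
    [(a^2, b^2)]. By (9) some big homogeneous [J] multiplies it into that ideal, and [tilde_a_pair]
    is applied to each generator of [J]. *)
Lemma tilde_a_invertible : tilde_a_eq -> all_invertible.
Proof.
move=> h9; apply: invertible_of_pairs => a b ha hb na nb.
set B := prin (emb a) + prin (emb b); set E := prin (emb (a * a)) + prin (emb (b * b)).
have hB : fgh B by apply: fgh_D; apply: fgh_prin; apply: homKe.
have hE : fgh E by apply: fgh_D; apply: fgh_prin; apply: homKe; apply: (homM hgr).
have nE : E != 0.
  by apply/neq0S; exists (emb (a * a)); rewrite emb_eq0 mulf_neq0 //; split=> //; apply: leS_addl; apply: prin_id.
have nB : B != 0.
  by apply/neq0S; exists (emb a); rewrite emb_eq0; split=> //; apply: leS_addl; apply: prin_id.
have E1 : E ≤ 1 by apply: leS_add; apply: prin_le1.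
have hab : tilde E (emb (a * b)).
  apply/(h9 E hE E1 nE); apply: (tilde_a_intro (fgh_fg hE) nE (fgh_fg hB) nB).
  rewrite /B /E !embM !prinM; set X := prin (emb a); set Y := prin (emb b).
  rewrite (_ : X * Y * (X + Y) = X * X * Y + Y * Y * X); last by ring.
  rewrite mulrDl !mulrDr; apply: leS_addS; [exact: leS_addr|exact: leS_addl].
have habh : homK Rg (emb (a * b)) by apply: homKe; apply: (homM hgr).
have [J [hJ bJ h]] := below_fgh (fgh_prin habh) hE (proj1 (star_tildeE _ _) hab).
have [js [hj ej]] := fgh_le1 hgr hJ (big_le1 bJ).
have [T [hT T1 hT']] : exists T, [/\ fgh T, T * B ≤ 1 & J ⊑ T * B].
  have {bJ h} hjE j : j \in js -> scar E (emb (j * (a * b))).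
    move=> jin; apply: h; rewrite [emb (j * _)]embM [emb j * _]mulrC; apply: mulS_mem; first exact: prin_id.
    by rewrite ej; apply: span_mem; apply: map_f.
  rewrite ej; elim: js hj hjE {ej} => [|j js IH] hj hjE.
    exists 0; rewrite mul0r /span big_nil; split; [exact: fgh0|exact: leS0|].
    by apply: (below_le (fgh1 hgr)); apply: leS_refl.
  have [|i hi|T [hT T1 hT']] := IH; first by move=> i hi; apply: hj; rewrite inE hi orbT.
    by apply: hjE; rewrite inE hi orbT.
  have [T' [hT2 T1' hT2']] := tilde_a_pair h9 ha hb na nb (hj j (mem_head _ _)) (hjE j (mem_head _ _)).
  exists (T + T'); rewrite mulrDl; split; [exact: fgh_D|exact: leS_add|].
  rewrite /span /= big_cons; apply: (below_add fghM).
    by apply: (below_trans fghM hT2'); apply: (below_le (fgh1 hgr)); apply: leS_addr.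
  by apply: (below_trans fghM hT'); apply: (below_le (fgh1 hgr)); apply: leS_addl.
have [J' [hJ' bJ' h']] := hT'.
by exists T; split=> //; apply: (big_le (big_M bJ bJ')).
Qed.

End Star.

Theorem theorem3p6 (R : idomainType) (G : zmodType) (Gam : G -> Prop)
  (Rg : G -> R -> Prop) (hgr : graded_domain Gam Rg)
  (st : ({fraction R} -> Prop) -> ({fraction R} -> Prop)) (hst : semistar st)
  (hRH : subs (st (@Rset R)) (RH Rg) /\ exists x, RH Rg x /\ ~ st (@Rset R) x) :
  let P1 := GPsMD Rg st in
  let P2 := forall J, ideal (NA Rg st) J ->
              exists I, [/\ idealR I, homogR Rg I & seteq J (extended I (NA Rg st))] in
  let P3 := forall x, NA Rg st x ->
              exists I, [/\ idealR I, homogR Rg I &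
                seteq (dspan (NA Rg st) [:: x]) (extended I (NA Rg st))] in
  let P4 := prufer (NA Rg st) in
  let P5 := bezout (NA Rg st) in
  let P6 := seteq (NA Rg st) (KR Rg (star_tilde st)) in
  let P7 := quotient_ring_of_RX (KR Rg (star_tilde st)) in
  let P8 := flat_RX (KR Rg (star_tilde st)) in
  let P9 := forall I, idealR I -> homogR Rg I -> fgR I -> nonzeroR I ->
              seteq (star_tilde st (embK I)) (star_a (star_tilde st) (embK I)) in
  ((P1 <-> P2) /\ (P1 <-> P3) /\ (P1 <-> P4) /\ (P1 <-> P5) /\ (P1 <-> P6) /\
   (P1 <-> P7) /\ (P1 <-> P8) /\ (P1 <-> P9)) /\
  (P1 -> integrally_closed_in_K (star_tilde st (@Rset R))).
Proof.
have [hsub _] := hRH; have e1 := GPsMD_invertible hgr hst.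
have e9 := ideal_tilde_a hgr st.
have e13 : all_invertible Rg st -> forall x, NA Rg st x ->
    exists I, [/\ idealR I, homogR Rg I & seteq (dspan (NA Rg st) [:: x]) (extended I (NA Rg st))].
  by move=> h; apply: (extended_principal hgr hst); apply: (invertible_extended hgr hst).
have e16 := invertible_KR hgr hst; have e61 := flat_invertible hgr hst.
have e78 := @quotient_flat R (KR Rg (star_tilde st)); have e67 := KR_quotient hgr hst.
have e15 := invertible_bezout hgr hst; have e54 := bezout_prufer hgr hst.
have e41 := prufer_invertible hgr hst; have e31 := principal_extended_invertible hgr hst.
have e19 h := invertible_tilde_a hgr hst h hsub; have e91 := tilde_a_invertible hgr hst.
split; last by move=> /e1 h; apply: (invertible_integrally_closed hgr hst).
split; first by split=> [/e1/(invertible_extended hgr hst)//|/(extended_principal hgr hst)/e31/e1].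
split; first by split=> [/e1/e13//|/e31/e1].
split; first by split=> [/e1/e15/e54//|/e41/e1].
split; first by split=> [/e1/e15//|/e54/e41/e1].
split; first by split=> [/e1/e16//|/e67/e78/e61/e1].
split; first by split=> [/e1/e16/e67//|/e78/e61/e1].
split; first by split=> [/e1/e16/e67/e78//|/e61/e1].
by split=> [/e1/e19/e9//|/e9/e91/e1].
Qed.
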